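(* Let $f=\frac1N\sum_{i=1}^N f_i:\mathbb{R}^n\to\mathbb{R}$ be coercive, where each $f_i:\mathbb{R}^n\to\mathbb{R}$ is definable, locally Lipschitz continuous and admits a definable conservative field $\mathcal{D}_{f_i}$; put $\mathcal{D}_f(x):=\mathrm{conv}\big(\frac1N\sum_{i=1}^N\mathcal{D}_{f_i}(x)\big)$. Let $\varepsilon_0,\tau_1,\tau_2>0$ with $4\tau_1\ge\tau_2$, let $\rho\ge0$, let $\mathcal{V}:\mathbb{R}^n\times\mathbb{R}^n\rightrightarrows\mathbb{R}^n_+$ be nonempty convex-valued, compact-valued, locally bounded and graph-closed, and let $\mathcal{X}\subset\mathbb{R}^n\times\mathbb{R}^n\times\mathbb{R}^n$ be compact. Then there exists $\alpha_{ub}>0$ such that for every $\varepsilon>0$ there exists $\alpha>0$ with the following property. Let $\{\eta_k\}_{k\ge0}$ be any positive sequence with $\sum_k\eta_k=\infty$, with $\eta_{k_1}=\eta_{k_2}$ whenever $\lfloor k_1/N\rfloor=\lfloor k_2/N\rfloor$, and with $\sup_k\eta_k\le\alpha_{ub}$ and $\limsup_k\eta_k\le\alpha$. Let $\{i_k\}$ be any sequence in $[N]$ with $\{i_k:jN\le k<(j+1)N\}=[N]$ for all integers $j\ge0$. Then for every sequence $\{(x_k,m_k,v_k)\}$ with $(x_0,m_0,v_0)\in\mathcal{X}$ and, for all $k\ge0$, $$\begin{aligned}&g_k\in\mathcal{D}_{f_{i_k}}(x_k),\qquad m_{k+1}=m_k+\tau_1\eta_k(g_k-m_k),\\&v_{k+1}\in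 v_k+\tau_2\eta_k(\mathcal{V}(x_k,m_{k+1})-v_k),\\&x_{k+1}=x_k-\eta_k(\mathcal{P}_+(v_{k+1})+\varepsilon_0)^{-1/2}\odot(m_{k+1}+\rho g_k),\end{aligned}$$ we have $$\limsup_{k\to\infty}\mathrm{dist}\big(x_k,\{x:0\in\mathcal{D}_f(x)\}\big)\le\varepsilon,\qquad\limsup_{k\to\infty}\mathrm{dist}\big(f(x_k),\{f(x):0\in\mathcal{D}_f(x)\}\big)\le\varepsilon.$$
   Context: $[N]=\{1,\dots,N\}$; $\mathbb{R}^n_+$ is the set of nonnegative vectors and $\mathcal{P}_+$ the orthogonal projection onto it; $\odot$ and powers of vectors are element-wise, and adding the scalar $\varepsilon_0$ is element-wise. Coercive: tends to $+\infty$ as the norm tends to $\infty$. ''Definable'' means definable in a fixed $o$-minimal structure on the real field (a function or set-valued map is definable if its graph is). A set-valued map is graph-closed if its graph is closed, and locally bounded if each point has a neighborhood on which the union of values is bounded. A conservative field is a set-valued map $\mathcal{D}:\mathbb{R}^n\rightrightarrows\mathbb{R}^n$ with nonempty compact values, locally bounded and graph-closed, such that $\int_0^1\max_{v\in\mathcal{D}(\gamma(t))}\langle\gamma'(t),v\rangle\,\mathrm{d}t=0$ for every absolutely continuous $\gamma:[0,1]\to\mathbb{R}^n$ with $\gamma(0)=\gamma(1)$. It is a conservative field for $f$ if $f(\gamma(1))-f(\gamma(0))=\int_0^1\max_{v\in\mathcal{D}(\gamma(t))}\langle\gamma'(t),v\rangle\,\mathrm{d}t$ for every absolutely continuous $\gamma:[0,1]\to\mathbb{R}^n$.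 *)

(* Defs.v *)
From HB Require Import structures.
From mathcomp Require Export all_boot all_order all_algebra.
From mathcomp Require Export all_classical all_reals all_analysis.
Export Order.TTheory GRing.Theory Num.Theory.
Export numFieldNormedType.Exports.

Set Implicit Arguments.
Unset Strict Implicit.
Unset Printing Implicit Defensive.

#[global] Open Scope classical_set_scope.
#[global] Open Scope ring_scope.

Section Euclidean.
Context {R : realType} {n : nat}.
Implicit Types (x y v : 'rV[R]_n) (A : set 'rV[R]_n).

Definition dot x y : R := \sum_i x 0 i * y 0 i.

(* The library norm `|x| on 'rV[R]_n is the sup norm (same topology, same
   bounded and compact sets, different distances). *)
Definition enorm x : R := Num.sqrt (dot x x).

Definition coercive (f : 'rV[R]_n -> R) :=
  forall M : R, exists r : R, forall x, r <= enorm x -> M <= f x.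

Definition locally_lipschitz (f : 'rV[R]_n -> R) :=
  forall x, exists2 U, nbhs x U & [lipschitz f y | y in U].

Definition nonneg_orthant : set 'rV[R]_n := [set x | forall i, 0 <= x 0 i].

(* The nearest point of A; a junk value when A has none. *)
Definition orth_proj A v : 'rV[R]_n :=
  xget v [set p | A p /\ forall q, A q -> enorm (v - p) <= enorm (v - q)].

Definition convex_hull A : set 'rV[R]_n :=
  \bigcap_(C in [set C | convex_set C /\ A `<=` C]) C.

End Euclidean.

Definition proj_nonneg {R : realType} {n : nat} : 'rV[R]_n -> 'rV[R]_n :=
  orth_proj nonneg_orthant.

Lemma proj_nonnegE (R : realType) (n : nat) (v : 'rV[R]_n) :
  proj_nonneg v = map_mx (Num.max 0) v.
Proof.
pose w := map_mx (Num.max 0) v.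
have w_ge0 : nonneg_orthant w by move=> i; rewrite mxE le_max lexx.
have coord (q : 'rV[R]_n) i : nonneg_orthant q ->
    (v - w) 0 i ^+ 2 + (w - q) 0 i ^+ 2 <= (v - q) 0 i ^+ 2.
  move=> /(_ i) q0; rewrite !mxE; have [v0|v0] := leP (v 0 i) 0.
    rewrite subr0 sub0r sqrrN sqrrB lerD2r lerDl oppr_ge0.
    by rewrite pmulrn_lle0// mulr_le0_ge0.
  by rewrite subrr expr0n add0r.
have dotE (x : 'rV[R]_n) : dot x x = \sum_i x 0 i ^+ 2.
  by apply: eq_bigr => i _; rewrite expr2.
have dot_ge0 (x : 'rV[R]_n) : 0 <= dot x x.
  by rewrite dotE sumr_ge0// => i _; exact: sqr_ge0.
have pyth (q : 'rV[R]_n) : nonneg_orthant q ->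
    dot (v - w) (v - w) + dot (w - q) (w - q) <= dot (v - q) (v - q).
  by move=> q0; rewrite !dotE -big_split ler_sum// => i _; exact: coord.
apply: (@xget_unique _ _ _ w).
  split=> // q q0; rewrite ler_sqrt//; apply: le_trans (pyth q q0).
  by rewrite lerDl.
move=> q [q0 /(_ w w_ge0)]; rewrite ler_sqrt// => qw.
have wq0 : dot (w - q) (w - q) <= 0.
  by rewrite -(lerD2l (dot (v - w) (v - w))) addr0 (le_trans (pyth q q0)).
have : dot (w - q) (w - q) == 0 by rewrite eq_le wq0 dot_ge0.
rewrite dotE psumr_eq0; last by move=> i _; exact: sqr_ge0.
move=> /allP wq; apply/rowP => i.
have := wq i (mem_index_enum i); rewrite /= sqrf_eq0 !mxE subr_eq0.
by move=> /eqP.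
Qed.

Definition dist_to {R : realType} {T : Type} (d : T -> T -> R) (x : T)
    (A : set T) : \bar R :=
  ereal_inf [set (d x a)%:E | a in A].

(* Distances to the empty set are +oo. *)
Definition vdist {R : realType} {n : nat} :=
  dist_to (fun x y : 'rV[R]_n => enorm (x - y)).
Definition rdist {R : realType} := dist_to (fun a b : R => `|a - b|).

Section SetValuedMaps.
Context {R : realType} {T : topologicalType} {n : nat}.
Implicit Type F : T -> set 'rV[R]_n.

Definition graph_closed F := closed [set p : T * 'rV[R]_n | F p.1 p.2].

Definition locally_bounded F :=
  forall x : T, exists2 U, nbhs x U & bounded_set (\bigcup_(y in U) F y).

End SetValuedMaps.

(* An o-minimal structure on the real field, in the axiomatization of
   van den Dries and Miller; S m is the collection of definable subsets
   of R^m. *)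
Record o_minimal {R : realType} (S : forall m, set (set 'rV[R]_m)) : Prop := {
  omin_setT : forall m, S m setT;
  omin_setC : forall m (A : set 'rV[R]_m), S m A -> S m (~` A);
  omin_setU : forall m (A B : set 'rV[R]_m), S m A -> S m B -> S m (A `|` B);
  omin_diag : forall m (i j : 'I_m),
    S m [set x : 'rV[R]_m | x 0 i = x 0 j];
  omin_prodr : forall m (A : set 'rV[R]_m), S m A ->
    S (m + 1)%N [set z : 'rV[R]_(m + 1) | A (lsubmx z)];
  omin_prodl : forall m (A : set 'rV[R]_m), S m A ->
    S (1 + m)%N [set z : 'rV[R]_(1 + m) | A (rsubmx z)];
  omin_proj : forall m (A : set 'rV[R]_(m + 1)), S (m + 1)%N A ->
    S m [set lsubmx z | z in A];
  omin_add : S 3 [set x : 'rV[R]_3 | x 0 0 + x 0 1 = x 0 2];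
  omin_mul : S 3 [set x : 'rV[R]_3 | x 0 0 * x 0 1 = x 0 2];
  omin_intervals : forall A : set 'rV[R]_1, S 1%N A <->
    exists s : seq (interval R),
      A = [set x : 'rV[R]_1 | exists2 I, I \in s & x 0 0 \in I]
}.

Definition definable_fun {R : realType} (S : forall m, set (set 'rV[R]_m))
    (n : nat) (f : 'rV[R]_n -> R) :=
  S (n + 1)%N [set z : 'rV[R]_(n + 1) | rsubmx z 0 0 = f (lsubmx z)].

Definition definable_map {R : realType} (S : forall m, set (set 'rV[R]_m))
    (n : nat) (F : 'rV[R]_n -> set 'rV[R]_n) :=
  S (n + n)%N [set z : 'rV[R]_(n + n) | F (lsubmx z) (rsubmx z)].

Section ConservativeFields.
Context {R : realType} {n : nat}.

(* A curve [0,1] -> R^n is represented by a function on R of which only the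
   values on [0,1] are constrained; the other values can change its derivative
   on [0,1] only at the two endpoints. *)
Definition abs_continuous (gamma : R -> 'rV[R]_n) :=
  forall e : R, 0 < e -> exists2 d : R, 0 < d &
    forall (k : nat) (a b : 'I_k -> R),
      (forall i, 0 <= a i /\ a i <= b i /\ b i <= 1) ->
      trivIset setT (fun i => `]a i, b i[%classic) ->
      \sum_i (b i - a i) < d ->
      \sum_i enorm (gamma (b i) - gamma (a i)) < e.

(* The supremum is a maximum when D has nonempty compact values. *)
Definition path_integral (D : 'rV[R]_n -> set 'rV[R]_n)
    (gamma : R -> 'rV[R]_n) : \bar R :=
  (\int[lebesgue_measure]_(t in `[0%R, 1%R])
     (sup [set dot (derive1 gamma t) v | v in D (gamma t)])%:E)%E.

Definition conservative_field (D : 'rV[R]_n -> set 'rV[R]_n) :=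
  [/\ forall x, D x !=set0,
      forall x, compact (D x),
      locally_bounded D,
      graph_closed D &
      forall gamma, abs_continuous gamma -> gamma 0 = gamma 1 ->
        path_integral D gamma = 0%E].

Definition conservative_field_for (f : 'rV[R]_n -> R)
    (D : 'rV[R]_n -> set 'rV[R]_n) :=
  conservative_field D /\
  forall gamma, abs_continuous gamma ->
    (f (gamma 1) - f (gamma 0))%:E = path_integral D gamma.

End ConservativeFields.

Section FiniteSum.
Context {R : realType} {n N : nat}.

Definition avg_fun (f : 'I_N -> 'rV[R]_n -> R) (x : 'rV[R]_n) : R :=
  N%:R^-1 * \sum_i f i x.

Definition avg_field (D : 'I_N -> 'rV[R]_n -> set 'rV[R]_n) (x : 'rV[R]_n) :
    set 'rV[R]_n :=
  convex_hull
    [set N%:R^-1 *: \sum_i g i | g in [set g | forall i, D i x (g i)]].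

Definition crit_points (D : 'rV[R]_n -> set 'rV[R]_n) : set 'rV[R]_n :=
  [set x | D x 0].

End FiniteSum.

(* Main.v *)
From HB Require Import structures.
Require Import Defs.
From mathcomp Require Import ring lra zify measurable_realfun.

(** Over one pass through the [N] functions the iterates move by a multiple of the
    step size, so a pass behaves like one step, of size [h = N * eta], of a scheme
    for the differential inclusion
      m' = tau1 (G - m),  x' = - p (m + rho G),  G \in conv (1/N sum_i Df i x),
    where [p = (v^+ + eps0)^(-1/2)] acts coordinatewise. The second moment enters
    the dynamics only through the inequality [p' <= 2 tau1 p (1 - eps0 p^2)], which holds because
    the values of [V] are nonnegative and [tau2 <= 4 tau1]. Along the inclusion the
    energy [f x + (2 tau1)^-1 sum_c p_c m_c^2] decreases ([energy_derive]), and it is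
    constant only if [m = 0] and [x] is critical ([energy_stationary]). That [f] can be
    differentiated along a Lipschitz curve through any element of the fields is
    [chain_rule]: almost every derivative of a conservative potential is the support
    function of the field in the direction of the curve, and reversing the curve gives
    the opposite sign.

    The step sizes need not tend to zero, so the asymptotic statement is replaced by a
    uniform one over a duration of order one. Ultralimits of step functions with
    vanishing steps solve the inclusion ([scheme_compactness]), hence for small steps
    every window of duration between 1/2 and 1 loses a definite amount of energy,
    unless it starts near a critical point with energy near its critical value
    ([descent]).

    Definability is used once, for a Sard theorem ([sard]): every interval contains a
    subinterval without critical values. Otherwise the critical values would fill an
    interval, a lexicographic choice of critical points would be a definable curve,
    and a definable function of one variable is Lipschitz on some subinterval
    ([definable_lipschitz_subinterval]); the chain rule along this curve of critical
    points contradicts the fact that the potential is not constant on it.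

    An interval of noncritical values is a barrier that the energy cannot climb with
    small steps ([trap]). This first confines the whole iteration to a compact set,
    which provides all constants, and then shows that the energy finally stays in
    an interval shorter than the loss of a noncritical window
    ([eventually_near_critical]): all late windows start near critical points, in
    position and in value. Criticality is expressed by support functions throughout;
    [crit_dual_avg_field] finally derives that [0] belongs to the convex hull, by
    Caratheodory's theorem and a point of minimal norm. *)

Set Implicit Arguments.
Unset Strict Implicit.
Unset Printing Implicit Defensive.

(** * Lipschitz functions of one real variable *)

#[global] Instance ae_filter (R : realType) :
  Filter (nbhs (almost_everywhere (@lebesgue_measure R))) :=
  ae_filter_ringOfSetsType lebesgue_measure.

(** Curves are total functions of a real parameter, so that they can be stopped,
    reversed and reparametrized without leaving this class. *)
Definition lip_on_line {R : realType} {V : normedModType R} (L : R)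
    (F : R -> V) :=
  forall s t, `|F s - F t| <= L * `|s - t|.

Section LipschitzRealFunctions.
Context {R : realType}.
Notation mu := (@lebesgue_measure R).
Implicit Types (F : R -> R) (L : R).

Lemma lip_continuous (V : normedModType R) L (g : R -> V) : lip_on_line L g -> continuous g.
Proof.
move=> gL x; apply/cvgrPdist_le => e e0.
have L0 : 0 < `|L| + 1 by rewrite ltr_wpDl.
near=> t.
rewrite (le_trans (gL x t))// (@le_trans _ _ ((`|L| + 1) * `|x - t|))//.
  by rewrite ler_wpM2r// (le_trans (ler_norm L))// lerDl.
rewrite mulrC -ler_pdivlMr//.
near: t; apply: (@cvgr_dist_le _ R^o); [exact: cvg_id|exact: divr_gt0].
Unshelve. all: by end_near. Qed.

Lemma stieltjes_itv (G : cumulative R R) (s t : R) : s <= t ->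
  lebesgue_stieltjes_measure G `]s, t]%classic = (G t - G s)%:E.
Proof.
move=> st; rewrite /lebesgue_stieltjes_measure /measure_extension/=.
rewrite measurable_mu_extE; last exact: is_ocitv.
rewrite /= wlength_itv_bnd//.
Qed.

(** With [K] larger than the Lipschitz constant, [(K t + F t) / (2 K)] and
    [(K t - F t) / (2 K)] are nondecreasing and add up to the identity. The
    Stieltjes measure of the first is therefore dominated by the Lebesgue measure,
    and its Radon-Nikodym density yields that of [F]. *)
Lemma lip_density L F (a b : R) : lip_on_line L F -> a < b ->
  exists h : R -> R,
    mu.-integrable setT (EFin \o h) /\
    forall s t, a <= s -> s <= t -> t <= b ->
      F t - F s = (\int[mu]_(x in `]s, t]) h x)%R.
Proof.
move=> FL ab; pose K : R := `|L| + 1.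
have K0 : 0 < K by rewrite ltr_wpDl.
have FK s t : `|F s - F t| <= K * `|s - t|.
  by rewrite (le_trans (FL s t))// ler_wpM2r// (le_trans (ler_norm L))// lerDl.
have Fc := lip_continuous FL.
pose G (t : R) : R := (K * t + F t) / (2 * K).
pose H (t : R) : R := (K * t - F t) / (2 * K).
have K2 : 0 <= (2 * K)^-1 by rewrite invr_ge0 mulr_ge0// ltW.
have Gnd : nondecreasing G.
  move=> s t st; rewrite /G ler_wpM2r//.
  have := FK t s; rewrite (ger0_norm (_ : 0 <= t - s)) ?subr_ge0//.
  by rewrite ler_norml => /andP[]; lra.
have Hnd : nondecreasing H.
  move=> s t st; rewrite /H ler_wpM2r//.
  have := FK t s; rewrite (ger0_norm (_ : 0 <= t - s)) ?subr_ge0//.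
  by rewrite ler_norml => /andP[]; lra.
have Gc : continuous G.
  move=> x; apply: cvgMr_tmp; apply: cvgD; last exact: Fc.
  by apply: cvgMl_tmp; exact: cvg_id.
have Hc : continuous H.
  move=> x; apply: cvgMr_tmp; apply: cvgB; last exact: Fc.
  by apply: cvgMl_tmp; exact: cvg_id.
pose G' : cumulative R R :=
  HB.pack G (isCumulative.Build R _ R G Gnd (right_continuousW Gc)).
pose H' : cumulative R R :=
  HB.pack H (isCumulative.Build R _ R H Hnd (right_continuousW Hc)).
pose mG := lebesgue_stieltjes_measure G'.
pose mH := lebesgue_stieltjes_measure H'.
have GH A : measurable A -> mu A = (mG A + mH A)%E.
  move=> mA; rewrite -measure_addE.
  apply: lebesgue_measure_unique => // X [[s t] _ <-]/=.
  rewrite [RHS]measure_addE.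
  have [st|ts] := leP s t; last by rewrite set_itv_ge -?leNgt ?bnd_simp ?ltW// !measure0 adde0.
  transitivity ((G t - G s)%:E + (H t - H s)%:E)%E; last first.
    by congr (_ + _)%E; rewrite /= stieltjes_itv.
  rewrite /lebesgue_measure stieltjes_itv//= -EFinD; congr EFin.
  rewrite /G /H; field; exact: lt0r_neq0.
pose D : set (measurableTypeR R) := `]a, b]%classic.
have mD : measurable D by exact: measurable_itv.
have D_fin : (mG D < +oo)%E by rewrite /mG stieltjes_itv ?ltW// ltry.
pose nu : {finite_measure set (measurableTypeR R) -> \bar R} := mfrestr mD D_fin.
have nu_mu : null_dominates mu nu.
  apply/null_content_dominatesP => B mB B0.
  have : (mG B <= 0)%E.
    by apply: (@le_trans _ _ (mu B)); [rewrite GH// leeDl|rewrite -[leRHS]B0].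
  rewrite measure_le0 => /eqP GB.
  apply/eqP; rewrite -measure_le0 -GB /nu /mfrestr /mrestr.
  by apply: le_measure; rewrite ?inE//; exact: measurableI.
have [h [h0 hfin hint hE]] := @radon_nikodym_sigma_finite _ (measurableTypeR R) R mu nu nu_mu.
have hh : (fun x => (fine (h x))%:E) = h by apply/funext => x; rewrite fineK.
have GE s t : a <= s -> s <= t -> t <= b ->
    G t - G s = (\int[mu]_(x in `]s, t]) fine (h x))%R.
  move=> as_ st tb; rewrite /Rintegral.
  under eq_integral do rewrite fineK//.
  rewrite -hE//= /nu /mfrestr /mrestr setIidl.
    by rewrite /mG stieltjes_itv.
  by apply: subset_itv; rewrite bnd_simp.
have fhint : mu.-integrable setT (EFin \o (fun x => fine (h x))).
  by rewrite (_ : _ \o _ = h)//; exact/funext.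
have Dint (A : set R) : measurable A -> mu.-integrable A (EFin \o (fun x => fine (h x))).
  by move=> mA; apply: integrableS fhint.
pose k x := 2 * K * fine (h x) - K * \1_D x.
have kint1 : mu.-integrable setT (EFin \o (fun x => K * \1_D x : R)).
  rewrite (_ : _ \o _ = (fun x => K%:E * (\1_D x)%:E)%E)//.
  apply: integrableZl => //; exact: integrable_indic_itv.
have kint2 : mu.-integrable setT (EFin \o (fun x => 2 * K * fine (h x))).
  by rewrite (_ : _ \o _ = (fun x => (2 * K)%:E * (fine (h x))%:E)%E)//; exact: integrableZl.
exists k; split.
  exact: (integrableB measurableT kint2 kint1).
move=> s t as_ st tb.
have mst : measurable (`]s, t]%classic : set R) by exact: measurable_itv.
rewrite /k RintegralB//; [|exact: integrableS kint2|exact: integrableS kint1].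
rewrite RintegralZl//; last exact: Dint.
rewrite -GE//.
rewrite (@eq_Rintegral _ _ _ _ _ (cst K)); last first.
  move=> x; rewrite inE/= in_itv/= => /andP[sx xt].
  rewrite indicE mem_set ?mulr1//= /D/= in_itv/=; apply/andP; split; lra.
rewrite Rintegral_cst//= lebesgue_measure_itv/= lte_fin.
have -> : fine (if s < t then (t%:E - s%:E)%E else 0%E) = t - s.
  by case: ltP => // ts; rewrite /=; lra.
rewrite /G; field; exact: lt0r_neq0.
Qed.

Lemma primitive_ae_derive F (h : R -> R) (a b : R) :
  mu.-integrable setT (EFin \o h) ->
  (forall s t, a <= s -> s <= t -> t <= b ->
    F t - F s = (\int[mu]_(x in `]s, t]) h x)%R) ->
  {ae mu, forall t, a < t < b -> is_derive t (1 : R) F (h t)}.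
Proof.
move=> hint FE.
have hintS (A : set R) : measurable A -> mu.-integrable A (EFin \o h).
  by move=> mA; apply: integrableS hint.
have := @FTC1Ny R h (fun y => hintS _ (measurable_itv _))
  (open_integrable_locally openT hint).
apply: filterS.
move=> t [dt ht] /andP[at_ tb].
pose H y := (\int[mu]_(x in `]-oo, y]) h x)%R.
suff FH : {near t, (fun y => H y + (F a - H a)) =1 F}.
  have e1 : is_derive t (1 : R) (fun y => H y + (F a - H a)) (h t).
    rewrite -[h t]addr0; apply: is_deriveD; rewrite -ht derive1E; exact: derivableP.
  split; first by apply: near_eq_derivable FH _.
  by rewrite -(near_eq_derive _ FH)//; case: e1.
near=> y.
have ay : a <= y by near: y; apply: filterS (lt_nbhsr at_) => z /ltW.
have yb : y <= b.
  by near: y; apply: filterS (lt_nbhsl tb) => z /ltW.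
have := FE _ _ (lexx a) ay yb.
rewrite -(@Rintegral_itvB _ _ -oo%O)//; last exact: hintS.
by rewrite /H; lra.
Unshelve. all: by end_near. Qed.

Lemma lip_ae_derivable L F (a b : R) : lip_on_line L F ->
  {ae mu, forall t, a < t < b -> derivable F t 1}.
Proof.
move=> FL; have [ab|ba] := ltP a b; last first.
  by apply: aeW => t /andP[at_ tb]; have := lt_le_trans (lt_trans at_ tb) ba; rewrite ltxx.
have [h [hint FE]] := lip_density FL ab.
apply: filterS (primitive_ae_derive hint FE).
by move=> t tD /tD[].
Qed.

End LipschitzRealFunctions.

Section LipschitzMonotone.
Context {R : realType}.
Notation mu := (@lebesgue_measure R).
Implicit Types (F : R -> R) (L : R).

(** [F t - F s] is the integral of the density of [F], which is almost everywhere
    the derivative of [F]. *)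
Lemma lip_nonincreasing L F (s t : R) : lip_on_line L (F : R -> R) -> s <= t ->
  {ae mu, forall x, s < x < t -> forall d : R, is_derive x (1 : R) F d -> d <= 0} ->
  F t <= F s.
Proof.
move=> FL; rewrite le_eqVlt => /predU1P[->//|st] aeF.
have [h [hint FE]] := lip_density FL st.
have hD := primitive_ae_derive hint FE.
rewrite -subr_le0 FE ?lexx ?(ltW st)//.
have mS : measurable (`]s, t]%classic : set (measurableTypeR R)) by exact: measurable_itv.
have mh := measurable_int _ hint.
have -> : (\int[mu]_(x in `]s, t]) h x)%R = (\int[mu]_(x in `]s, t[) h x)%R.
  by rewrite -Rintegral_itv_bndo_bndc//; apply: integrableS hint => //; exact: measurable_itv.
have mS' : measurable (`]s, t[%classic : set (measurableTypeR R)) by exact: measurable_itv.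
pose k : measurableTypeR R -> \bar R := EFin \o h.
have mk : measurable_fun (`]s, t[%classic : set (measurableTypeR R)) k by exact: measurable_funS mh.
have mN := measurable_funeneg mk.
rewrite /Rintegral (@ae_eq_integral _ _ _ mu _ (fun x => - k^\- x)%E k)//.
- rewrite integral_ge0N; last by move=> x _; exact: funeneg_ge0.
  rewrite fineN oppr_le0 fine_ge0//.
  by apply: integral_ge0 => x _; exact: funeneg_ge0.
- exact: (measurableT_comp _ mN).
- apply: filterS2 aeF hD.
  move=> x xF hx; rewrite /= in_itv/= => xst.
  have h0 : h x <= 0 by apply: (xF xst); exact: hx.
  rewrite funenegE /k /= max_l; first by rewrite -EFinN opprK.
  by rewrite lee_fin oppr_ge0.
Qed.

End LipschitzMonotone.

(** * Row vectors and support functions *)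

Lemma cvg_sumr {R : realType} (T I : Type) (F : set_system T)
    {FF : Filter F} (r : seq I) (a : I -> T -> R) (l : I -> R) :
  (forall i, a i @ F --> l i) ->
  (fun t => \sum_(i <- r) a i t) @ F --> \sum_(i <- r) l i.
Proof.
move=> al; elim: r => [|i r IH].
  rewrite big_nil (_ : (fun t => _) = cst 0); first exact: cvg_cst.
  by apply/funext => t; rewrite big_nil.
rewrite big_cons (_ : (fun t => _) = a i \+ (fun t => \sum_(j <- r) a j t)).
  exact: cvgD.
by apply/funext => t; rewrite big_cons.
Qed.

Section Vectors.
Context {R : realType} {n : nat}.
Implicit Types (x y u v : 'rV[R]_n) (c : R).

Lemma coord_le_norm x i : `|x 0 i| <= `|x|.
Proof.
rewrite [leRHS]/Num.Def.normr /= mx_normrE; apply/bigmax_geP; right => /=.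
by exists (ord0, i).
Qed.

Lemma norm_leP x c : 0 <= c -> (forall i, `|x 0 i| <= c) -> `|x| <= c.
Proof.
move=> c0 xc; rewrite /Num.Def.normr /= mx_normrE; apply: bigmax_le => //= -[i j] _ /=.
by rewrite ord1.
Qed.

Lemma dotC u v : dot u v = dot v u.
Proof. by apply: eq_bigr => i _; rewrite mulrC. Qed.

Lemma dotDl u v w : dot (u + v) w = dot u w + dot v w.
Proof.
by rewrite /dot -big_split; apply: eq_bigr => i _; rewrite mxE mulrDl.
Qed.

Lemma dotZl c u v : dot (c *: u) v = c * dot u v.
Proof. by rewrite /dot mulr_sumr; apply: eq_bigr => i _; rewrite mxE mulrA. Qed.

Lemma dotDr u v w : dot u (v + w) = dot u v + dot u w.
Proof. by rewrite !(dotC u) dotDl. Qed.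

Lemma dotZr c u v : dot u (c *: v) = c * dot u v.
Proof. by rewrite !(dotC u) dotZl. Qed.

Lemma dotNl u v : dot (- u) v = - dot u v.
Proof. by rewrite -scaleN1r dotZl mulN1r. Qed.

Lemma dotNr u v : dot u (- v) = - dot u v.
Proof. by rewrite -scaleN1r dotZr mulN1r. Qed.

Lemma dotBl u v w : dot (u - v) w = dot u w - dot v w.
Proof. by rewrite dotDl dotNl. Qed.

Lemma dotBr u v w : dot u (v - w) = dot u v - dot u w.
Proof. by rewrite dotDr dotNr. Qed.

Lemma dot0l v : dot 0 v = 0.
Proof. by apply: big1 => i _; rewrite mxE mul0r. Qed.

Lemma dot0r v : dot v 0 = 0.
Proof. by rewrite dotC dot0l. Qed.

Lemma dot_sumr u (I : Type) (r : seq I) (P : pred I) (F : I -> 'rV[R]_n) :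
  dot u (\sum_(i <- r | P i) F i) = \sum_(i <- r | P i) dot u (F i).
Proof.
by elim/big_rec2: _ => [|i a b _ <-]; rewrite ?dot0r ?dotDr.
Qed.

Lemma dot_ge0 u : 0 <= dot u u.
Proof. by apply: sumr_ge0 => i _; rewrite -expr2 sqr_ge0. Qed.

Lemma dot_eq0 u : dot u u = 0 -> u = 0.
Proof.
move=> /eqP; rewrite psumr_eq0; last by move=> i _; rewrite -expr2 sqr_ge0.
move=> /allP u0; apply/rowP => i; rewrite mxE.
by have := u0 i (mem_index_enum i); rewrite /= -expr2 sqrf_eq0 => /eqP.
Qed.

Lemma dot_le u v : `|dot u v| <= n%:R * (`|u| * `|v|).
Proof.
rewrite (le_trans (ler_norm_sum _ _ _))//.
suff -> : n%:R * (`|u| * `|v|) = \sum_(i < n) (`|u| * `|v|).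
  by rewrite ler_sum// => i _; rewrite normrM ler_pM// coord_le_norm.
by rewrite sumr_const card_ord mulr_natl.
Qed.

Lemma enorm_le_norm x : enorm x <= n%:R * `|x|.
Proof.
rewrite /enorm -(ler_pXn2r (_ : (0 < 2)%N))// ?nnegrE ?mulr_ge0//.
rewrite sqr_sqrtr ?dot_ge0// (le_trans (ler_norm _))// (le_trans (dot_le _ _))//.
rewrite exprMn -[`|x| * `|x|]expr2 ler_wpM2r ?sqr_ge0//.
case: n => [|k]; first by rewrite expr0n.
by rewrite expr2 -{1}[_.+1%:R]mul1r ler_wpM2r// ler1n.
Qed.

Lemma norm_le_enorm x : `|x| <= enorm x.
Proof.
apply: norm_leP; first exact: sqrtr_ge0.
move=> i; rewrite -sqrtr_sqr ler_sqrt ?dot_ge0//.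
rewrite /dot (bigD1 i)//= -expr2 lerDl sumr_ge0// => j _.
by rewrite -expr2 sqr_ge0.
Qed.

Lemma cvg_dot (T : Type) (F : set_system T) {FF : Filter F}
    (a b : T -> 'rV[R]_n) u v :
  a @ F --> u -> b @ F --> v -> (fun t => dot (a t) (b t)) @ F --> dot u v.
Proof.
move=> au bv; apply: cvg_sumr => i; apply: cvgM; first exact: (cvg_comp _ _ au (@coord_continuous _ _ _ 0 i u)).
exact: (cvg_comp _ _ bv (@coord_continuous _ _ _ 0 i v)).
Qed.

End Vectors.

Lemma closed_ball_compact {R : realType} {n : nat} (C : R) :
  compact [set v : 'rV[R]_n | `|v| <= C].
Proof.
apply: bounded_closed_compact.
  exists C; split; first exact: num_real.
  by move=> M CM v /= /le_trans; apply; exact: ltW.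
rewrite (_ : [set v | _] = Num.norm @^-1` [set r | r <= C])//.
by apply: closed_comp => [v _|]; [exact: norm_continuous|exact: closed_le].
Qed.

(** The topological clauses shared by conservative fields and by [V]: together
    they make the map upper semicontinuous with compact values. *)
Definition usc_field {R : realType} {T : topologicalType} {n : nat}
    (D : T -> set 'rV[R]_n) :=
  [/\ forall x, D x !=set0, forall x, compact (D x), locally_bounded D &
      graph_closed D].

Lemma bounded_setP {R : realType} {n : nat} (A : set 'rV[R]_n) :
  bounded_set A -> exists2 M : R, 0 < M & forall v, A v -> `|v| <= M.
Proof.
move=> bA; near (+oo%R : set_system R) => M; exists M => //.
by near: M; exact: bA.
Unshelve. all: by end_near. Qed.

(** The support function; all the inclusions [v \in conv A] of the proof are
    handled through it. *)
Definition supp {R : realType} {n : nat} (A : set 'rV[R]_n) (u : 'rV[R]_n) : R :=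
  sup [set dot u v | v in A].

Section SupportFunction.
Context {R : realType} {n : nat}.
Implicit Types (A : set 'rV[R]_n) (u v : 'rV[R]_n).

Lemma supp_attained A u : A !=set0 -> compact A ->
  (exists2 v, A v & dot u v = supp A u) /\ forall v, A v -> dot u v <= supp A u.
Proof.
move=> A0 cA; have [|v /set_mem Av vmax] := compact_EVT_max (f := dot u) A0 cA.
  apply: continuous_subspaceT .
  move=> v; apply: (cvg_dot (F := nbhs v) (a := fun=> u) (b := id)).
    exact: cvg_cst.
  exact: cvg_id.
have {}vmax w : A w -> dot u w <= dot u v by move=> Aw; apply: vmax; exact: mem_set.
have ubA : ubound [set dot u v | v in A] (dot u v).
  by move=> _ [w Aw <-]; apply: vmax.
have suppE : dot u v = supp A u.
  apply/eqP; rewrite eq_le; apply/andP; split.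
    by apply: ub_le_sup; [exists (dot u v)|exists v].
  apply: ge_sup => //; first by exists (dot u v), v.
split; first by exists v.
by rewrite -suppE => w Aw; exact: vmax.
Qed.

End SupportFunction.

Section SupportOfField.
Context {R : realType} {T : topologicalType} {n : nat}.
Variable D : T -> set 'rV[R]_n.
Hypothesis Dusc : usc_field D.
Implicit Types (x y : T) (u v : 'rV[R]_n).

Lemma supp_ge x u v : D x v -> dot u v <= supp (D x) u.
Proof.
by case: Dusc => /(_ x) D0 /(_ x) cD _ _; have [_] := supp_attained u D0 cD; apply.
Qed.

Lemma supp_ex x u : exists2 v, D x v & dot u v = supp (D x) u.
Proof.
by case: Dusc => /(_ x) D0 /(_ x) cD _ _; have [] := supp_attained u D0 cD.
Qed.

Lemma supp_le x u c : (forall v, D x v -> dot u v <= c) -> supp (D x) u <= c.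
Proof. by move=> Dc; have [v Dv <-] := supp_ex x u; exact: Dc. Qed.

Lemma supp0 x : supp (D x) 0 = 0.
Proof. by have [v _ <-] := supp_ex x 0; rewrite dot0l. Qed.

(** A bounded vector outside the half space [dot u v < c] is not a value at [x],
    hence not a value near [x] because the graph is closed; compactness of the local
    bound makes the neighbourhood uniform. *)
Lemma supp_usc x u c : supp (D x) u < c ->
  \forall p \near (x, u), supp (D p.1) p.2 < c.
Proof.
case: Dusc => _ _ /(_ x)[U xU] /bounded_setP[M M0 UM] cD uc.
pose B : set 'rV[R]_n := [set v | `|v| <= M].
have cB : compact B by exact: closed_ball_compact.
have cov v : B v -> \forall v' \near v & p \near (x, u), D p.1 v' -> dot p.2 v' < c.
  move=> _; have [vc|cv] := ltP (dot u v) c.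
    have dc : (fun q : 'rV[R]_n * (T * 'rV[R]_n) => dot q.2.2 q.1)
        @ (v, (x, u)) --> dot u v.
      apply: (cvg_dot (F := nbhs (v, (x, u)))
        (a := fun q => q.2.2) (b := fst)).
        move=> C uC; exists (setT, [set p : T * 'rV[R]_n | C p.2]) => /=.
          split; first exact: filterT.
          by exists (setT, C) => /= [|p []//]; split=> //; exact: filterT.
        by move=> q [].
      exact: cvg_fst.
    have vcn := cvgr_lt (F := nbhs (v, (x, u))) _ dc _ vc.
    have [[A1 A2] /= A12 h] := vcn; exists (A1, A2) => //= -[v' [y w]] /= vyw _.
    exact: (h (v', (y, w))).
  have nD : ~ D x v by move=> /(@supp_ge _ u); move: cv uc; lra.
  have : \forall q \near (x, v), ~ D q.1 q.2.
    by apply: open_nbhs_nbhs; split => //; rewrite openC; exact: cD.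
  move=> [[A1 A2]] /= [xA1 vA2] A12.
  exists (A2, A1 `*` setT) => /=.
    split => //; exists (A1, setT) => //=; split=> //; exact: filterT.
  by move=> [v' [y w]] /= [A2v [A1y _]] Dy; have := A12 (y, v') (conj A1y A2v).
have Bc := (compact_near_coveringP B).1 cB _ _
  (fun p v' => D p.1 v' -> dot p.2 v' < c) _ cov.
have xU' : \forall p \near (x, u), U p.1.
  by exists (U, setT) => /=; [split => //; exact: filterT|move=> p []].
near=> p.
have [v Dv <-] := supp_ex p.1 p.2.
have pBc : B `<=` (fun v' => D p.1 v' -> dot p.2 v' < c) by near: p; exact: Bc.
apply: pBc => //; apply: UM; exists p.1 => //.
by near: p; exact: xU'.
Unshelve. all: by end_near. Qed.

(** Local boundedness becomes a uniform bound by a covering argument. *)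
Lemma compact_field_bound (K : set T) : compact K ->
  exists2 M : R, 0 < M & forall x v, K x -> D x v -> `|v| <= M.
Proof.
move=> cK; case: Dusc => _ _ lD _.
have cov x : K x -> \forall y \near x & M \near +oo%R,
    forall v, D y v -> `|v| <= M.
  move=> _; have [U xU bU] := lD x.
  exists (U, [set M : R | forall v, (\bigcup_(y in U) D y) v -> `|v| <= M]) => //=.
  by move=> [y M] /= [Uy UM] v Dv; apply: UM; exists y.
have KM := (compact_near_coveringP K).1 cK _ _
  (fun M y => forall v, D y v -> `|v| <= M) _ cov.
near (+oo%R : set_system R) => M; exists M => // x v Kx.
have KM' : K `<=` (fun y => forall v, D y v -> `|v| <= M) by near: M; exact: KM.
exact: KM'.
Unshelve. all: by end_near. Qed.

End SupportOfField.

(** * The chain rule along Lipschitz curves *)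

Import HBNNSimple.

(** The integrand of [path_integral] is not known to be measurable, and the
    integral of a nonmeasurable function is a supremum over simple functions below
    it. That supremum is insensitive to null sets, so it can be computed from any
    measurable function that agrees with the integrand almost everywhere. *)
Lemma ge0_integral_ae_eq_measurable d (T : measurableType d) (R : realType)
    (mu : {measure set T -> \bar R}) (D : set T) (f g : T -> \bar R) :
  measurable D -> measurable_fun D g ->
  (forall x, 0 <= f x)%E -> (forall x, 0 <= g x)%E ->
  ae_eq mu D f g -> (\int[mu]_(x in D) f x = \int[mu]_(x in D) g x)%E.
Proof.
move=> mD mg f0 g0 [N [mN N0 fgN]]; apply/eqP; rewrite eq_le; apply/andP; split.
  rewrite ge0_integralE//; apply: ge_ereal_sup => _ /= [h hf <-].
  rewrite -integralT_nnsfun (integral_mkcond D g).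
  apply: ae_ge0_le_integral => //.
  - by move=> x _; rewrite lee_fin; exact: fun_ge0.
  - exact/measurable_EFinP.
  - by move=> x _; rewrite patchE; case: ifP.
  - exact/(measurable_restrictT _ mD).1.
  - exists N; split=> //; apply: subset_trans fgN; apply: subsetC => x /= fgx _.
    apply: (le_trans (hf x)).
    by rewrite !patchE; case: ifPn => // /set_mem Dx; rewrite fgx.
rewrite (ge0_negligible_integral _ _ _ _ N0)// !ge0_integralE//.
apply: le_ereal_sup => _ [h /= hg <-]; exists h => //= x.
apply: (le_trans (hg x)); rewrite !patchE.
case: ifPn => [/set_mem[Dx Nx]|_]; last by case: ifP.
rewrite mem_set//; have [->//|xE] := pselect (f x = g x).
by exfalso; apply: Nx; apply: fgN => /= /(_ Dx).
Qed.

Lemma integral_ae_eq_measurable d (T : measurableType d) (R : realType)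
    (mu : {measure set T -> \bar R}) (D : set T) (f g : T -> \bar R) :
  measurable D -> measurable_fun D g ->
  ae_eq mu D f g -> (\int[mu]_(x in D) f x = \int[mu]_(x in D) g x)%E.
Proof.
move=> mD mg /ae_eq_funeposneg[fgp fgn]; rewrite integralE [RHS]integralE.
by congr (_ - _)%E; apply: ge0_integral_ae_eq_measurable => //;
  [exact: measurable_funepos|exact: measurable_funeneg].
Qed.

Section Curves.
Context {R : realType} {n : nat}.
Notation mu := (@lebesgue_measure R).
Implicit Types (g : R -> 'rV[R]_n) (L : R).

Lemma lip_coord L g i : lip_on_line L g -> lip_on_line L (fun t => g t 0 i : R).
Proof.
move=> gL s t; apply: le_trans (gL s t).
by have := coord_le_norm (g s - g t) i; rewrite !mxE.
Qed.

Lemma lip_curve_ae_derivable L g (a b : R) : lip_on_line L g ->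
  {ae mu, forall t, a < t < b -> derivable g t 1}.
Proof.
move=> gL.
have : {ae mu, forall t, forall i, a < t < b -> derivable (fun x => g x 0 i : R) t 1}.
  apply: filter_forall => i; exact: lip_ae_derivable (lip_coord i gL).
apply: filterS => t gt ab; apply/derivable_mxP => i j; rewrite ord1; exact: gt.
Qed.

Lemma lip_abs_continuous L g : lip_on_line L g -> abs_continuous g.
Proof.
move=> gL e e0; pose K := n%:R * (`|L| + 1) + 1.
have K0 : 0 < K by rewrite ltr_wpDl// mulr_ge0// addr_ge0.
exists (e / K); first exact: divr_gt0.
move=> k a b ab _ sum; apply: (@le_lt_trans _ _ (K * \sum_i (b i - a i))); last first.
  by rewrite mulrC -ltr_pdivlMr.
rewrite mulr_sumr ler_sum// => i _; have [_ [ab_i _]] := ab i.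
rewrite (le_trans (enorm_le_norm _))//.
have ba0 : 0 <= b i - a i by rewrite subr_ge0.
apply: (@le_trans _ _ (n%:R * (`|L| + 1) * (b i - a i))); last first.
  by rewrite ler_wpM2r// lerDl.
rewrite -mulrA ler_wpM2l// (le_trans (gL _ _))// (ger0_norm ba0) ler_wpM2r//.
by rewrite (le_trans (ler_norm L))// lerDl.
Qed.

(** Stopping a curve at time [s] turns the identity over [[0, 1]] that defines a
    conservative field into one over [[0, s]]. *)
Lemma lip_stop L g s : lip_on_line L g ->
  lip_on_line L (fun t => g (Num.min t s)).
Proof.
move=> gL t u; have [L0|L0] := leP 0 L; last first.
  have gst := gL (Num.min t s) (Num.min u s).
  have : `|t - u| = 0.
    have := gL t u; have := normr_ge0 (g t - g u); have := normr_ge0 (t - u); nra.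
  by move=> /normr0_eq0/subr0_eq ->; rewrite !subrr !normr0 mulr0.
apply: (le_trans (gL _ _)); rewrite ler_wpM2l//.
have [ts|st] := leP t s; have [us|su] := leP u s => //.
- rewrite distrC ger0_norm ?subr_ge0//.
  by rewrite [in leRHS]distrC ger0_norm ?subr_ge0; lra.
- rewrite ger0_norm ?subr_ge0//.
  by rewrite ger0_norm ?subr_ge0; lra.
- by rewrite subrr normr0.
Qed.

End Curves.

Section PathIntegrand.
Context {R : realType} {n : nat}.
Notation mu := (@lebesgue_measure R).
Implicit Types (g : R -> 'rV[R]_n) (D : 'rV[R]_n -> set 'rV[R]_n) (L : R).

Definition diff_quot g (j : nat) (t : R) : 'rV[R]_n :=
  j.+1%:R *: (g (t + j.+1%:R^-1) - g t).

Lemma diff_quot_continuous L g j : lip_on_line L g -> continuous (diff_quot g j).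
Proof.
move=> gL t; have gc := lip_continuous gL.
apply: (@cvgZl_tmp _ _ _ (nbhs t) _ j.+1%:R (fun t => g (t + j.+1%:R^-1) - g t)).
apply: cvgB; last exact: gc.
apply: (@cvg_comp _ _ _ (fun t => t + j.+1%:R^-1) g _ (nbhs (t + j.+1%:R^-1))).
  by apply: cvgD; [exact: cvg_id|exact: cvg_cst].
exact: gc.
Qed.

(** Derivatives are tested along the steps [1 / (j + 1)], which makes them limits
    of sequences. *)
Lemma harmonic_dnbhs : (fun j => j.+1%:R^-1 : R) @ \oo --> 0^'.
Proof.
move=> A A0.
have h : \forall j \near \oo, (@harmonic R j != 0 -> A (harmonic j)).
  exact: (@cvg_harmonic R) _ A0.
change (\forall j \near \oo, A (@harmonic R j)).
by apply: filterS h => j; apply; rewrite invr_eq0 pnatr_eq0.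
Qed.

Lemma diff_quot_cvg g t : derivable g t 1 ->
  diff_quot g ^~ t @ \oo --> derive1 g t.
Proof.
move=> gt; rewrite derive1E.
have gt' : (fun h : R => h^-1 *: (g (h *: (1 : R) + t) - g t)) @ 0^' --> 'D_1 g t := gt.
have := cvg_comp _ _ harmonic_dnbhs gt'.
rewrite (_ : _ \o _ = diff_quot g ^~ t)//.
by apply/funext => j; rewrite /diff_quot /= invrK [_ *: 1]mulr1 [_ + t]addrC.
Qed.

Lemma diff_quot_norm L g j t : lip_on_line L g -> `|diff_quot g j t| <= L.
Proof.
move=> gL; rewrite normrZ ger0_norm// -ler_pdivlMl//.
apply: (le_trans (gL _ _)); rewrite addrAC subrr add0r ger0_norm ?invr_ge0//.
by rewrite mulrC.
Qed.

Variables (f : 'rV[R]_n -> R) (D : 'rV[R]_n -> set 'rV[R]_n).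
Hypothesis Df : conservative_field_for f D.

Let Dusc : usc_field D.
Proof. by case: Df => -[]. Qed.

Lemma supp_lipschitz (M : R) x u u' : (forall v, D x v -> `|v| <= M) ->
  `|supp (D x) u - supp (D x) u'| <= n%:R * (`|u - u'| * M).
Proof.
move=> DM; rewrite ler_norml; apply/andP; split.
  have [v Dv <-] := supp_ex Dusc x u'; rewrite lerNl opprB.
  have := supp_ge Dusc u Dv; have := ler_normlW (dot_le (u' - u) v).
  rewrite distrC dotBl => h1 h2; apply: (@le_trans _ _ (n%:R * (`|u - u'| * `|v|))); first by lra.
  by rewrite ler_wpM2l// ler_wpM2l// DM.
have [v Dv <-] := supp_ex Dusc x u.
have := supp_ge Dusc u' Dv; have := ler_normlW (dot_le (u - u') v).
rewrite dotBl => h1 h2; apply: (@le_trans _ _ (n%:R * (`|u - u'| * `|v|))); first by lra.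
by rewrite ler_wpM2l// ler_wpM2l// DM.
Qed.

(** The integrand [t |-> supp (D (g t)) (g' t)] of the path integral agrees
    almost everywhere with a bounded measurable function: it is the limit of the
    upper semicontinuous functions obtained by replacing the derivative by
    difference quotients. *)
Lemma path_integrand L g : lip_on_line L g ->
  exists h : R -> R,
    mu.-integrable setT (EFin \o h) /\
    forall t, 0 < t < 1 -> derivable g t 1 -> h t = supp (D (g t)) (derive1 g t).
Proof.
move=> gL; pose H j t := supp (D (g t)) (diff_quot g j t).
have gc := lip_continuous gL.
have mH j : measurable_fun (setT : set (measurableTypeR R)) (fun t => (H j t)%:E).
  apply/measurable_EFinP.
  apply: (measurability _ (RGenInftyO.measurableE R)) => //.
  move=> _ [_ [c ->] <-]; rewrite setTI.
  apply: open_measurable; rewrite openE => t /=; rewrite in_itv/= => Htc.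
  have gd : (fun s => (g s, diff_quot g j s)) @ t --> (g t, diff_quot g j t).
    exact: (cvg_pair (gc t) (diff_quot_continuous (j := j) gL (x := t))).
  have gn : \forall s \near t, H j s < c := gd _ (supp_usc Dusc Htc).
  by apply: filterS gn => s /=; rewrite in_itv.
have mH' : measurable_fun (setT : set (measurableTypeR R))
    (fun t => limn_esup (fun j => (H j t)%:E)).
  exact: measurable_fun_limn_esup.
have cK : compact [set g t | t in `[0, 1]%classic].
  apply: continuous_compact; last exact: segment_compact.
  by apply: continuous_subspaceT.
have [M M0 DM] := compact_field_bound Dusc cK.
pose B := n%:R * (L * M).
have L0 : 0 <= L.
  by have := gL 0 1; rewrite sub0r normrN1 mulr1; apply: le_trans.
have B0 : 0 <= B by rewrite !mulr_ge0// ltW.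
pose h0 (t : R) : R := Num.max (- B) (Num.min B (fine (limn_esup (fun j => (H j t)%:E)))).
have mh0 : measurable_fun (setT : set (measurableTypeR R)) h0.
  apply: measurable_maxr; first exact: measurable_cst.
  apply: measurable_minr; first exact: measurable_cst.
  exact: measurableT_comp mH'.
have m01 : measurable (`[0, 1]%classic : set (measurableTypeR R)) by exact: measurable_itv.
exists (h0 \_ `[0, 1]%classic); split.
  rewrite (_ : EFin \o _ = (EFin \o h0) \_ `[0, 1]%classic); last first.
    by apply/funext => t /=; rewrite !patchE; case: ifP.
  apply/(integrable_mkcond _ m01).
  apply: measurable_bounded_integrable => //.
  - by rewrite /= lebesgue_measure_itv/= lte_fin ltr01 -EFinB ltry.
  - exact: measurable_funTS.
  - exists `|B|; split; first exact: num_real.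
    move=> y By t _; apply/ltW/(le_lt_trans _ By).
    rewrite (ger0_norm B0) /h0 ler_norml le_max lexx/= ge_max.
    by rewrite ge_min lexx andbT (le_trans _ B0)// oppr_le0.
move=> t /andP[t0 t1] gt; rewrite patchE mem_set; last first.
  by rewrite /= in_itv/= !ltW.
have DMt v : D (g t) v -> `|v| <= M.
  by apply: DM; exists t => //=; rewrite in_itv/= !ltW.
have HB u : `|u| <= L -> `|supp (D (g t)) u| <= B.
  move=> uL; have := supp_lipschitz u 0 DMt; rewrite supp0// !subr0 => /le_trans; apply.
  by rewrite ler_wpM2l// ler_wpM2r// ltW.
have Hcvg : H ^~ t @ \oo --> supp (D (g t)) (derive1 g t).
  apply/cvgrPdist_le => e e0.
  have K0 : 0 < n%:R * M + 1 by rewrite ltr_wpDl// mulr_ge0// ltW.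
  have dn : \forall j \near \oo,
      `|derive1 g t - diff_quot g j t| <= e / (n%:R * M + 1).
    exact: (cvgrPdist_le _ _).1 (diff_quot_cvg gt) _ (divr_gt0 e0 K0).
  apply: filterS dn => j dj; rewrite (le_trans (supp_lipschitz _ _ DMt))//.
  rewrite ler_pdivlMr// in dj; apply: le_trans dj.
  by rewrite mulrCA ler_wpM2l// lerDl.
have [_ HsE] : (limn_einf (fun j => (H j t)%:E) = (supp (D (g t)) (derive1 g t))%:E) *
    (limn_esup (fun j => (H j t)%:E) = (supp (D (g t)) (derive1 g t))%:E).
  by apply: cvg_limn_einf_sup; apply: cvg_EFin => //; exact: nearW.
rewrite /h0 HsE /=.
have : `|supp (D (g t)) (derive1 g t)| <= B.
  apply: (cvgr_to_le (cvg_norm Hcvg)); apply: nearW => j.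
  by apply: HB; exact: diff_quot_norm gL.
by rewrite ler_norml => /andP[lo hi]; rewrite (min_r hi) (max_r lo).
Qed.

End PathIntegrand.

Section ChainRule.
Context {R : realType} {n : nat}.
Notation mu := (@lebesgue_measure R).
Implicit Types (g : R -> 'rV[R]_n) (L : R).

Lemma ae_neq (c : R) : {ae mu, forall t, t != c}.
Proof.
exists [set c]; split; [exact: measurable_set1|exact: lebesgue_measure_set1|].
by move=> t /= /negP; rewrite negbK => /eqP.
Qed.

Lemma ae_reflect (P : R -> Prop) :
  {ae mu, forall t, P t} -> {ae mu, forall t, P (1 - t)}.
Proof.
move=> [N [mN N0 PN]].
have mf : measurable_fun (setT : set (measurableTypeR R))
    (fun t : measurableTypeR R => 1 - t : measurableTypeR R).
  by apply: measurable_funB; [exact: measurable_cst|exact: measurable_id].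
exists ((fun t => 1 - t) @^-1` N); split.
- by rewrite -[X in measurable X]setTI; exact: mf.
- transitivity (pushforward mu (fun t : measurableTypeR R => 1 - t : measurableTypeR R) N) => //.
  rewrite -[RHS]N0; apply/esym.
  apply: lebesgue_measure_unique => // X [[a b] _ <-]/=.
  rewrite /pushforward [X in _ = mu X](_ : _ = `[(1 - b), (1 - a)[%classic); last first.
    apply/seteqP; split=> t /=; rewrite !in_itv/= => /andP[]; lra.
  rewrite !lebesgue_measure_itv/= !lte_fin.
  have -> : (1 - b < 1 - a) = (a < b) by rewrite ltrD2l ltrN2.
  by case: ifP => // _; rewrite -!EFinB; congr EFin; lra.
- by move=> t /= ?; apply: PN.
Qed.

Lemma reflect_derive (V : normedModType R) (g : R -> V) (t : R) :
  derivable g t 1 -> derive1 (fun u => g (1 - u)) (1 - t) = - derive1 g t.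
Proof.
move=> gt; have dg : differentiable g t by exact/derivable1_diffP.
rewrite !derive1E [in RHS]deriveE// -linearN -deriveE//.
rewrite /derive; set a := (fun h : R => _); set b := (fun h : R => _).
suff -> : a = b by [].
apply/funext => h; rewrite /a /b /=.
have -> : 1 - (h *: (1 : R) + (1 - t)) = h *: (- (1 : R)) + t.
  by rewrite /GRing.scale/=; lra.
by have -> : 1 - (1 - t) = t by lra.
Qed.

Variables (f : 'rV[R]_n -> R) (D : 'rV[R]_n -> set 'rV[R]_n).
Hypothesis Df : conservative_field_for f D.

Let Dusc : usc_field D.
Proof. by case: Df => -[]. Qed.

(** The conservative identity for the curve stopped at [s]: after time [s] the
    curve is constant and the integrand is [supp (D _) 0 = 0]. *)
Lemma path_integral_stop L g (h : R -> R) (s : R) : lip_on_line L g ->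
  mu.-integrable setT (EFin \o h) ->
  (forall t, 0 < t < 1 -> derivable g t 1 -> h t = supp (D (g t)) (derive1 g t)) ->
  0 <= s <= 1 ->
  f (g s) - f (g 0) = (\int[mu]_(t in `]0%R, s]) h t)%R.
Proof.
move=> gL hint hE /andP[s0 s1].
have [_ /(_ _ (lip_abs_continuous (lip_stop s gL)))] := Df.
rewrite (min_r s1) (min_l s0) /path_integral.
pose gs (t : R) := g (Num.min t s).
pose l (t : R) := supp (D (gs t)) (derive1 gs t).
rewrite -[X in _ = X -> _]/(\int[mu]_(t in `[0%R, 1%R]) (l t)%:E)%E => fE.
have m01 : measurable (`[0, 1]%classic : set (measurableTypeR R)) by exact: measurable_itv.
have m0s : measurable (`]0, s]%classic : set (measurableTypeR R)) by exact: measurable_itv.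
have mh : measurable_fun (setT : set (measurableTypeR R)) (EFin \o h : measurableTypeR R -> \bar R).
  exact: measurable_int hint.
have ae1 := lip_curve_ae_derivable 0 1 gL.
pose k : measurableTypeR R -> \bar R := (EFin \o h) \_ `]0, s]%classic.
have eqI : (\int[mu]_(t in `[0%R, 1%R]) k t = \int[mu]_(t in `]0%R, s]) (h t)%:E)%E.
  rewrite /k -integral_mkcondl setIidl// => t /=; rewrite !in_itv/= => /andP[t0 ts].
  by rewrite ltW//= (le_trans ts).
have : (f (g s) - f (g 0))%:E = (\int[mu]_(t in `]0%R, s]) (h t)%:E)%E.
  rewrite fE -eqI; apply: integral_ae_eq_measurable => //.
    apply: (measurable_funS measurableT) => //.
    by apply/(measurable_restrictT _ m0s); exact: measurable_funTS mh.
  have ne : {ae mu, forall t, [/\ t != 0, t != 1 & t != s]}.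
    by apply: filterS3 (ae_neq 0) (ae_neq 1) (ae_neq s).
  apply: filterS2 ae1 ne => t gt [t0 t1 ts].
  rewrite /= in_itv/= => /andP[t0' t1'].
  have t01 : 0 < t < 1 by rewrite !lt_neqAle t1 t0' t1' eq_sym t0.
  have {}gt := gt t01; case/andP: (t01) => t0'' t1''.
  have [tls|st|tsE] := ltgtP t s; last by rewrite tsE eqxx in ts.
    have -> : k t = (h t)%:E.
      by rewrite /k patchE mem_set//= in_itv/= t0'' ltW.
    have -> // : l t = h t.
    rewrite (hE _ t01 gt) /l {1}/gs (min_l (ltW tls)); congr (supp _ _).
    rewrite !derive1E; apply: near_eq_derive.
    by near=> u; rewrite /gs min_l//; near: u; apply: filterS (lt_nbhsl tls) => z /ltW.
  have -> : k t = 0%E.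
    by rewrite /k patchE memNset//= in_itv/= t0'' leNgt st.
  have -> // : l t = 0.
  rewrite /l {1}/gs (min_r (ltW st)) -[RHS](supp0 Dusc (g s)); congr (supp _ _).
  rewrite derive1E (@near_eq_derive _ _ _ _ (cst (g s))) ?derive_cst//.
  by near=> u; rewrite /gs min_r//; near: u; apply: filterS (lt_nbhsr st) => z /ltW.
by move=> /(congr1 fine).
Unshelve. all: by end_near. Qed.

Lemma path_derive L g : lip_on_line L g ->
  {ae mu, forall t : R, 0 < t < 1 ->
    is_derive t (1 : R) (fun t : R => f (g t) : R) (supp (D (g t)) (derive1 g t))}.
Proof.
move=> gL; have [h [hint hE]] := path_integrand Df gL.
have FE := path_integral_stop gL hint hE.
have hintS (A : set R) : measurable A -> mu.-integrable A (EFin \o h).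
  by move=> mA; apply: integrableS hint.
have FE' s t : 0 <= s -> s <= t -> t <= 1 ->
    f (g t) - f (g s) = (\int[mu]_(x in `]s, t]) h x)%R.
  move=> s0 st t1.
  rewrite -(@Rintegral_itvB _ _ (BRight 0) (BRight t) s) ?bnd_simp//; last first.
    by apply: hintS; exact: measurable_itv.
  by rewrite -!FE ?s0/= ?(le_trans s0 st) ?(le_trans st t1)//; lra.
apply: filterS2 (primitive_ae_derive hint FE') (lip_curve_ae_derivable 0 1 gL).
by move=> t + + t01 => /(_ t01) + /(_ t01) gt; rewrite hE.
Qed.

(** [path_derive] for a curve and for its reversal shows that the support function
    of [D] takes opposite values at [g'] and [- g'], so all elements of [D (g t)]
    have the same product with [g'] and this product is the derivative of [f]
    along the curve. *)
Lemma chain_rule L g : lip_on_line L g ->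
  {ae mu, forall t : R, 0 < t < 1 -> derivable g t 1 /\
    exists d : R, is_derive t (1 : R) (fun t : R => f (g t) : R) d /\
      forall v, D (g t) v -> dot (derive1 g t) v = d}.
Proof.
move=> gL; pose r (t : R) := g (1 - t).
have rL : lip_on_line L r.
  move=> s t; apply: (le_trans (gL _ _)).
  by have -> : 1 - s - (1 - t) = t - s; [lra|rewrite distrC].
have H1 := path_derive gL; have H2 := ae_reflect (path_derive rL).
apply: filterS3 H1 H2 (lip_curve_ae_derivable 0 1 gL) => t H1 H2 H3 t01.
have {}H1 := H1 t01; have {}H3 := H3 t01.
have {}H2 : is_derive (1 - t) (1 : R) (fun u => f (r u) : R)
    (supp (D (r (1 - t))) (derive1 r (1 - t))).
  by apply: H2; case/andP: t01 => t0 t1; apply/andP; split; lra.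
split=> //; exists (supp (D (g t)) (derive1 g t)); split=> // v Dv.
have rt : r (1 - t) = g t by rewrite /r; congr g; lra.
have dr : derive1 r (1 - t) = - derive1 g t by exact: reflect_derive.
have dfr : supp (D (r (1 - t))) (derive1 r (1 - t)) = - supp (D (g t)) (derive1 g t).
  have [F1 <-] := H1; have [F2 <-] := H2; rewrite -!derive1E.
  exact: (reflect_derive (g := fun t : R => f (g t) : R)).
apply/eqP; rewrite eq_le supp_ge//=.
rewrite -lerN2 -dfr rt dr -dotNl; exact: supp_ge.
Qed.

End ChainRule.

(** * Definable predicates and functions *)

Section Definability.
Context {R : realType} (S : forall m : nat, set (set 'rV[R]_m)).
Hypothesis Somin : o_minimal S.
Implicit Types (e : nat -> R) (P Q : (nat -> R) -> Prop) (m k l : nat).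

(** Definability is handled with predicates of a valuation of countably many
    variables rather than with subsets of spaces of row vectors: Boolean
    operations, quantifiers and substitutions then need no change of dimension. *)
Definition env m (x : 'rV[R]_m) (i : nat) : R :=
  if insub i is Some j then x 0 j else 0.

Definition vec m e : 'rV[R]_m := \row_i e i.

Definition agree m e e' := forall i, (i < m)%N -> e i = e' i.

Definition depends_below m P := forall e e', agree m e e' -> P e -> P e'.

Definition definable_below m P :=
  depends_below m P /\ @S m [set x | P (env x)].

Lemma env_ord m (x : 'rV[R]_m) (i : 'I_m) : env x i = x 0 i.
Proof. by rewrite /env valK. Qed.

Lemma env_lt m (x : 'rV[R]_m) i (im : (i < m)%N) : env x i = x 0 (Ordinal im).
Proof. by rewrite -(env_ord x (Ordinal im)). Qed.

Lemma vec_env m (x : 'rV[R]_m) : vec m (env x) = x.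
Proof. by apply/rowP => i; rewrite mxE env_ord. Qed.

Lemma agree_sym m e e' : agree m e e' -> agree m e' e.
Proof. by move=> h i /h. Qed.

Lemma depends_iff m P e e' : depends_below m P -> agree m e e' -> (P e <-> P e').
Proof. by move=> dP h; split; apply: dP => //; exact: agree_sym. Qed.

Lemma depends_le m k P : (m <= k)%N -> depends_below m P -> depends_below k P.
Proof. by move=> mk dP e e' h; apply: dP => i im; apply: h; exact: leq_trans mk. Qed.

Lemma definable_below_iff m P Q : (forall e, P e <-> Q e) ->
  definable_below m P -> definable_below m Q.
Proof. by move=> PQ; rewrite (_ : P = Q)//; apply/funext => e; exact/propext. Qed.

Lemma omin_iff m (A B : set 'rV[R]_m) : (forall x, A x <-> B x) -> @S m A -> @S m B.
Proof. by move=> AB; rewrite (_ : A = B)//; apply/seteqP; split=> x /AB. Qed.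

Lemma definable_belowS m P : definable_below m P -> definable_below m.+1 P.
Proof.
move=> [dP SP]; split; first exact: depends_le dP.
rewrite -addn1; apply: omin_iff (omin_prodr Somin SP) => z /=.
apply: depends_iff dP _ => i im.
have im1 : (i < m + 1)%N by rewrite addn1 ltnS ltnW.
rewrite (env_lt _ im) (env_lt _ im1) mxE; congr (z _ _); exact: val_inj.
Qed.

Lemma definable_below_le m k P : (m <= k)%N ->
  definable_below m P -> definable_below k P.
Proof.
move=> mk; rewrite -(subnK mk); elim: (k - m)%N => // j IH /IH.
exact: definable_belowS.
Qed.

Lemma definable_belowC m P : definable_below m P -> definable_below m (fun e => ~ P e).
Proof.
move=> [dP SP]; split; last exact: omin_setC SP.
by move=> e e' /agree_sym h nP /(dP _ _ h).
Qed.

Lemma definable_belowU m P Q : definable_below m P -> definable_below m Q ->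
  definable_below m (fun e => P e \/ Q e).
Proof.
move=> [dP SP] [dQ SQ]; split; last exact: omin_setU SP SQ.
by move=> e e' h [/(dP _ _ h)|/(dQ _ _ h)]; [left|right].
Qed.

Lemma definable_belowI m P Q : definable_below m P -> definable_below m Q ->
  definable_below m (fun e => P e /\ Q e).
Proof.
move=> hP hQ.
have := definable_belowC (definable_belowU (definable_belowC hP) (definable_belowC hQ)).
apply: definable_below_iff => e; split=> [h|[? ?] []//].
by split; apply: contrapT => ?; apply: h; [left|right].
Qed.

Lemma definable_belowT m : definable_below m (fun=> True).
Proof. by split => //; exact: omin_setT. Qed.

Lemma definable_below_shift k m P : definable_below m P ->
  definable_below (k + m) (fun e => P (fun i => e (k + i)%N)).
Proof.
elim: k => [|k IH] hP; first exact: hP.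
have [dP SP] := IH hP; split.
  by move=> e e' h; apply: (dP (fun i => e i.+1) (fun i => e' i.+1)) => i im; exact: h.
apply: omin_iff (omin_prodl Somin SP) => z /=.
apply: (depends_iff (e' := fun i => env z i.+1) dP) => i im.
have im1 : (i.+1 < 1 + (k + m))%N by [].
by rewrite (env_lt _ im) (env_lt _ im1) mxE; congr (z _ _); exact: val_inj.
Qed.

Definition upd e m (y : R) i := if i == m then y else e i.

Lemma definable_below_proj m P : definable_below m.+1 P ->
  definable_below m (fun e => exists y, P (upd e m y)).
Proof.
rewrite -addn1 => -[dP SP]; split.
  move=> e e' h [y Py]; exists y; apply: dP Py => i; rewrite addn1 ltnS /upd.
  by rewrite leq_eqVlt => /orP[/eqP ->|im]; [rewrite eqxx|case: ifP => // _; exact: h].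
apply: omin_iff (omin_proj Somin SP) => x /=; split.
  move=> [z Pz <-]; exists (z 0 (rshift m ord0)); apply: dP Pz => i im.
  rewrite (env_lt _ im) /upd; case: eqP => [im'|/eqP ne].
    by congr (z _ _); apply: val_inj; rewrite /= im' addn0.
  have im1 : (i < m)%N by lia.
  by rewrite (env_lt _ im1) mxE; congr (z _ _); exact: val_inj.
move=> [y Py]; exists (row_mx x (\row_(_ < 1) y)); last by rewrite row_mxKl.
apply: dP Py => i im; rewrite (env_lt _ im) /upd mxE.
case: splitP => [j /= ij|j /= ij]; last by rewrite mxE ifT// ij ord1 addn0.
by rewrite ij (ltn_eqF (ltn_ord j)) env_ord.
Qed.

(** A set defined with superfluous variables is recovered by projecting them out. *)
Lemma definable_below_lower m P : definable_below m.+1 P -> depends_below m P ->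
  definable_below m P.
Proof.
move=> hP dP; apply: definable_below_iff (definable_below_proj hP) => e.
have ag y : agree m e (upd e m y) by move=> i im; rewrite /upd (ltn_eqF im).
by split=> [[y /(depends_iff dP (ag y))]|/(depends_iff dP (ag 0)) ?] //; exists 0.
Qed.

Lemma definable_below_lower_le m k P : (m <= k)%N -> definable_below k P ->
  depends_below m P -> definable_below m P.
Proof.
move=> mk; rewrite -(subnK mk); elim: (k - m)%N => // j IH hP dP.
apply: (IH _ dP); apply: definable_below_lower hP _; apply: depends_le dP.
exact: leq_addl.
Qed.

Lemma definable_below_eq i j : definable_below (maxn i j).+1 (fun e => e i = e j).
Proof.
have im : (i < (maxn i j).+1)%N by rewrite ltnS leq_maxl.
have jm : (j < (maxn i j).+1)%N by rewrite ltnS leq_maxr.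
split; first by move=> e e' h; rewrite !h.
apply: omin_iff (omin_diag Somin (Ordinal im) (Ordinal jm)) => x /=.
by rewrite (env_lt _ im) (env_lt _ jm).
Qed.

(** Substitution of the functions [t 0], ..., [t (m - 1)] for the variables of
    [P]: the substituted predicate is the projection of the set where [m] fresh
    variables satisfy [P] and are equal to the [t i]. *)
Lemma definable_below_subst m k P (t : nat -> (nat -> R) -> R) :
  definable_below m P ->
  (forall i, (i < m)%N -> forall e e', agree k e e' -> t i e = t i e') ->
  (forall i, (i < m)%N ->
    definable_below (k + m) (fun e => e (k + i)%N = t i e)) ->
  definable_below k (fun e => P (fun i => t i e)).
Proof.
move=> hP dt ht; have [dP _] := hP.
pose G (l : nat) (e : nat -> R) : Prop :=
  P (fun i => if (i < l)%N then e (k + i)%N else t i e) /\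
  (forall i, (i < l)%N -> e (k + i)%N = t i e).
have hQ l : (l <= m)%N -> definable_below (k + l) (G l).
  move=> lm; rewrite -(subKn lm); elim: (m - l)%N (leq_subr l m) => [_|j IH jm].
    rewrite subn0.
    have hall d : (d <= m)%N -> definable_below (k + m)
        (fun e => forall i, (i < d)%N -> e (k + i)%N = t i e).
      elim: d => [_|d IHd dm].
        by apply: definable_below_iff (definable_belowT _) => e; split.
      apply: definable_below_iff (definable_belowI (IHd (ltnW dm)) (ht d dm)) => e.
      split=> [[h1 h2] i|h]; last by split=> [i id|]; apply: h; lia.
      by rewrite ltnS leq_eqVlt => /orP[/eqP ->//|]; exact: h1.
    apply: definable_below_iff (definable_belowI (definable_below_shift k hP) (hall m (leqnn m))) => e.
    apply: and_iff_compat_r; apply: depends_iff dP _ => i im; by rewrite im.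
  have := IH (ltnW jm); have -> : (m - j = (m - j.+1).+1)%N by lia.
  set l' := (m - j.+1)%N; rewrite addnS => /definable_below_proj.
  have l'm : (l' < m)%N by rewrite /l'; lia.
  have updE e y i : (i < l')%N -> upd e (k + l') y (k + i)%N = e (k + i)%N.
    by move=> il; rewrite /upd ifF//; apply/negbTE; lia.
  have updt e y i : (i < m)%N -> t i (upd e (k + l') y) = t i e.
    by move=> im; apply: dt im _ _ _ => d dk; rewrite /upd ifF//; apply/negbTE; lia.
  apply: definable_below_iff => e; split.
    move=> [y [Py ey]]; split.
      apply: dP Py => i im; rewrite updt// ltnS.
      case: (ltngtP i l') => [il|li|->]; [by rewrite updE|by []|].
      by have := ey l' (ltnSn _); rewrite updt.
    by move=> i il; rewrite -(updE _ y)// ey ?updt//; lia.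
  move=> [Pe ee]; exists (t l' e); split.
    apply: dP Pe => i im; rewrite updt// ltnS.
    case: (ltngtP i l') => [il|li|->]; [by rewrite updE|by []|].
    by rewrite /upd eqxx.
  move=> i; rewrite ltnS leq_eqVlt => /orP[/eqP ->|il].
    by rewrite updt// /upd eqxx.
  by rewrite updE// updt ?ee//; lia.
have := hQ 0%N (leq0n m); rewrite addn0; apply: definable_below_iff => e.
by split=> [[]|Pe]; [|split].
Qed.

(** Definability with an unspecified number of variables, so that the closure
    properties below have no side conditions on indices. *)
Definition dP P := exists m, definable_below m P.

Lemma dP_iff P Q : (forall e, P e <-> Q e) -> dP P -> dP Q.
Proof. by move=> PQ [m hP]; exists m; exact: definable_below_iff PQ hP. Qed.

Lemma dP_not P : dP P -> dP (fun e => ~ P e).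
Proof. by move=> [m hP]; exists m; exact: definable_belowC. Qed.

Lemma dP_or P Q : dP P -> dP Q -> dP (fun e => P e \/ Q e).
Proof.
move=> [m hP] [k hQ]; exists (maxn m k); apply: definable_belowU.
  exact: definable_below_le (leq_maxl _ _) hP.
exact: definable_below_le (leq_maxr _ _) hQ.
Qed.

Lemma dP_and P Q : dP P -> dP Q -> dP (fun e => P e /\ Q e).
Proof.
move=> [m hP] [k hQ]; exists (maxn m k); apply: definable_belowI.
  exact: definable_below_le (leq_maxl _ _) hP.
exact: definable_below_le (leq_maxr _ _) hQ.
Qed.

Lemma dP_imp P Q : dP P -> dP Q -> dP (fun e => P e -> Q e).
Proof.
move=> hP hQ; apply: dP_iff (dP_or (dP_not hP) hQ) => e.
split=> [[nP /nP//|//]|h]; have [Pe|nPe] := pselect (P e); [right; exact: h|by left].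
Qed.

Lemma dP_rename (s : nat -> nat) P : dP P -> dP (fun e => P (fun i => e (s i))).
Proof.
move=> [m hP]; pose k := (\max_(i < m) (s i).+1)%N; exists k.
have sk i : (i < m)%N -> (s i < k)%N.
  by move=> im; exact: (leq_bigmax (F := fun i : 'I_m => (s i).+1) (Ordinal im)).
apply: (definable_below_subst (t := fun i e => e (s i)) hP).
  by move=> i im e e' h; apply: h; exact: sk.
move=> i im; apply: definable_below_le (definable_below_eq _ _).
by have := sk i im; lia.
Qed.

(** De Bruijn convention: the variable bound by a quantifier gets index 0 and the
    others are shifted. *)
Definition scons (y : R) e i := if i is j.+1 then e j else y.

Lemma dP_ex (Q : R -> (nat -> R) -> Prop) :
  dP (fun e => Q (e 0%N) (fun i => e i.+1)) -> dP (fun e => exists y, Q y e).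
Proof.
set P := (fun e => _) => -[m hP].
have [dP_ _] := definable_belowS hP.
have [k hk] := dP_rename (fun i => if i is j.+1 then j else m) (ex_intro _ m hP).
set P' := (fun e => _) in hk.
have dP' : depends_below m.+1 P'.
  move=> e e' h; apply: dP_ => -[|i] im; apply: h => //; lia.
have hP' : definable_below m.+1 P'.
  have [mk|km] := leqP m.+1 k; first exact: definable_below_lower_le mk hk dP'.
  exact: definable_below_le (ltnW km) hk.
exists m; apply: definable_below_iff (definable_below_proj hP') => e.
have E y : P' (upd e m y) <-> Q y e.
  apply: (depends_iff (e' := scons y e) (proj1 hP)).
  by move=> [|i] im; rewrite /upd /= ?eqxx// ifF//; apply/negbTE; lia.
by split=> -[y /E ?]; exists y.
Qed.

Lemma dP_all (Q : R -> (nat -> R) -> Prop) :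
  dP (fun e => Q (e 0%N) (fun i => e i.+1)) -> dP (fun e => forall y, Q y e).
Proof.
move=> /dP_not hQ; apply: dP_iff (dP_not (dP_ex (Q := fun y e => ~ Q y e) hQ)) => e.
split=> [h y|h [y]]; last by apply.
by apply: contrapT => ?; apply: h; exists y.
Qed.

End Definability.

Section DefinableTerms.
Context {R : realType} (S : forall m : nat, set (set 'rV[R]_m)).
Hypothesis Somin : o_minimal S.
Implicit Types (e : nat -> R) (P Q : (nat -> R) -> Prop) (s t : (nat -> R) -> R).
Notation dP := (dP S).

(** A function is definable when its graph is, the value being variable 0. *)
Definition dT t := dP (fun e => e 0%N = t (fun i => e i.+1)).

Lemma dT_depends t : dT t -> exists m, forall e e', agree m e e' -> t e = t e'.
Proof.
move=> [m [dPt _]]; exists m => e e' h.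
apply: (dPt (scons (t e) e) (scons (t e) e')) => //= -[|i] im //=.
by apply: h; lia.
Qed.

Lemma dP_subst P (t : nat -> (nat -> R) -> R) :
  dP P -> (forall i, dT (t i)) -> dP (fun e => P (fun i => t i e)).
Proof.
move=> [m hP] ht.
have [d dE] := choice (fun i => dT_depends (ht i)).
pose k := (\max_(i < m) d i)%N; exists k.
have dk i : (i < m)%N -> forall e e', agree k e e' -> t i e = t i e'.
  move=> im e e' h; apply: dE => j jd; apply: h; apply: leq_trans jd _.
  exact: (leq_bigmax (F := fun i : 'I_m => d i) (Ordinal im)).
apply: (definable_below_subst Somin hP) => // i im.
have [l hl] := dP_rename Somin (fun j => if j is j'.+1 then j' else (k + i)%N) (ht i).
have dep : depends_below (k + m) (fun e => e (k + i)%N = t i e).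
  move=> e e' h; rewrite -(dk i im e e') ?h//; first by lia.
  by move=> j jk; apply: h; lia.
have [lk|kl] := leqP l (k + m).
  exact: (definable_below_le Somin lk hl).
exact: (definable_below_lower_le Somin (ltnW kl) hl dep).
Qed.

Lemma dT_eq s t : (forall e, s e = t e) -> dT s -> dT t.
Proof. by move=> st; rewrite (_ : s = t)//; apply/funext. Qed.

Lemma dT_var i : dT (fun e => e i).
Proof. by exists (maxn 0 i.+1).+1; exact: definable_below_eq. Qed.

Lemma dT_lift t : dT t -> dT (fun e => t (fun i => e i.+1)).
Proof. exact: (dP_rename Somin (fun i => if i is j.+1 then j.+2 else 0%N)). Qed.

Lemma dP_eq s t : dT s -> dT t -> dP (fun e => s e = t e).
Proof.
move=> hs ht; have h : dP (fun e => e 0%N = e 1%N) by exact: (dT_var 0).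
apply: (@dP_subst _ (fun i => if i is 0%N then s else t) h).
by move=> [|i].
Qed.

Lemma dT_subst t (u : nat -> (nat -> R) -> R) :
  dT t -> (forall i, dT (u i)) -> dT (fun e => t (fun i => u i e)).
Proof.
move=> ht hu; apply: (@dP_subst _
  (fun i => if i is j.+1 then (fun e => u j (fun i => e i.+1)) else (fun e => e 0%N)) ht).
by move=> [|i]; [exact: dT_var|exact: dT_lift].
Qed.

Lemma dP_rel1 (P : R -> Prop) s : S [set x : 'rV[R]_1 | P (x 0 0)] -> dT s ->
  dP (fun e => P (s e)).
Proof.
move=> SP hs; apply: (@dP_subst (fun e => P (e 0%N)) (fun=> s)) => //.
exists 1%N; split; first by move=> e e' ->.
by apply: omin_iff SP => x /=; rewrite (env_lt _ (ltn0Sn 0)).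
Qed.

Lemma dP_vec m (A : set 'rV[R]_m) (v : (nat -> R) -> 'rV[R]_m) : S A ->
  (forall i, dT (fun e => v e 0 i)) -> dP (fun e => A (v e)).
Proof.
move=> SA hv.
have h : dP (fun e => A (vec m e)).
  exists m; split.
    move=> e e' h; rewrite (_ : vec m e = vec m e')//.
    by apply/rowP => i; rewrite !mxE h.
  by apply: omin_iff SA => x /=; rewrite vec_env.
apply: dP_iff (@dP_subst _ (fun i e => if insub i is Some j then v e 0 j else 0) h _).
  move=> e; rewrite (_ : vec m _ = v e)//.
  by apply/rowP => i; rewrite mxE valK.
move=> i; case: insubP => [j _ _|_]; first exact: hv.
rewrite /dT; apply: (@dP_rel1 (fun x => x = 0)); last exact: (dT_var 0).
apply/(omin_intervals Somin); exists [:: `[0%R, 0%R]].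
apply/seteqP; split=> x /=.
  by move=> ->; exists `[0%R, 0%R]; rewrite ?mem_head// in_itv/= lexx.
by move=> [I]; rewrite mem_seq1 => /eqP ->; rewrite in_itv/= => /le_anti.
Qed.

Lemma dT_cst (c : R) : dT (fun=> c).
Proof.
apply: (@dP_rel1 (fun x => x = c)); last exact: (dT_var 0).
apply/(omin_intervals Somin); exists [:: `[c, c]].
apply/seteqP; split=> x /=.
  by move=> ->; exists `[c, c]; rewrite ?mem_head// in_itv/= lexx.
by move=> [I]; rewrite mem_seq1 => /eqP ->; rewrite in_itv/= => /le_anti.
Qed.

Lemma dT_op (op : R -> R -> R) s t :
  S [set x : 'rV[R]_3 | op (x 0 0) (x 0 1) = x 0 2] ->
  dT s -> dT t -> dT (fun e => op (s e) (t e)).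
Proof.
move=> Sop hs ht.
pose v e : 'rV[R]_3 := \row_i (if i == 0 :> nat then s (fun i => e i.+1)
  else if i == 1 :> nat then t (fun i => e i.+1) else e 0%N).
apply: dP_iff (@dP_vec _ _ v Sop _).
  by move=> e; rewrite /= !mxE/=; split.
move=> i; apply: (@dT_eq (if i == 0 :> nat then (fun e => s (fun i => e i.+1))
  else if i == 1 :> nat then (fun e => t (fun i => e i.+1)) else (fun e => e 0%N))).
  by move=> e; rewrite mxE; case: ifP => // _; case: ifP.
case: ifP => _; first exact: dT_lift.
by case: ifP => _; [exact: dT_lift|exact: dT_var].
Qed.

Lemma dT_add s t : dT s -> dT t -> dT (fun e => s e + t e).
Proof. by apply: (dT_op (op := +%R)); exact: omin_add Somin. Qed.

Lemma dT_mul s t : dT s -> dT t -> dT (fun e => s e * t e).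
Proof. by apply: (dT_op (op := *%R)); exact: omin_mul Somin. Qed.

Lemma dT_opp s : dT s -> dT (fun e => - s e).
Proof.
move=> hs; apply: (@dT_eq (fun e => -1 * s e)); first by move=> e; rewrite mulN1r.
by apply: dT_mul => //; exact: dT_cst.
Qed.

Lemma dT_sub s t : dT s -> dT t -> dT (fun e => s e - t e).
Proof. by move=> hs ht; apply: dT_add => //; exact: dT_opp. Qed.

Lemma dT_sum (I : Type) (r : seq I) (s : I -> (nat -> R) -> R) :
  (forall i, dT (s i)) -> dT (fun e => \sum_(i <- r) s i e).
Proof.
move=> hs; elim: r => [|i r IH].
  by apply: dT_eq (dT_cst 0) => e; rewrite big_nil.
by apply: dT_eq (dT_add (hs i) IH) => e; rewrite big_cons.
Qed.

Lemma dP_gt0 s : dT s -> dP (fun e => 0 < s e).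
Proof.
apply: (@dP_rel1 (fun x => 0 < x)); apply/(omin_intervals Somin).
exists [:: `]0%R, +oo[]; apply/seteqP; split=> x /=.
  by move=> x0; exists `]0%R, +oo[; rewrite ?mem_head// in_itv/= x0.
by move=> [I]; rewrite mem_seq1 => /eqP ->; rewrite in_itv/= andbT.
Qed.

Lemma dP_lt s t : dT s -> dT t -> dP (fun e => s e < t e).
Proof.
move=> hs ht; apply: dP_iff (dP_gt0 (dT_sub ht hs)) => e.
by rewrite subr_gt0.
Qed.

Lemma dP_le s t : dT s -> dT t -> dP (fun e => s e <= t e).
Proof.
move=> hs ht; apply: dP_iff (dP_not Somin (dP_lt ht hs)) => e.
by rewrite leNgt; split=> /negP.
Qed.

Lemma dT_norm s : dT s -> dT (fun e => `|s e|).
Proof.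
move=> hs; have hs' := dT_lift hs; have h0 := dT_var 0.
apply: dP_iff (dP_or Somin
  (dP_and Somin (dP_le (dT_cst 0) hs') (dP_eq h0 hs'))
  (dP_and Somin (dP_lt hs' (dT_cst 0)) (dP_eq h0 (dT_opp hs')))) => e.
set x := s _; have [x0|x0] := leP 0 x; rewrite ?(ger0_norm x0) ?(ltr0_norm x0); split.
- by move=> [[_ ->]|[]//].
- by move=> ->; left.
- by move=> [[]//|[_ ->]].
- by move=> ->; right.
Qed.

Definition dV m (v : (nat -> R) -> 'rV[R]_m) := forall i, dT (fun e => v e 0 i).

Lemma dT_dot m (v w : (nat -> R) -> 'rV[R]_m) : dV v -> dV w ->
  dT (fun e => dot (v e) (w e)).
Proof. by move=> hv hw; apply: dT_sum => i; exact: dT_mul. Qed.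

(** A quantifier over row vectors is a block of [m] real quantifiers. *)
Lemma dP_ex_vec m (Q : 'rV[R]_m -> (nat -> R) -> Prop) :
  dP (fun e => Q (vec m e) (fun i => e (m + i)%N)) ->
  dP (fun e => exists v, Q v e).
Proof.
move=> hQ.
suff h : dP (fun e => exists a : nat -> R,
    Q (vec m (fun i => if (i < m)%N then a i else e (i - m)%N))
      (fun i => e i)).
  apply: dP_iff h => e; split=> [[a Qa]|[v Qv]]; first by eexists; exact: Qa.
  exists (env v); rewrite (_ : vec m _ = v)//.
  by apply/rowP => i; rewrite mxE ltn_ord env_ord.
suff h (P : (nat -> R) -> Prop) : dP P ->
    dP (fun e => exists a : nat -> R, P (fun i => if (i < m)%N then a i else e (i - m)%N)).
  apply: dP_iff (h _ hQ) => e; split=> -[a Qa]; exists a; move: Qa.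
    rewrite [X in Q _ X -> _](_ : _ = e)//; apply/funext => i.
    by rewrite ltnNge leq_addr/= addKn.
  rewrite [X in _ -> Q _ X](_ : _ = e)//; apply/funext => i.
  by rewrite ltnNge leq_addr/= addKn.
elim: m {hQ Q} P => [|m IH] P hP.
  apply: dP_iff hP => e; have E : (fun i : nat => e (i - 0)%N) = e.
    by apply/funext => i; rewrite subn0.
  by split=> [Pe|[a]]; rewrite /= ?E//; exists e; rewrite E.
have hP1 : dP (fun e => exists y, P (scons y e)).
  apply: (dP_ex Somin (Q := fun y e => P (scons y e))).
  apply: dP_iff hP => e; rewrite (_ : scons _ _ = e)//.
  by apply/funext => -[].
apply: dP_iff (IH _ hP1) => e; split.
  move=> [a [y Pa]]; exists (scons y a); move: Pa; congr P.
  by apply/funext => -[|i].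
move=> [a Pa]; exists (fun i => a i.+1), (a 0%N); move: Pa; congr P.
by apply/funext => -[|i].
Qed.

Lemma dP_all_vec m (Q : 'rV[R]_m -> (nat -> R) -> Prop) :
  dP (fun e => Q (vec m e) (fun i => e (m + i)%N)) ->
  dP (fun e => forall v, Q v e).
Proof.
move=> /(dP_not Somin) /(@dP_ex_vec _ (fun v e => ~ Q v e)) /(dP_not Somin).
apply: dP_iff => e; split=> [h v|h [v]]; last by apply.
by apply: contrapT => ?; apply: h; exists v.
Qed.

Lemma dT_fun n (f : 'rV[R]_n -> R) (v : (nat -> R) -> 'rV[R]_n) :
  definable_fun S f -> dV v -> dT (fun e => f (v e)).
Proof.
move=> Sf hv.
apply: dP_iff (@dP_vec _ _ (fun e => row_mx (v (fun i => e i.+1)) (\row__ e 0%N)) Sf _).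
  by move=> e; rewrite /= row_mxKl row_mxKr mxE.
move=> i; case: (splitP i) => j ij.
  apply: dT_eq (dT_lift (hv j)) => e.
  by rewrite (_ : i = lshift 1 j) ?row_mxEl//; exact: val_inj.
apply: dT_eq (dT_var 0) => e.
by rewrite (_ : i = rshift n j) ?row_mxEr ?mxE//; exact: val_inj.
Qed.

Lemma dP_map n (F : 'rV[R]_n -> set 'rV[R]_n) (v w : (nat -> R) -> 'rV[R]_n) :
  definable_map S F -> dV v -> dV w -> dP (fun e => F (v e) (w e)).
Proof.
move=> SF hv hw; apply: dP_iff (@dP_vec _ _ (fun e => row_mx (v e) (w e)) SF _).
  by move=> e; rewrite /= row_mxKl row_mxKr.
move=> i; case: (splitP i) => j ij.
  apply: dT_eq (hv j) => e.
  by rewrite (_ : i = lshift n j) ?row_mxEl//; exact: val_inj.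
apply: dT_eq (hw j) => e.
by rewrite (_ : i = rshift n j) ?row_mxEr ?mxE//; exact: val_inj.
Qed.

(** The superfluous variables are projected out, so that the o-minimality axiom for
    subsets of the line applies. *)
Lemma definable_line (P : R -> Prop) : dP (fun e => P (e 0%N)) ->
  exists r : seq (interval R), forall x, P x <-> exists2 I, I \in r & x \in I.
Proof.
move=> [m hP].
have dep : depends_below 1 (fun e => P (e 0%N)) by move=> e e' ->.
have [_ S1] : definable_below S 1 (fun e => P (e 0%N)).
  have [m1|m1] := leqP m 1; first exact: (definable_below_le Somin m1 hP).
  exact: (definable_below_lower_le Somin (ltnW m1) hP dep).
have [r rE] := (omin_intervals Somin _).1 S1; exists r => x.
have := congr1 (fun A : set 'rV[R]_1 => A (const_mx x)) rE => /=.
by rewrite (env_lt _ (ltn0Sn 0)) !mxE => ->.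
Qed.

End DefinableTerms.

(** * Definable functions of one variable *)

Section LineGerms.
Context {R : realType}.
Implicit Types (P Q : R -> Prop) (a b t s : R).

(** Constancy of a predicate on a right neighbourhood; this is the only
    consequence of o-minimality that the one-variable arguments use. *)
Definition germ_right P t := exists2 d : R, 0 < d &
  (forall s, t < s < t + d -> P s) \/ (forall s, t < s < t + d -> ~ P s).

Lemma germ_right_and P Q t : germ_right P t -> germ_right Q t ->
  germ_right (fun s => P s /\ Q s) t.
Proof.
move=> [d d0 hP] [c c0 hQ]; exists (Num.min c d); first by rewrite lt_min c0.
have h s : t < s < t + Num.min c d -> t < s < t + c /\ t < s < t + d.
  move=> /andP[ts]; rewrite ts /=.
  by case: (leP c d) => cd st; split; lra.
case: hP => hP; last by right=> s /h[_ /hP nP] [].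
case: hQ => hQ; last by right=> s /h[/hQ nQ _] [].
by left=> s /h[/hQ ? /hP].
Qed.

Lemma germ_right_not P t : germ_right P t -> germ_right (fun s => ~ P s) t.
Proof.
by move=> [d d0 [hP|hP]]; exists d => //; [right=> s /hP Ps /(_ Ps)|left].
Qed.

Lemma germ_right_iff P Q t : (forall s, P s <-> Q s) -> germ_right P t -> germ_right Q t.
Proof. by move=> PQ; rewrite (_ : P = Q)//; apply/funext => s; exact/propext. Qed.

Lemma germ_right_or P Q t : germ_right P t -> germ_right Q t ->
  germ_right (fun s => P s \/ Q s) t.
Proof.
move=> /germ_right_not hP /germ_right_not hQ.
apply: germ_right_iff (germ_right_not (germ_right_and hP hQ)) => s.
split; last by move=> [?|?] [].
by move=> h; have [|nP] := pselect (P s); [left|right; apply: contrapT => nQ; exact: h].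
Qed.

(** Membership in an interval is a combination of an upward closed condition and
    of the negation of one, and an upward closed predicate has constant germs. *)
Lemma germ_right_up P t : (forall s s', s <= s' -> P s -> P s') -> germ_right P t.
Proof.
move=> up; have [[s ts nP]|h] := pselect (exists2 s, t < s & ~ P s).
  exists (s - t); first by rewrite subr_gt0.
  right=> s' /andP[_ s's] Ps'; apply: nP; apply: up Ps'; lra.
exists 1 => //; left=> s /andP[ts _]; apply: contrapT => nP; apply: h.
by exists s.
Qed.

Lemma germ_right_itv (I : interval R) t : germ_right (fun s => s \in I) t.
Proof.
case: I => l r; apply: (@germ_right_iff (fun s => (l <= BLeft s)%O /\ (BRight s <= r)%O)).
  by move=> s; rewrite itv_boundlr; split=> [[? ?]|/andP[]//]; apply/andP.
apply: germ_right_and.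
  by apply: germ_right_up => s s' ss' /le_trans; apply; rewrite bnd_simp.
apply: (germ_right_iff (P := fun s => ~ ~ (BRight s <= r)%O)).
  by move=> s; split=> [/contrapT//|? []].
apply: germ_right_not; apply: germ_right_up => s s' ss' h h'; apply: h.
by apply: le_trans h'; rewrite bnd_simp.
Qed.

Definition splits_intervals P := forall a b, a < b -> exists c d,
  [/\ a < c, c < d, d < b & (forall s, c < s < d -> P s) \/ (forall s, c < s < d -> ~ P s)].

Lemma germ_right_splits P : (forall t, germ_right P t) -> splits_intervals P.
Proof.
move=> gP a b ab; have [d d0 h] := gP a.
pose w := Num.min d (b - a).
have w0 : 0 < w by rewrite /w lt_min d0 subr_gt0.
have wd : w <= d by rewrite /w ge_min lexx.
have wb : w <= b - a by rewrite /w ge_min lexx orbT.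
exists (a + w / 3), (a + 2 * w / 3); split; [lra|lra|lra|].
by case: h => h; [left|right] => s /andP[s1 s2]; apply: h; apply/andP; split; lra.
Qed.

(** A Baire category argument: if no set contained a subinterval, nested intervals
    could be chosen so that the [k]-th one avoids the [k]-th set, and their common
    point would not be covered. *)
Lemma interval_cover (A : nat -> R -> Prop) a b :
  (forall k, splits_intervals (A k)) -> a < b ->
  (forall t, a < t < b -> exists k, A k t) ->
  exists k c d, [/\ a < c, c < d, d < b & forall t, c < t < d -> A k t].
Proof.
move=> sA ab cov; apply: contrapT => nA.
pose ok (p : R * R) := [/\ a <= p.1, p.1 < p.2 & p.2 <= b].
have step (kp : nat * (R * R)) : exists q : R * R, ok kp.2 ->
    [/\ ok q, kp.2.1 < q.1, q.2 < kp.2.2 & forall s, q.1 < s < q.2 -> ~ A kp.1 s].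
  case: kp => k p /=.
  have [okp|] := pselect (ok p); last by exists p.
  have [ap p12 pb] := okp.
  have [c [d [pc cd dp [h|h]]]] := sA k _ _ p12; last first.
    by exists (c, d) => _; split => //; split => //=; lra.
  exfalso; apply: nA; exists k, c, d; split => //; lra.
have [F FE] := choice step.
pose p := fix p k := if k is k'.+1 then F (k', p k') else (a, b).
have okp k : ok (p k).
  elim: k => [|k IH]; first by split => /=.
  by have [] := FE (k, p k) IH.
have pS k := FE (k, p k) (okp k).
have pnd : {homo (fun k => (p k).1) : i j / (i <= j)%N >-> i <= j}.
  apply: homo_leq => //; first by move=> ? ? ?; exact: le_trans.
  by move=> k; have [_ /ltW] := pS k.
have pni : {homo (fun k => (p k).2) : i j / (i <= j)%N >-> j <= i}.
  apply: homo_leq => //; first by move=> ? ? ? h1 h2; exact: le_trans h2 h1.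
  by move=> k; have [_ _ /ltW] := pS k.
have lt12 i j : (p i).1 < (p j).2.
  have [_ h _] := okp (maxn i j); apply: le_lt_trans (pnd _ _ (leq_maxl i j)) _.
  exact: lt_le_trans h (pni _ _ (leq_maxr i j)).
pose E := range (fun k => (p k).1).
have supE : has_sup E.
  by split; [exists a, 0%N|exists b => _ [k _ <-]; exact/ltW/(lt12 k 0%N)].
pose x := sup E.
have px k : (p k).1 < x.
  have [_ h _ _] := pS k; apply: lt_le_trans h _.
  by apply: (ub_le_sup supE.2); exists k.+1.
have xp k : x < (p k).2.
  have [_ _ h _] := pS k; apply: le_lt_trans h.
  apply: ge_sup; first exact: supE.1.
  by move=> _ [j _ <-]; exact: ltW (lt12 j k.+1).
have [k Ak] : exists k, A k x by apply: cov; apply/andP; split; [exact: (px 0%N)|exact: (xp 0%N)].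
by have [_ _ _ /(_ x)] := pS k; apply => //; apply/andP; split; [exact: (px k.+1)|exact: (xp k.+1)].
Qed.

End LineGerms.

Section DefinableLine.
Context {R : realType} (S : forall m : nat, set (set 'rV[R]_m)).
Hypothesis Somin : o_minimal S.
Implicit Types (P : R -> Prop) (g : R -> R) (a b c d s t K : R).
Notation dP := (dP S).
Notation dT := (dT S).

Definition dP1 P := dP (fun e => P (e 0%N)).
Definition dT1 g := dT (fun e => g (e 0%N)).

Lemma dP1_comp P (s : (nat -> R) -> R) : dP1 P -> dT s -> dP (fun e => P (s e)).
Proof. by move=> hP hs; exact: (@dP_subst _ _ Somin _ (fun=> s) hP). Qed.

Lemma dT1_comp g (s : (nat -> R) -> R) : dT1 g -> dT s -> dT (fun e => g (s e)).
Proof. by move=> hg hs; exact: (@dT_subst _ _ Somin _ (fun=> s) hg). Qed.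

Lemma definable_germ_right P t : dP1 P -> germ_right P t.
Proof.
move=> /(definable_line Somin)[r rE].
apply: (germ_right_iff (P := fun x => exists2 I, I \in r & x \in I)).
  by move=> x; symmetry; exact: rE.
elim: r {rE} => [|I r IH].
  by exists 1 => //; right=> s _ [].
apply: germ_right_iff (germ_right_or (germ_right_itv I t) IH) => s; split.
  move=> [sI|[J Jr sJ]]; first by exists I; rewrite ?mem_head.
  by exists J => //; rewrite inE Jr orbT.
move=> [J]; rewrite inE => /predU1P[-> ?|Jr sJ]; first by left.
by right; exists J.
Qed.

Lemma definable_splits P : dP1 P -> splits_intervals P.
Proof. by move=> hP; apply: germ_right_splits => t; exact: definable_germ_right. Qed.

(** The right difference quotients of [h] at [t] tend to [+oo]. *)
Definition steep (h : R -> R) t := forall K, exists2 d, 0 < d &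
  forall s, t < s < t + d -> K * (s - t) < h s - h t.

(** By [interval_cover] the function would be strictly increasing on a subinterval
    [[p, q]]. A supremum argument in the style of the mean value inequality then
    gives [g q - g p >= K * (q - p)] for every [K]. *)
Lemma no_vertical_increase g a b : dT1 g -> a < b ->
  ~ (forall t, a < t < b -> steep g t).
Proof.
move=> hg ab g_steep.
pose A k t := forall s, t < s -> (k.+1%:R * (s - t) < 1) -> 0 < g s - g t.
have dA k : dP1 (A k).
  rewrite /dP1 /A.
  apply: (dP_all Somin) => /=; apply: (dP_imp Somin).
    by apply: (dP_lt Somin); exact: dT_var.
  apply: (dP_imp Somin).
    apply: (dP_lt Somin); last exact: dT_cst.
    apply: (dT_mul Somin); first exact: dT_cst.
    by apply: (dT_sub Somin); exact: dT_var.
  apply: (dP_gt0 Somin).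
  by apply: (dT_sub Somin); apply: (dT1_comp hg); exact: dT_var.
have [||k [c [d [ac cd db Ak]]]] := @interval_cover _ A a b _ ab.
- by move=> k; exact: definable_splits.
- move=> t /g_steep /(_ 0)[e e0 he].
  have [k ke] : exists k : nat, k.+1%:R^-1 < e.
    exists (Num.bound e^-1); rewrite invf_plt ?posrE//.
    apply: lt_trans (archi_boundP _) _; rewrite ?invr_ge0 ?ltW// ltr_nat.
    exact: ltnSn.
  exists k => s ts ks; have := he s; rewrite mul0r; apply.
  rewrite ts/= -ltrBlDl; apply: lt_trans ke.
  by rewrite -ltr_pdivlMl ?mulr1 in ks.
pose w := Num.min (d - c) (k.+1%:R^-1).
have w0 : 0 < w by rewrite lt_min subr_gt0 cd invr_gt0 ltr0n.
have [wd wk] : w <= d - c /\ w <= k.+1%:R^-1 by rewrite !ge_min !lexx orbT.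
pose p := c + w / 3; pose q := c + 2 * w / 3.
have kw : k.+1%:R * w <= 1 by rewrite -ler_pdivlMl ?mulr1.
have inc s t : p <= s -> s < t -> t <= q -> g s < g t.
  rewrite /p /q => ps st tq; rewrite -subr_gt0; apply: (Ak s) => //.
    by apply/andP; split; lra.
  apply: lt_le_trans kw; rewrite ltr_pM2l//; lra.
have pq : p < q by rewrite /p /q; lra.
have grow K : 0 <= K -> K * (q - p) <= g q - g p.
  (* [g] may be discontinuous: monotonicity controls [g] to the left of
     the supremum, and the growth condition to its right *)
  move=> K0; pose E := [set s | p <= s <= q /\ K * (s - p) <= g s - g p].
  have Ep : E p by rewrite /E/= !lexx ltW// !subrr mulr0.
  have ubE : ubound E q by move=> s [/andP[]].
  have supE : has_sup E by split; [exists p|exists q].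
  pose x := sup E.
  have px : p <= x by exact: (ub_le_sup supE.2).
  have xq : x <= q by apply: ge_sup => //; exists p.
  have Ex : K * (x - p) <= g x - g p.
    rewrite leNgt; apply/negP => h.
    have [K0'|Kp] := eqVneq K 0.
      move: h; rewrite K0' mul0r subr_lt0; move: px; rewrite le_eqVlt => /predU1P[->|px].
        by rewrite ltxx.
      by have := inc p x (lexx _) px xq; lra.
    have {Kp} Kp : 0 < K by rewrite lt_neqAle eq_sym Kp.
    have e0 : 0 < (K * (x - p) - (g x - g p)) / K by rewrite divr_gt0//; lra.
    have [s [/andP[ps sq] sE] xs] := sup_adherent e0 supE.
    have sx : s <= x by apply: (ub_le_sup supE.2); split => //; rewrite ps.
    have gsx : g s <= g x.
      by move: sx; rewrite le_eqVlt => /predU1P[->//|sx]; exact/ltW/inc.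
    have : K * (x - s) < K * (x - p) - (g x - g p).
      by rewrite -ltr_pdivlMl// mulrC; move: xs; rewrite -/x; lra.
    have : K * (x - s) = K * (x - p) - K * (s - p) by ring.
    lra.
  move: xq; rewrite le_eqVlt => /predU1P[<-//|xq].
  have [|e e0 he] := g_steep x _ K.
    by rewrite /p /q in px xq; apply/andP; split; lra.
  pose s := x + Num.min (e / 2) (q - x).
  have m0 : 0 < Num.min (e / 2) (q - x) by rewrite lt_min subr_gt0 xq divr_gt0.
  have [me mq] : Num.min (e / 2) (q - x) <= e / 2 /\ Num.min (e / 2) (q - x) <= q - x.
    by rewrite !ge_min !lexx orbT.
  have Es : E s.
    split; first by apply/andP; split; rewrite /s; lra.
    have := he s; rewrite /s => hs; have {}hs := hs _.
    have : K * (s - x) < g s - g x by apply: hs; apply/andP; split; lra.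
    have : K * (s - p) = K * (s - x) + K * (x - p) by ring.
    lra.
  have := ub_le_sup supE.2 Es; rewrite -/x /s; lra.
have D0 : 0 < g q - g p by rewrite subr_gt0; exact: inc.
have := grow ((g q - g p + 1) / (q - p)) _.
rewrite divfK; last by rewrite subr_eq0 gt_eqF.
have h : 0 <= (g q - g p + 1) / (q - p) by rewrite divr_ge0//; lra.
by move=> /(_ h); lra.
Qed.

End DefinableLine.

Section DefinableLipschitz.
Context {R : realType} (S : forall m : nat, set (set 'rV[R]_m)).
Hypothesis Somin : o_minimal S.
Implicit Types (P : R -> Prop) (g h : R -> R) (a b c d s t K : R).
Notation dP := (dP S).
Notation dT := (dT S).
Notation dP1 := (dP1 S).
Notation dT1 := (dT1 S).

Lemma definable_steep h : dT1 h -> dP1 (steep h).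
Proof.
move=> hh; change (dP (fun e => steep h (e 0%N))); rewrite /steep.
apply: (dP_all Somin) => /=.
apply: (@dP_iff _ _ (fun e => exists d, 0 < d /\
  forall s, e 1%N < s -> s < e 1%N + d -> e 0%N * (s - e 1%N) < h s - h (e 1%N))).
  move=> e; split=> [[d [d0 H]]|[d d0 H]]; exists d => //.
    by move=> s /andP[]; exact: H.
  by split=> // s s1 s2; apply: H; rewrite s1.
apply: (dP_ex Somin) => /=; apply: (dP_and Somin).
  by apply: (dP_gt0 Somin); exact: dT_var.
apply: (dP_all Somin) => /=; apply: (dP_imp Somin).
  by apply: (dP_lt Somin); exact: dT_var.
apply: (dP_imp Somin).
  by apply: (dP_lt Somin); [exact: dT_var|apply: (dT_add Somin); exact: dT_var].
apply: (dP_lt Somin).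
  by apply: (dT_mul Somin); [exact: dT_var|apply: (dT_sub Somin); exact: dT_var].
by apply: (dT_sub Somin); apply: (dT1_comp Somin hh); exact: dT_var.
Qed.

(** A definable comparison with a line holds on a whole right neighbourhood or
    fails on one, so a failure of steepness gives a one-sided linear bound. *)
Lemma not_steep h t : dT1 h -> ~ steep h t ->
  exists K d, [/\ 0 <= K, 0 < d &
    forall s, t <= s < t + d -> h s - h t <= K * (s - t)].
Proof.
move=> hh /existsNP[K nK].
have [d d0 [H|H]] : germ_right (fun s => K * (s - t) < h s - h t) t.
- apply: (definable_germ_right Somin); apply: (dP_lt Somin).
    apply: (dT_mul Somin); first exact: dT_cst.
    by apply: (dT_sub Somin); [exact: dT_var|exact: dT_cst].
  by apply: (dT_sub Somin) => //; exact: dT_cst.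
- by exfalso; apply: nK; exists d.
exists `|K|, d; split=> // s /andP[]; rewrite le_eqVlt => /predU1P[<- _|ts sd].
  by rewrite !subrr mulr0.
have := H s; rewrite ts sd => /(_ isT)/negP; rewrite -leNgt => /le_trans; apply.
by rewrite ler_wpM2r ?ler_norm// subr_ge0 ltW.
Qed.

(** At each point, one of the functions [g t], [- g t], [g (- t)] and [- g (- t)]
    is steep, or [g] satisfies a linear bound near the point with some integer
    constant [k]. These countably many definable conditions cover the interval;
    the first four cannot hold on an interval by [no_vertical_increase], and the
    bound with a fixed [k] makes [g] Lipschitz on a short subinterval. *)
Lemma definable_lipschitz_subinterval g a b : dT1 g -> a < b ->
  exists c d L, [/\ a < c, c < d, d < b &
    forall s t, c < s < d -> c < t < d -> `|g s - g t| <= L * `|s - t|].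
Proof.
move=> hg ab.
pose gN t := - g t; pose gr t := g (- t); pose grN t := - g (- t).
have hN : dT1 gN by exact: dT_opp.
have hr : dT1 gr.
  by apply: (dT1_comp Somin hg); apply: (dT_opp Somin); exact: dT_var.
have hrN : dT1 grN by exact: dT_opp.
have hopp P : dP1 P -> dP1 (fun t => P (- t)).
  by move=> hP; apply: (dP1_comp Somin hP); apply: (dT_opp Somin); exact: dT_var.
pose E k t := forall s, k%:R * `|s - t| < 1 -> `|g s - g t| <= k%:R * `|s - t|.
pose A k := match k with
  | 0 => steep g | 1 => steep gN
  | 2 => fun t => steep gr (- t) | 3 => fun t => steep grN (- t)
  | k'.+4 => E k' end%N.
have dA k : splits_intervals (A k).
  apply: (definable_splits Somin); case: k => [|[|[|[|k]]]] /=.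
  - exact: definable_steep.
  - exact: definable_steep.
  - by apply: hopp; exact: definable_steep.
  - by apply: hopp; exact: definable_steep.
  have dk : dT (fun e => k%:R * `|e 0%N - e 1%N|).
    apply: (dT_mul Somin); first exact: dT_cst.
    by apply: (dT_norm Somin); apply: (dT_sub Somin); exact: dT_var.
  apply: (dP_all Somin) => /=; apply: (dP_imp Somin).
    by apply: (dP_lt Somin); [|exact: dT_cst].
  apply: (dP_le Somin) => //; apply: (dT_norm Somin).
  by apply: (dT_sub Somin); apply: (dT1_comp Somin hg); exact: dT_var.
have [t _|k [c [d [ac cd db H]]]] := @interval_cover _ A a b dA ab.
  have [?|n0] := pselect (steep g t); first by exists 0%N.
  have [?|n1] := pselect (steep gN t); first by exists 1%N.
  have [?|n2] := pselect (steep gr (- t)); first by exists 2%N.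
  have [?|n3] := pselect (steep grN (- t)); first by exists 3%N.
  have [K0 [d0 [K00 d00 H0]]] := not_steep hg n0.
  have [K1 [d1 [K10 d10 H1]]] := not_steep hN n1.
  have [K2 [d2 [K20 d20 H2]]] := not_steep hr n2.
  have [K3 [d3 [K30 d30 H3]]] := not_steep hrN n3.
  pose k := Num.bound (K0 + K1 + K2 + K3 + d0^-1 + d1^-1 + d2^-1 + d3^-1).
  have kk : K0 + K1 + K2 + K3 + d0^-1 + d1^-1 + d2^-1 + d3^-1 < k%:R.
    by apply: archi_boundP; rewrite !addr_ge0// invr_ge0 ltW.
  have i0 : 0 < d0^-1 by rewrite invr_gt0.
  have i1 : 0 < d1^-1 by rewrite invr_gt0.
  have i2 : 0 < d2^-1 by rewrite invr_gt0.
  have i3 : 0 < d3^-1 by rewrite invr_gt0.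
  have close (dd u : R) : 0 < dd -> dd^-1 < k%:R -> 0 <= u -> k%:R * u < 1 -> u < dd.
    move=> dd0 ddk u0 ku; rewrite ltNge; apply/negP => du.
    have : 1 < k%:R * dd by rewrite -ltr_pdivrMr// mul1r.
    have : k%:R * dd <= k%:R * u by rewrite ler_wpM2l.
    lra.
  exists k.+4 => /= s; have [ts|st] := leP t s.
    rewrite (ger0_norm (_ : 0 <= s - t)) ?subr_ge0// => ks.
    have s0 : 0 <= s - t by rewrite subr_ge0.
    have b0 : s - t < d0 by apply: close ks => //; lra.
    have b1 : s - t < d1 by apply: close ks => //; lra.
    have := H0 s; have := H1 s; rewrite ts /gN => /(_ _)h1 /(_ _)h0.
    have {}h1 := h1 ltac:(simpl; lra).
    have {}h0 := h0 ltac:(simpl; lra).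
    rewrite ler_norml; apply/andP; split; nra.
  rewrite (ltr0_norm (_ : s - t < 0)) ?subr_lt0// opprB => ks.
  have s0 : 0 <= t - s by rewrite subr_ge0 ltW.
  have b2 : t - s < d2 by apply: close ks => //; lra.
  have b3 : t - s < d3 by apply: close ks => //; lra.
  have := H2 (- s); have := H3 (- s); rewrite lerN2 (ltW st) /gr /grN !opprK.
  move=> /(_ _)h3 /(_ _)h2.
  have {}h3 := h3 ltac:(simpl; lra).
  have {}h2 := h2 ltac:(simpl; lra).
  rewrite ler_norml; apply/andP; split; nra.
case: k H => [|[|[|[|k]]]] /= H.
- by case: (no_vertical_increase Somin hg cd).
- by case: (no_vertical_increase Somin hN cd).
- have dc : - d < - c by rewrite ltrN2.
  case: (no_vertical_increase Somin hr dc) => t /andP[t1 t2].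
  by rewrite -[t]opprK; apply: H; apply/andP; split; lra.
- have dc : - d < - c by rewrite ltrN2.
  case: (no_vertical_increase Somin hrN dc) => t /andP[t1 t2].
  by rewrite -[t]opprK; apply: H; apply/andP; split; lra.
pose w := Num.min (d - c) (k.+1%:R^-1).
have w0 : 0 < w by rewrite lt_min subr_gt0 cd invr_gt0 ltr0n.
have [wd wk] : w <= d - c /\ w <= k.+1%:R^-1 by rewrite !ge_min !lexx orbT.
exists (c + w / 3), (c + 2 * w / 3), k%:R; split; [lra|lra|lra|].
move=> s t /andP[s1 s2] /andP[t1 t2]; apply: H; first by apply/andP; split; lra.
have kw : k.+1%:R * w <= 1 by rewrite -ler_pdivlMl ?mulr1.
apply: le_lt_trans (_ : k%:R * w < 1).
  by rewrite ler_wpM2l// ler_norml; apply/andP; split; lra.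
by move: kw; rewrite -natr1; lra.
Qed.

End DefinableLipschitz.

(** * Lipschitz selections of definable families *)

Section Lexmin.
Context {R : realType} (S : forall m : nat, set (set 'rV[R]_m)).
Hypothesis Somin : o_minimal S.
Notation dP := (dP S).
Notation dT := (dT S).
Context {n : nat}.

Lemma dT_rename (s : nat -> nat) (t : (nat -> R) -> R) :
  dT t -> dT (fun e => t (fun i => e (s i))).
Proof.
move=> ht; apply: (@dT_subst _ _ Somin _ (fun i e => e (s i)) ht) => i.
exact: dT_var.
Qed.

Lemma dV_rename m (s : nat -> nat) (v : (nat -> R) -> 'rV[R]_m) :
  dV S v -> dV S (fun e => v (fun i => e (s i))).
Proof. by move=> hv i; exact: (dT_rename s (hv i)). Qed.

Lemma dT_supp (D : 'rV[R]_n -> set 'rV[R]_n) (v u : (nat -> R) -> 'rV[R]_n) :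
  usc_field D -> definable_map S D -> dV S v -> dV S u ->
  dT (fun e => supp (D (v e)) (u e)).
Proof.
move=> Dusc Ddef hv hu.
apply: (@dP_iff _ _ (fun e =>
   (exists g, D (v (fun i => e i.+1)) g /\ dot (u (fun i => e i.+1)) g = e 0%N) /\
   (forall g, D (v (fun i => e i.+1)) g -> dot (u (fun i => e i.+1)) g <= e 0%N))).
  move=> e; split=> [[[g [Dg <-]] gmax]|->]; last first.
    by split=> [|g]; [have [g] := supp_ex Dusc (v (fun i => e i.+1)) (u (fun i => e i.+1)); exists g|exact: supp_ge].
  by apply/eqP; rewrite eq_le supp_ge//= supp_le.
have h0 : dV S (fun e : nat -> R => vec n (fun i => e i)) 
  by move=> i; apply: dT_eq (dT_var Somin i) => e; rewrite mxE.
apply: (dP_and Somin).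
  apply: (dP_ex_vec Somin); apply: (dP_and Somin).
    by apply: (dP_map Somin Ddef) => //; exact: (dV_rename (fun i => (n + i.+1)%N) hv).
  apply: (dP_eq Somin); last exact: dT_var.
  by apply: (dT_dot Somin) => //; exact: (dV_rename (fun i => (n + i.+1)%N) hu).
apply: (dP_all_vec Somin); apply: (dP_imp Somin).
  by apply: (dP_map Somin Ddef) => //; exact: (dV_rename (fun i => (n + i.+1)%N) hv).
apply: (dP_le Somin); last exact: dT_var.
by apply: (dT_dot Somin) => //; exact: (dV_rename (fun i => (n + i.+1)%N) hu).
Qed.

Variable A : R -> set 'rV[R]_n.
Hypothesis A_compact : forall t, compact (A t).
Hypothesis A_definable : dP (fun e => A (e 0%N) (vec n (fun i => e i.+1))).

(** Lexicographic minimization is a definable way to choose a point in a compact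
    fibre; [c] is the number of coordinates already minimized. *)
Fixpoint lexmin (c : nat) (t : R) : set 'rV[R]_n :=
  if c is c'.+1 then
    [set x | lexmin c' t x /\ forall y, lexmin c' t y -> env x c' <= env y c']
  else A t.

Lemma env_continuous c : continuous (fun x : 'rV[R]_n => env x c : R).
Proof.
rewrite /env; case: insubP => [j _ _|_]; first exact: coord_continuous.
exact: cst_continuous.
Qed.

Lemma lexmin_compact c t : A t !=set0 -> lexmin c t !=set0 /\ compact (lexmin c t).
Proof.
move=> At0; elim: c => [|c [L0 cL]]; first by split => //; exact: A_compact.
have [x /set_mem Lx xmin] := compact_EVT_min (f := fun x : 'rV[R]_n => env x c : R)
  L0 cL (continuous_subspaceT (env_continuous (c := c))).
have {}xmin y : lexmin c t y -> env x c <= env y c by move=> Ly; apply: xmin; exact: mem_set.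
split; first by exists x; split.
rewrite (_ : lexmin c.+1 t = lexmin c t `&` [set y | env y c <= env x c]); last first.
  apply/seteqP; split=> y /= [Ly ymin]; split=> //; first exact: ymin.
  by move=> z /xmin; exact: le_trans.
apply: compact_closedI => //.
rewrite (_ : [set y | _] = (fun y : 'rV[R]_n => env y c) @^-1` [set r | r <= env x c])//.
by apply: closed_comp => [y _|]; [exact: env_continuous|exact: closed_le].
Qed.

Lemma lexmin_sub c t : lexmin c t `<=` A t.
Proof. by elim: c => // c IH x [/IH]. Qed.

Lemma lexmin_unique t x y : lexmin n t x -> lexmin n t y -> x = y.
Proof.
move=> hx hy; suff h c : (c <= n)%N -> lexmin c t x /\ lexmin c t y /\
    forall i, (i < c)%N -> env x i = env y i.
  apply/rowP => i; have [_ [_ E]] := h n (leqnn n).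
  by rewrite -!env_ord; exact: E.
move=> cn; have : lexmin c t x /\ lexmin c t y.
  move: hx hy; rewrite -(subnK cn); elim: (n - c)%N => // k IH [h1 _] [h2 _]; exact: IH.
move=> [lx ly]; do 2!split => //; elim: c cn lx ly => // c IH cn [lx mx] [ly my] i.
rewrite ltnS leq_eqVlt => /predU1P[->|]; last by apply: IH => //; exact: ltnW.
by apply/eqP; rewrite eq_le mx//= my.
Qed.

Lemma lexmin_definable c : (c <= n)%N ->
  dP (fun e => lexmin c (e 0%N) (vec n (fun i => e i.+1))).
Proof.
elim: c => [//|c IH cn]; have hc := IH (ltnW cn).
have E (e : nat -> R) : env (vec n e) c = e c by rewrite (env_lt _ cn) mxE.
apply: (dP_and Somin) => //.
apply: (dP_all_vec Somin
  (Q := fun y e => lexmin c (e 0%N) y -> env (vec n (fun i => e i.+1)) c <= env y c)).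
apply: (dP_imp Somin).
  apply: dP_iff (dP_rename Somin (fun i => if i is j.+1 then j else (n + 0)%N) hc) => e.
  by [].
apply: (dP_le Somin).
  by apply: dT_eq (dT_var Somin (n + c.+1)%N) => e; rewrite E.
by apply: dT_eq (dT_var Somin c) => e; rewrite E.
Qed.

Definition lexcoord c t : R := env (xget 0 (lexmin n t)) c.

Lemma lexcoord_definable c : (c < n)%N -> dT1 S (lexcoord c).
Proof.
move=> cn; have hn := lexmin_definable (leqnn n).
have E (e : nat -> R) : env (vec n e) c = e c by rewrite (env_lt _ cn) mxE.
apply: (@dP_iff _ _ (fun e =>
  (exists x, lexmin n (e 1%N) x /\ e 0%N = env x c) \/
  (~ (exists x, lexmin n (e 1%N) x) /\ e 0%N = env (0 : 'rV[R]_n) c))).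
  move=> e; rewrite /lexcoord; case: xgetP => [x _ Lx|nL].
    split=> [[[y [Ly ->]]|[[]]]|->]; [by rewrite (lexmin_unique Ly Lx)|by exists x|].
    by left; exists x.
  split=> [[[y [/nL//]]|[]//]|->]; by right; split => // -[x /nL].
have hn1 : dP (fun e => exists x, lexmin n (e 1%N) x).
  apply: (dP_ex_vec Somin (Q := fun x e => lexmin n (e 1%N) x)).
  exact: dP_iff (dP_rename Somin (fun i => if i is j.+1 then j else (n + 1)%N) hn).
apply: (dP_or Somin); last first.
  apply: (dP_and Somin); first exact: dP_not.
  by apply: (dP_eq Somin); [exact: dT_var|exact: dT_cst].
apply: (dP_ex_vec Somin (Q := fun x e => lexmin n (e 1%N) x /\ e 0%N = env x c)).
apply: (dP_and Somin).
  exact: dP_iff (dP_rename Somin (fun i => if i is j.+1 then j else (n + 1)%N) hn).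
apply: (dP_eq Somin); first exact: dT_var.
by apply: dT_eq (dT_var Somin c) => e; rewrite E.
Qed.

(** The coordinates of the lexicographic minimum are definable functions of one
    variable; each of them is Lipschitz after shrinking the interval. *)
Lemma lipschitz_selection (a b : R) : a < b -> (forall t, a < t < b -> A t !=set0) ->
  exists (c d L : R) (g : R -> 'rV[R]_n), [/\ a < c, c < d, d < b, 0 <= L &
    (forall t, c < t < d -> A t (g t)) /\
    forall s t, c < s < d -> c < t < d -> `|g s - g t| <= L * `|s - t|].
Proof.
move=> ab A0.
have ex m : (m <= n)%N -> exists c d L, [/\ a < c, c < d, d < b &
    0 <= L /\ forall k, (k < m)%N -> forall s t, c < s < d -> c < t < d ->
      `|lexcoord k s - lexcoord k t| <= L * `|s - t|].
  elim: m => [_|m IH mn].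
    exists (a + (b - a) / 3), (a + 2 * (b - a) / 3), 0; split => //; lra.
  have [c [d [L [ac cd db [L0 H]]]]] := IH (ltnW mn).
  have [c' [d' [L' [cc cd' dd H']]]] :=
    definable_lipschitz_subinterval Somin (lexcoord_definable mn) cd.
  exists c', d', (L + `|L'|); split; [lra|lra|lra|split; first by rewrite addr_ge0].
  have sub t : c' < t < d' -> c < t < d.
    by move=> /andP[t1 t2]; apply/andP; split; lra.
  move=> k; rewrite ltnS leq_eqVlt => /predU1P[->|km] s t st tt.
    rewrite (le_trans (H' _ _ st tt))// ler_wpM2r// (le_trans (ler_norm L'))//.
    by rewrite lerDr.
  by rewrite (le_trans (H _ km _ _ (sub _ st) (sub _ tt)))// ler_wpM2r// lerDl.
have [c [d [L [ac cd db [L0 H]]]]] := ex n (leqnn n).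
exists c, d, L, (fun t => xget 0 (lexmin n t)); split=> //; split.
  move=> t /andP[ct td]; have [|[x Lx] _] := @lexmin_compact n t.
    by apply: A0; apply/andP; split; lra.
  by apply: (@lexmin_sub n); case: xgetP => [//|/(_ x)].
move=> s t st tt; apply: norm_leP; first by rewrite mulr_ge0.
by move=> i; rewrite !mxE; have := H i (ltn_ord i) s t st tt; rewrite /lexcoord !env_ord.
Qed.

End Lexmin.

(** * Critical values *)

Lemma near_norm_le {R : realType} (V : normedModType R) (x : V) (e : R) :
  0 < e -> \forall y \near x, `|x - y| <= e.
Proof.
move=> e0; apply/nbhs_ballP; exists e => //= y.
by rewrite -ball_normE => /ltW.
Qed.

Section LocallyLipschitz.
Context {R : realType} {n : nat} (f : 'rV[R]_n -> R).
Hypothesis f_lip : locally_lipschitz f.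

Lemma locally_lipschitz_near (x : 'rV[R]_n) : exists (U : set 'rV[R]_n) (K : R),
  [/\ nbhs x U, 0 < K & forall y z, U y -> U z -> `|f y - f z| <= K * `|y - z|].
Proof.
have [U xU fU] := f_lip x.
have fU' : \forall K \near +oo%R, forall p : 'rV[R]_n * 'rV[R]_n, (U `*` U) p ->
    `|f p.1 - f p.2| <= K * `|p.1 - p.2| by exact: fU.
near (+oo%R : set_system R) => K; exists U, K; split => //.
have h : forall p : 'rV[R]_n * 'rV[R]_n, (U `*` U) p ->
    `|f p.1 - f p.2| <= K * `|p.1 - p.2| by near: K.
by move=> y z Uy Uz; apply: (h (y, z)).
Unshelve. all: by end_near. Qed.

Lemma locally_lipschitz_continuous : continuous f.
Proof.
move=> x; have [U [K [xU K0 fU]]] := locally_lipschitz_near x.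
apply/(@cvgrPdist_le _ R^o _ (nbhs x) _ f (f x)) => e e0; have eK : 0 < K^-1 * e by rewrite mulr_gt0// invr_gt0.
have xe := near_norm_le x eK.
apply: (@filterS2 _ (nbhs x) _ _ _ _ _ xU xe) => y Uy xy.
by rewrite (le_trans (fU _ _ (nbhs_singleton xU) Uy))// -ler_pdivlMl.
Qed.

(** Pairs of nearby points are handled by the local constants, and pairs of distant
    points by boundedness; both cases are open conditions on the pair, so the
    compactness of [C * C] makes the constant uniform. *)
Lemma lipschitz_on_compact (C : set 'rV[R]_n) : compact C ->
  exists2 M : R, 0 < M & forall y z, C y -> C z -> `|f y - f z| <= M * `|y - z|.
Proof.
move=> cC; have fc := locally_lipschitz_continuous.
have cov (p : 'rV[R]_n * 'rV[R]_n) : (C `*` C) p ->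
    \forall q \near p & M \near +oo%R, `|f q.1 - f q.2| <= M * `|q.1 - q.2|.
  case: p => x y /= _; have [<-|xy] := eqVneq x y.
    have [U [K [xU K0 fU]]] := locally_lipschitz_near x.
    exists ([set q | U q.1 /\ U q.2], [set M : R | K <= M]) => /=.
      split; last exact: nbhs_pinfty_ge (num_real K).
      by exists (U, U) => //=.
    move=> [[u v] M] /= [[Uu Uv] KM]; apply: le_trans (fU _ _ Uu Uv) _.
    by rewrite ler_wpM2r.
  have d0 : 0 < `|x - y| by rewrite normr_gt0 subr_eq0.
  have d2 : 0 < `|x - y| / 4 by rewrite divr_gt0.
  pose d := `|x - y| / 4.
  pose B := `|f x - f y| + 2.
  exists ([set q | [/\ `|x - q.1| <= d, `|y - q.2| <= d,
      `|f x - f q.1| <= 1 & `|f y - f q.2| <= 1]], [set M : R | B / (2 * d) <= M]) => /=.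
    split; last exact: nbhs_pinfty_ge (num_real _).
    exists ([set u | `|x - u| <= d /\ `|f x - f u| <= 1],
            [set v | `|y - v| <= d /\ `|f y - f v| <= 1]) => /=.
      have n1 (w : 'rV[R]_n) : \forall u \near w, `|w - u| <= d.
        exact: near_norm_le.
      have n2 (w : 'rV[R]_n) : \forall u \near w, `|f w - f u| <= 1.
        exact: (@cvgrPdist_le _ R^o _ (nbhs w) _ f (f w)).1 (fc w) 1 ltr01.
      split; [exact: (@filterI _ (nbhs x) _ _ _ (n1 x) (n2 x))|exact: (@filterI _ (nbhs y) _ _ _ (n1 y) (n2 y))].
    by move=> [u v] /= [[? ?] [? ?]]; split.
  move=> [[u v] M] /= [[xu yv fxu fyv] BM].
  have uv : 2 * d <= `|u - v|.
    have := ler_normD (x - u) ((u - v) + (v - y)).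
    have := ler_normD (u - v) (v - y).
    have -> : x - u + (u - v + (v - y)) = x - y by rewrite addrA subrKA subrKA.
    rewrite (distrC v y).
    have : `|x - y| = 4 * d by rewrite /d; field.
    by lra.
  have dd : 0 < 2 * d by rewrite mulr_gt0.
  apply: (@le_trans _ _ B).
    have := ler_normD (f u - f x) ((f x - f y) + (f y - f v)).
    have := ler_normD (f x - f y) (f y - f v).
    have -> : f u - f x + (f x - f y + (f y - f v)) = f u - f v by ring.
    rewrite (distrC (f u) (f x)) /B; lra.
  have B0 : 0 <= B by rewrite addr_ge0.
  apply: (@le_trans _ _ (B / (2 * d) * (2 * d))); first by rewrite divfK// gt_eqF.
  by rewrite ler_pM// ?divr_ge0// ltW.
have KM := (compact_near_coveringP _).1 (compact_setX cC cC) _ _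
  (fun (M : R) (q : 'rV[R]_n * 'rV[R]_n) => `|f q.1 - f q.2| <= M * `|q.1 - q.2|) _ cov.
near (+oo%R : set_system R) => M; exists M => // y z Cy Cz.
have KM' : C `*` C `<=`
    (fun q : 'rV[R]_n * 'rV[R]_n => `|f q.1 - f q.2| <= M * `|q.1 - q.2|).
  by near: M; exact: KM.
exact: (KM' (y, z)).
Unshelve. all: by end_near. Qed.

End LocallyLipschitz.

Lemma ae_ex {R : realType} (P : R -> Prop) (a b : R) : a < b ->
  {ae (@lebesgue_measure R), forall t, P t} -> exists2 t, a < t < b & P t.
Proof.
move=> ab [N [mN N0 PN]]; apply: contrapT => nP.
have sub : (`]a, b[%classic : set R) `<=` N.
  move=> t /=; rewrite in_itv/= => tab; apply: PN => /= Pt; apply: nP.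
  by exists t.
have : (@lebesgue_measure R `]a, b[%classic <= 0)%E.
  by rewrite -N0; apply: le_measure; rewrite ?inE//; exact: measurable_itv.
by rewrite lebesgue_measure_itv/= lte_fin ab -EFinB lee_fin subr_le0 leNgt ab.
Qed.

(** The retraction onto [[0, 1]], used to extend curves to the line. *)
Lemma clip_lipschitz {R : realType} (s t : R) :
  `|Num.max 0 (Num.min 1 s) - Num.max 0 (Num.min 1 t)| <= `|s - t|.
Proof.
move: (ler_norm (s - t)) (ler_norm (t - s)); rewrite (distrC t s) => h1 h2.
rewrite ler_norml; have m01 := max_r (@ler01 R).
case: (leP 1 s) => s1; case: (leP 1 t) => t1; rewrite ?m01;
  try (case: (leP 0 s) => s0); try (case: (leP 0 t) => t0);
  by apply/andP; split; lra.
Qed.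

Section Sard.
Context {R : realType} (S : forall m : nat, set (set 'rV[R]_m)).
Hypothesis Somin : o_minimal S.
Context {n N : nat}.
Variables (f : 'I_N -> 'rV[R]_n -> R) (Df : 'I_N -> 'rV[R]_n -> set 'rV[R]_n).
Hypothesis Df_cons : forall i, conservative_field_for (f i) (Df i).

Let Dusc i : usc_field (Df i).
Proof. by case: (Df_cons i) => -[]. Qed.

(** The separation form of criticality: [0] lies in the convex hull of the averaged
    values if and only if no direction is strictly negative on them. It is stable
    under limits and definable, and the convex hull is needed only at the very end. *)
Definition crit_dual (x : 'rV[R]_n) := forall u, 0 <= \sum_i supp (Df i x) u.

Lemma sum_supp_usc (x u : 'rV[R]_n) (c : R) : \sum_i supp (Df i x) u < c ->
  \forall y \near x, \sum_i supp (Df i y) u < c.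
Proof.
move=> xc; pose e := (c - \sum_i supp (Df i x) u) / (N%:R + 1).
have N1 : 0 < N%:R + 1 :> R by rewrite ltr_wpDl.
have e0 : 0 < e by rewrite divr_gt0// subr_gt0.
have h : \forall y \near x, forall i, supp (Df i y) u < supp (Df i x) u + e.
  apply: (@filter_forall _ _ _ (nbhs x)) => i.
  have xe : supp (Df i x) u < supp (Df i x) u + e by rewrite ltrDl.
  have [[U W] /= [xU uW] UW] := supp_usc (Dusc i) xe.
  apply: (@filterS _ (nbhs x) _ _ _ _ xU) => y Uy; apply: (UW (y, u)); split => //=.
  exact: nbhs_singleton.
apply: (@filterS _ (nbhs x) _ _ _ _ h) => y hy.
apply: (@le_lt_trans _ _ (\sum_i (supp (Df i x) u + e))).
  by apply: ler_sum => i _; exact/ltW.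
rewrite big_split/= sumr_const card_ord.
have -> : e *+ N = (c - \sum_i supp (Df i x) u) * (N%:R / (N%:R + 1)).
  by rewrite -mulr_natr /e; field; exact: lt0r_neq0.
have : N%:R / (N%:R + 1) < 1 :> R by rewrite ltr_pdivrMr// mul1r ltrDl.
move: xc; set s := \sum_i _; set q := _ / _ => xc q1.
have : (c - s) * q < c - s by rewrite gtr_pMr// subr_gt0.
lra.
Qed.

Lemma crit_dual_closed : closed crit_dual.
Proof.
rewrite -openC openE => x /existsNP[u /negP]; rewrite -ltNge => xu.
apply: (@filterS _ (nbhs x) _ _ _ _ (sum_supp_usc xu)) => y yu /(_ u).
by rewrite leNgt yu.
Qed.

Hypothesis N_gt0 : (0 < N)%N.
Hypothesis f_coercive : coercive (avg_fun f).
Hypothesis f_definable : forall i, definable_fun S (f i).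
Hypothesis f_lipschitz : forall i, locally_lipschitz (f i).
Hypothesis Df_definable : forall i, definable_map S (Df i).

Lemma avg_fun_continuous : continuous (avg_fun f).
Proof.
move=> x; rewrite /avg_fun; apply: (@cvgMl_tmp R^o _ (nbhs x)).
apply: (@cvg_sumr R _ _ (nbhs x) _ _ f) => i.
exact: (locally_lipschitz_continuous (f_lipschitz i)).
Qed.

Lemma sublevel_bounded (c : R) : exists r : R, forall x, avg_fun f x <= c -> `|x| <= r.
Proof.
have [r rf] := f_coercive (c + 1); exists r => x xc; rewrite leNgt; apply/negP => rx.
have := rf x (ltW (lt_le_trans rx (norm_le_enorm x))); move: xc; lra.
Qed.

Definition crit_fiber (t : R) : set 'rV[R]_n := [set x | avg_fun f x = t /\ crit_dual x].

Lemma crit_fiber_compact t : compact (crit_fiber t).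
Proof.
have [r rf] := sublevel_bounded t.
apply: bounded_closed_compact.
  exists r; split; first exact: num_real.
  by move=> M rM x [/eqP]; rewrite eq_le => /andP[/rf xr _] _; exact: le_trans (ltW rM).
rewrite (_ : crit_fiber t = (avg_fun f @^-1` [set t]) `&` crit_dual)//.
apply: closedI; last exact: crit_dual_closed.
by apply: closed_comp => [x _|]; [exact: avg_fun_continuous|exact: closed_eq].
Qed.

Lemma crit_fiber_definable : dP S (fun e => crit_fiber (e 0%N) (vec n (fun i => e i.+1))).
Proof.
have hv : dV S (fun e : nat -> R => vec n (fun i => e i.+1)).
  by move=> i; apply: dT_eq (dT_var Somin i.+1) => e; rewrite mxE.
apply: (dP_and Somin).
  apply: (dP_eq Somin); last exact: dT_var.
  apply: (dT_mul Somin); first exact: dT_cst.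
  by apply: (dT_sum Somin) => i; exact: (dT_fun Somin).
apply: (dP_all_vec Somin (Q := fun u e =>
   0 <= \sum_i supp (Df i (vec n (fun i => e i.+1))) u)).
apply: (dP_le Somin); first exact: dT_cst.
apply: (dT_sum Somin) => i; apply: (dT_supp Somin (Dusc i)) => //.
  by move=> j; apply: dT_eq (dT_var Somin (n + j.+1)) => e; rewrite mxE.
by move=> j; apply: dT_eq (dT_var Somin j) => e; rewrite mxE.
Qed.

(** If the critical values filled an interval, the compact definable critical fibres
    would have a Lipschitz selection over a subinterval: a curve [G] of critical
    points along which [f] grows linearly with slope [w > 0]. By the chain rule [w]
    is the product of [G'] with every average of field elements, which contradicts
    criticality in the direction [- G']. *)
Lemma sard (a b : R) : a < b -> exists c d, [/\ a < c, c < d, d < b &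
  forall x, crit_dual x -> ~ (c < avg_fun f x < d)].
Proof.
move=> ab.
have dP1C : dP1 S (fun t => exists x, crit_fiber t x).
  apply: (dP_ex_vec Somin (Q := fun x e => crit_fiber (e 0%N) x)).
  exact: dP_iff (dP_rename Somin (fun i => if i is j.+1 then j else (n + 0)%N) crit_fiber_definable).
have [c [d [ac cd db [H|H]]]] := definable_splits Somin dP1C ab; last first.
  by exists c, d; split=> // x xc xcd; apply: (H _ xcd); exists x.
exfalso.
have [p [q [L [g [cp pq qd L0 [gA gL]]]]]] :=
  lipschitz_selection Somin crit_fiber_compact crit_fiber_definable cd H.
pose p' := p + (q - p) / 3; pose w := (q - p) / 3.
have w0 : 0 < w by rewrite /w; lra.
pose clip (t : R) := Num.max 0 (Num.min 1 t).
have clip01 t : 0 <= clip t <= 1.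
  by rewrite /clip le_max lexx/= ge_max ler01/= ge_min lexx.
have clipL (s t : R) : `|clip s - clip t| <= `|s - t| by exact: clip_lipschitz.
pose G (t : R) := g (p' + clip t * w).
have in_pq t : p < p' + clip t * w < q.
  have /andP[c0 c1] := clip01 t; have h0 : 0 <= clip t * w by rewrite mulr_ge0// ltW.
  have h1 : clip t * w <= w by rewrite -[leRHS]mul1r ler_wpM2r// ltW.
  by rewrite /p' /w in h0 h1 *; apply/andP; split; lra.
have GL : lip_on_line (L * w) G.
  move=> s t; apply: (le_trans (gL _ _ (in_pq s) (in_pq t))).
  rewrite -mulrA ler_wpM2l// opprD addrACA subrr add0r -mulrBl normrM.
  by rewrite mulrC (gtr0_norm w0) ler_wpM2l// ltW.
have cr : {ae (@lebesgue_measure R), forall t, forall i, 0 < t < 1 -> derivable G t 1 /\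
    exists d : R, is_derive t (1 : R) (fun t => f i (G t) : R) d /\
      forall v, Df i (G t) v -> dot (derive1 G t) v = d}.
  by apply: filter_forall => i; exact: (chain_rule (Df_cons i) GL).
have [t t01 ti] := ae_ex ltr01 cr.
have {ti} [dd ddE] := choice (fun i => (ti i t01).2).
have fG (s : R) : 0 <= s <= 1 -> avg_fun f (G s) = p' + s * w.
  move=> /andP[s0 s1]; have [-> _] := gA _ (in_pq s).
  by rewrite /clip (min_r s1) (max_r s0).
have e1 : is_derive t (1 : R) (fun t => avg_fun f (G t) : R) (N%:R^-1 * \sum_i dd i).
  have -> : (fun t => avg_fun f (G t) : R) = N%:R^-1 \*: \sum_i (fun t => f i (G t) : R).
    by apply/funext => s; rewrite /avg_fun fct_sumE.
  by apply: is_deriveZ; apply: is_derive_sum => i; exact: (ddE i).1.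
have e2 : is_derive t (1 : R) (fun t => avg_fun f (G t) : R) w.
  have : is_derive t (1 : R) (fun s : R => p' + s * w) (0 + (t *: 0 + w *: 1)).
    by apply: is_deriveD; apply: is_deriveM.
  have -> : 0 + (t *: 0 + w *: (1 : R)) = w by rewrite scaler0 !add0r [_ *: _]mulr1.
  apply: near_eq_is_derive.
  have t01' : t \in `]0, 1[ by rewrite in_itv.
  near=> s; rewrite fG//.
  have : s \in `]0, 1[ by near: s; exact: near_in_itvoo.
  by rewrite in_itv/= => /andP[/ltW -> /ltW ->].
have wE : w = N%:R^-1 * \sum_i dd i by case: e1 => _ <-; case: e2 => _ <-.
have [_ /(_ (- derive1 G t))] := gA _ (in_pq t).
rewrite -/(G t) (eq_bigr (fun i => - dd i)); last first.
  move=> i _; have [v Dv <-] := supp_ex (Dusc i) (G t) (- derive1 G t).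
  by rewrite dotNl (ddE i).2.
rewrite sumrN oppr_ge0 => sum0.
have : N%:R^-1 * \sum_i dd i <= 0 by rewrite mulr_ge0_le0.
by rewrite -wE leNgt w0.
Unshelve. all: by end_near. Qed.

End Sard.

(** * Convex hulls *)

Section ConvexHull.
Context {R : realType} {n : nat}.
Implicit Types (A C : set 'rV[R]_n) (x y a : 'rV[R]_n).

Lemma convex_set_comb C x y (t : R) : convex_set C -> C x -> C y -> 0 <= t -> t <= 1 ->
  C ((1 - t) *: x + t *: y).
Proof.
move=> cC /mem_set Cx /mem_set Cy t0 t1.
have := cC y x (Itv01 t0 t1) Cy Cx; rewrite inE.
by rewrite addrC.
Qed.

(** Convex combinations of [k + 1] points of [A], built one point at a time so
    that compactness passes from [A] to [comb A k]. *)
Fixpoint comb A k : set 'rV[R]_n :=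
  if k is k'.+1 then
    [set (1 - p.1) *: p.2.1 + p.1 *: p.2.2 | p in `[0%R, 1%R]%classic `*` (comb A k' `*` A)]
  else A.

Lemma comb_sub A C k : convex_set C -> A `<=` C -> comb A k `<=` C.
Proof.
move=> cC AC; elim: k => //= k IH _ [[t [x a]] /= [t01 [kx Aa]] <-].
move: t01; rewrite in_itv/= => /andP[t0 t1].
by apply: convex_set_comb => //; [exact: IH|exact: AC].
Qed.

Lemma comb_compact A k : compact A -> compact (comb A k).
Proof.
move=> cA; elim: k => //= k IH; apply: continuous_compact; last first.
  by apply: compact_setX; [exact: segment_compact|exact: compact_setX].
apply: continuous_subspaceT => -[t [x a]].
pose T : Type := (R * ('rV[R]_n * 'rV[R]_n))%type.
have c1 : (fun p : T => p.1) @ (t, (x, a)) --> t by exact: cvg_fst.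
have c2 : (fun p : T => p.2.1) @ (t, (x, a)) --> x.
  move=> U xU; exists (setT, [set q : 'rV[R]_n * 'rV[R]_n | U q.1]) => /=.
    split; first exact: filterT.
    by exists (U, setT) => /= [|q []//]; split=> //; exact: filterT.
  by move=> q [].
have c3 : (fun p : T => p.2.2) @ (t, (x, a)) --> a.
  move=> U xU; exists (setT, [set q : 'rV[R]_n * 'rV[R]_n | U q.2]) => /=.
    split; first exact: filterT.
    by exists (setT, U) => /= [|q []//]; split=> //; exact: filterT.
  by move=> q [].
have c4 : (fun p : T => 1 - p.1) @ (t, (x, a)) --> 1 - t.
  by apply: (@cvgB _ R^o _ (nbhs (t, (x, a))) _ (cst 1) fst) c1; exact: cvg_cst.
exact: (cvgD (cvgZ c4 c2) (cvgZ c1 c3)).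
Qed.

Definition explicit_comb A k x := exists (l : 'I_k.+1 -> R) (v : 'I_k.+1 -> 'rV[R]_n),
  [/\ forall i, 0 <= l i, \sum_i l i = 1, forall i, A (v i) & x = \sum_i l i *: v i].

Lemma comb_explicit A k x : comb A k x -> explicit_comb A k x.
Proof.
elim: k x => [|k IH] x /=.
  move=> Ax; exists (fun=> 1), (fun=> x); rewrite !big_ord1 scale1r; split => //.
move=> [[t [y a]] /= [+ [/IH[l [v [l0 l1 Av ->]]] Aa]] <-].
rewrite in_itv/= => /andP[t0 t1].
exists (fun i => if unlift ord_max i is Some j then (1 - t) * l j else t),
       (fun i => if unlift ord_max i is Some j then v j else a).
have wE (j : 'I_k.+1) : widen_ord (leqnSn k.+1) j = lift ord_max j.
  by apply: val_inj; rewrite /= /bump leqNgt ltn_ord.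
split.
- by move=> i; case: (unlift _ _) => [j|//]; rewrite mulr_ge0// subr_ge0.
- rewrite big_ord_recr/= unlift_none; under eq_bigr do rewrite wE liftK.
  by rewrite -mulr_sumr l1; lra.
- by move=> i; case: (unlift _ _).
- rewrite [RHS]big_ord_recr/= unlift_none; under [in RHS]eq_bigr do rewrite wE liftK -scalerA.
  by rewrite -scaler_sumr.
Qed.

Lemma explicit_comb_in A k x : explicit_comb A k x -> comb A k x.
Proof.
elim: k x => [|k IH] x /= [l [v [l0 l1 Av ->]]].
  by move: l1; rewrite !big_ord1 => ->; rewrite scale1r.
have wE (j : 'I_k.+1) : widen_ord (leqnSn k.+1) j = lift ord_max j.
  by apply: val_inj; rewrite /= /bump leqNgt ltn_ord.
pose t := l ord_max; pose s := \sum_(i < k.+1) l (lift ord_max i).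
have st : s + t = 1.
  by rewrite -l1 big_ord_recr/=; under [in RHS]eq_bigr do rewrite wE.
have s0 : 0 <= s by apply: sumr_ge0.
have t0 : 0 <= t := l0 _.
rewrite big_ord_recr/=; under eq_bigr do rewrite wE.
have [s00|sn0] := eqVneq s 0.
  have lz i : l (lift ord_max i) = 0.
    move/eqP: s00; rewrite psumr_eq0//.
    by move=> /allP /(_ i (mem_index_enum i)) /eqP.
  rewrite big1 ?add0r; last by move=> i _; rewrite lz scale0r.
  have t1 : t = 1 by rewrite -st s00 add0r.
  exists (1, (v ord0, v ord_max)) => /=.
    split; first by rewrite /= in_itv/= ler01 lexx.
    split => //=; apply: IH; exists (fun i => (i == ord0)%:R), (fun=> v ord0).
    split=> //.
      by rewrite (bigD1 ord0)//= big1 ?addr0// => i /negbTE ->.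
    by rewrite (bigD1 ord0)//= scale1r big1 ?addr0// => i /negbTE ->; rewrite scale0r.
  by rewrite subrr scale0r add0r -/t t1.
exists (t, (s^-1 *: \sum_(i < k.+1) l (lift ord_max i) *: v (lift ord_max i), v ord_max)) => /=.
  split; first by rewrite /= in_itv/= t0; lra.
  split => //=; apply: IH.
  exists (fun i => s^-1 * l (lift ord_max i)), (fun i => v (lift ord_max i)); split => //.
  - by move=> i; rewrite mulr_ge0// invr_ge0.
  - by rewrite -mulr_sumr mulVf.
  - by rewrite scaler_sumr; apply: eq_bigr => i _; rewrite scalerA.
have -> : 1 - t = s by lra.
by rewrite scalerA divff// scale1r.
Qed.

(** Caratheodory: [n + 2] points of an [n]-dimensional space are affinely
    dependent, and moving along a dependency makes one coefficient vanish. *)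
Lemma caratheodory A x : explicit_comb A n.+1 x -> explicit_comb A n x.
Proof.
move=> [l [v [l0 l1 Av ->]]].
pose B : 'M[R]_(n.+2, n + 1) := \matrix_i row_mx (v i) (const_mx 1).
have [mu [mu0 muB]] : exists mu : 'rV[R]_n.+2, mu != 0 /\ mu *m B = 0.
  have : kermx B != 0.
    rewrite kermx_eq0 /row_free neq_ltn (leq_ltn_trans (rank_leq_col B))//.
    by rewrite addn1.
  move=> /rowV0Pn[w wB w0]; exists w; split => //.
  by apply/eqP; rewrite -sub_kermx.
have muBi j : \sum_i mu 0 i * B i j = 0 by move/rowP/(_ j): muB; rewrite !mxE.
have mu1 : \sum_i mu 0 i = 0.
  apply: etrans (muBi (rshift n ord0)); apply: eq_bigr => i _.
  by rewrite mxE row_mxEr mxE mulr1.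
have muv : \sum_i mu 0 i *: v i = 0.
  apply/rowP => j; rewrite summxE mxE; apply: etrans (muBi (lshift 1 j)).
  by apply: eq_bigr => i _; rewrite mxE [in RHS]mxE row_mxEl.
have [i0 pos0] : exists i, 0 < mu 0 i.
  apply: contrapT => np; case/eqP: mu0; apply/rowP => i; rewrite mxE.
  have neg j : 0 <= - mu 0 j by rewrite oppr_ge0 leNgt; apply/negP => ?; apply: np; exists j.
  have : \sum_j - mu 0 j = 0 by rewrite sumrN mu1 oppr0.
  move=> /eqP; rewrite psumr_eq0// => /allP /(_ i (mem_index_enum i)).
  by rewrite /= oppr_eq0 => /eqP.
pose i1 := [arg min_(i < i0 | 0 < mu 0 i) (l i / mu 0 i)]%O.
have [pos1 min1] : 0 < mu 0 i1 /\ forall i, 0 < mu 0 i -> l i1 / mu 0 i1 <= l i / mu 0 i.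
  by rewrite /i1; case: arg_minP.
pose th := l i1 / mu 0 i1.
have th0 : 0 <= th by rewrite divr_ge0// ltW.
pose l' i := l i - th * mu 0 i.
have l'0 i : 0 <= l' i.
  rewrite /l' subr_ge0; have [mi|mi] := ltP 0 (mu 0 i).
    by rewrite -ler_pdivlMr//; exact: min1.
  by apply: le_trans (l0 i); rewrite mulr_ge0_le0.
have l'1 : l' i1 = 0 by rewrite /l' /th divfK ?subrr// gt_eqF.
have suml' : \sum_i l' i = 1 by rewrite /l' sumrB l1 -mulr_sumr mu1 mulr0 subr0.
have sumv' : \sum_i l i *: v i = \sum_i l' i *: v i.
  rewrite /l'; under [in RHS]eq_bigr do rewrite scalerBl -scalerA.
  by rewrite sumrB -scaler_sumr muv scaler0 subr0.
exists (fun i => l' (lift i1 i)), (fun i => v (lift i1 i)); split => //.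
  by rewrite -suml' (bigD1_ord i1)//= l'1 add0r.
by rewrite sumv' (bigD1_ord i1)//= l'1 scale0r add0r.
Qed.

(** The point of minimal norm of the compact set of convex combinations: if it were
    not [0], moving towards a point of [A] in a direction of descent would shorten it,
    and by [caratheodory] the new point is still a combination of [n + 1] points. *)
Lemma zero_in_comb A : A !=set0 -> compact A ->
  (forall u, exists2 a, A a & dot u a <= 0) -> comb A n 0.
Proof.
move=> A0 cA Adir; have cK := comb_compact (k := n) cA.
have K0 : comb A n !=set0.
  case: A0 => a Aa; exists a; elim: n => //= k IH; exists (0, (a, a)) => /=.
    by split => //=; rewrite in_itv/= lexx ler01.
  by rewrite subr0 scale1r scale0r addr0.
have [|z /set_mem Kz zmin] := compact_EVT_min (f := fun x => dot x x) K0 cK.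
  apply: continuous_subspaceT => x.
  by apply: (cvg_dot (F := nbhs x) (a := id) (b := id)); exact: cvg_id.
have {}zmin y : comb A n y -> dot z z <= dot y y by move=> Ky; apply: zmin; exact: mem_set.
have [z0|zn0] := eqVneq (dot z z) 0; first by rewrite -(dot_eq0 z0).
have zpos : 0 < dot z z by rewrite lt_neqAle eq_sym zn0 dot_ge0.
have [a Aa za] := Adir z.
have step t : 0 <= t -> t <= 1 -> comb A n ((1 - t) *: z + t *: a).
  move=> t0 t1; apply/explicit_comb_in/caratheodory/comb_explicit.
  by exists (t, (z, a)) => //=; split => //=; rewrite in_itv/= t0.
pose b := dot a a; have b0 : 0 <= b := dot_ge0 a.
pose t := dot z z / (2 * (dot z z + b)).
have tb : 0 < 2 * (dot z z + b) by lra.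
have t0 : 0 < t by rewrite divr_gt0.
have t1 : t <= 1 by rewrite ler_pdivrMr// mul1r; lra.
have := zmin _ (step t (ltW t0) t1).
rewrite dotDl !dotDr !dotZl !dotZr (dotC a z) -/b => h.
have tE : t * (dot z z + b) = dot z z / 2.
  by rewrite /t; field; rewrite gt_eqF//; lra.
have h1 : (1 - t) * t * dot z a <= 0.
  by rewrite mulr_ge0_le0// mulr_ge0 ?subr_ge0 ?(ltW t0).
have h2 : t * (t * (dot z z + b)) = t * (dot z z / 2) by rewrite tE.
have h3 : 0 < t * dot z z by rewrite mulr_gt0.
lra.
Qed.

Section AverageField.
Variables (N : nat) (Df : 'I_N -> 'rV[R]_n -> set 'rV[R]_n).
Hypothesis Dusc : forall i, usc_field (Df i).

Let sums (x : 'rV[R]_n) : set 'rV[R]_n :=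
  [set N%:R^-1 *: \sum_i g i | g in [set g | forall i, Df i x (g i)]].

Lemma sums_compact x : compact (sums x).
Proof.
pose P k : set 'rV[R]_n := [set \sum_(i < N | (i < k)%N) g i | g in
  [set g : 'I_N -> 'rV[R]_n | forall i, Df i x (g i)]].
have cP k : (k <= N)%N -> compact (P k).
  elim: k => [_|k IH kN].
    rewrite (_ : P 0%N = [set 0]); first exact: compact_set1.
    apply/seteqP; split=> y /=; first by move=> [g _ <-]; rewrite big_pred0.
    move=> ->; have [g gD] := choice (fun i => let: And4 D0 _ _ _ := Dusc i in D0 x).
    by exists g => //; rewrite big_pred0.
  pose j := Ordinal kN.
  rewrite (_ : P k.+1 = (fun p : 'rV[R]_n * 'rV[R]_n => p.1 + p.2) @` (P k `*` Df j x)).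
    apply: continuous_compact; last first.
      by apply: compact_setX; [exact/IH/ltnW|case: (Dusc j)].
    by apply: continuous_subspaceT => p; exact: (@add_continuous 'rV[R]_n).
  have E (g : 'I_N -> 'rV[R]_n) : \sum_(i < N | (i < k.+1)%N) g i =
      \sum_(i < N | (i < k)%N) g i + g j.
    rewrite (bigD1 j)//= addrC; congr (_ + _); apply: eq_bigl => i.
    by rewrite ltnS ltn_neqAle andbC.
  apply/seteqP; split=> y /=.
    by move=> [g gD <-]; exists (\sum_(i < N | (i < k)%N) g i, g j); rewrite ?E//=; split=> //; exists g.
  move=> [[a b] /= [[g gD <-] Db] <-].
  exists (fun i => if i == j then b else g i).
    by move=> i; case: eqP => [->|].
  rewrite E eqxx; congr (_ + _); apply: eq_bigr => i ik.
  by rewrite ifF//; apply/negbTE; apply: contraTneq ik => ->; rewrite ltnn.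
rewrite (_ : sums x = (fun y => N%:R^-1 *: y) @` P N).
  apply: continuous_compact; last exact: cP.
  by apply: continuous_subspaceT => p; exact: scaler_continuous.
apply/seteqP; split=> y /=.
  move=> [g gD <-]; exists (\sum_(i < N | (i < N)%N) g i); first by exists g.
  by congr (_ *: _); apply: eq_bigl => i; rewrite ltn_ord.
move=> [_ [g gD <-] <-]; exists g => //.
by congr (_ *: _); apply: eq_bigl => i; rewrite ltn_ord.
Qed.

Lemma crit_dual_avg_field x : (forall u, 0 <= \sum_i supp (Df i x) u) ->
  avg_field Df x 0.
Proof.
move=> xc C [cC AC].
apply: (comb_sub cC AC (k := n)); apply: zero_in_comb; last 1 first.
- move=> u; have ex i : exists v, Df i x v /\ dot (- u) v = supp (Df i x) (- u).
    by have [v] := supp_ex (Dusc i) x (- u); exists v.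
  have [g gE] := choice ex.
  exists (N%:R^-1 *: \sum_i g i); first by exists g => // i; have [] := gE i.
  rewrite dotZr dot_sumr mulr_ge0_le0// -oppr_ge0 -sumrN.
  rewrite (eq_bigr (fun i => supp (Df i x) (- u)))// => i _.
  by have [_ <-] := gE i; rewrite dotNl.
- have [g gD] := choice (fun i => let: And4 D0 _ _ _ := Dusc i in D0 x).
  by exists (N%:R^-1 *: \sum_i g i), g.
- exact: sums_compact.
Qed.

End AverageField.

End ConvexHull.

(** * Limits of step functions *)

Section UltraLimits.
Context {U : set_system nat} {UU : UltraFilter U}.

(** Ultralimits replace the extraction of subsequences: every sequence in a compact
    set converges along the ultrafilter, simultaneously for all times of a curve. *)
Lemma ultralimit (T : topologicalType) (A : set T) (s : nat -> T) :
  compact A -> (forall j, A (s j)) -> exists2 p, A p & s @ U --> p.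
Proof.
move=> cA sA; have PU : ProperFilter U by exact: ultra_proper.
have [|p [Ap clp]] := cA (s @ U) _.
  by apply: (@filterE _ U) => j; exact: sA.
exists p => // V pV; have [//|nV] := in_ultra_setVsetC (s @^-1` V) UU.
by have [x [nVx Vx]] := clp (~` V) V nV pV.
Qed.

End UltraLimits.

Section StepTimes.
Context {R : realType}.
Variables (h : nat -> R).
Hypothesis h_gt0 : forall k, 0 < h k.

(** Step lengths are read as durations, so that the iteration becomes a step
    function of time. *)
Definition step_time k := \sum_(i < k) h i.

Lemma step_timeS k : step_time k.+1 = step_time k + h k.
Proof. by rewrite /step_time big_ord_recr. Qed.

Lemma step_time0 : step_time 0 = 0.
Proof. exact: big_ord0. Qed.

Lemma step_time_lt k l : (k < l)%N -> step_time k < step_time l.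
Proof.
elim: l => // l IH; rewrite ltnS leq_eqVlt step_timeS => /predU1P[->|/IH kl].
  by rewrite ltrDl.
by apply: lt_trans kl _; rewrite ltrDl.
Qed.

Lemma step_time_le k l : (k <= l)%N -> step_time k <= step_time l.
Proof. by rewrite leq_eqVlt => /predU1P[->//|/step_time_lt/ltW]. Qed.

Lemma step_time_ge0 k : 0 <= step_time k.
Proof. by rewrite -step_time0 step_time_le. Qed.

Lemma step_index_ex K (t : R) : exists k, [/\ (k <= K)%N,
  0 <= t -> step_time k <= t, t < 0 -> k = 0%N & k = K \/ t < step_time k.+1].
Proof.
elim: K => [|K [k [kK kt k0 kE]]].
  by exists 0%N; rewrite step_time0; split => //; left.
have [tk|kt1] := ltP t (step_time k.+1).
  by exists k; split=> //; [exact: leqW|right].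
have {kE} kE : k = K by case: kE => // /lt_le_trans/(_ kt1); rewrite ltxx.
exists K.+1; subst k; split=> //; last by left.
by move=> t0; have := le_trans (step_time_ge0 K.+1) kt1; rewrite leNgt t0.
Qed.

Lemma telescope_le (F : nat -> R) (b : R) k l : (k <= l)%N ->
  (forall i, (k <= i < l)%N -> F i.+1 - F i <= b * h i) ->
  F l - F k <= b * (step_time l - step_time k).
Proof.
move=> kl; elim: l kl => [|l IH].
  by rewrite leqn0 => /eqP -> _; rewrite !subrr mulr0.
rewrite leq_eqVlt => /predU1P[-> _|]; first by rewrite !subrr mulr0.
rewrite ltnS => kl H; have := H l; rewrite kl ltnSn => /(_ isT) h1.
have h2 : F l - F k <= b * (step_time l - step_time k).
  by apply: IH => // i /andP[ki il]; apply: H; rewrite ki leqW.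
by rewrite step_timeS; lra.
Qed.

End StepTimes.

Section CurveLimit.
Context {R : realType} {U : set_system nat} {UU : UltraFilter U}.
Variables (h : nat -> nat -> R) (K : nat -> nat).
Hypothesis h_gt0 : forall j k, 0 < h j k.
Hypothesis h_small : forall j k, (k < K j)%N -> h j k <= harmonic j.
Hypothesis total_le1 : forall j, step_time (h j) (K j) <= 1.
Hypothesis U_oo : \oo `<=` U.

Let PU : ProperFilter U. Proof. exact: ultra_proper. Qed.
#[local] Existing Instance PU.

Notation T j := (step_time (h j)).

Implicit Types (s t e : R).

(** The index of the state at time [t]. Times outside [[0, step_time K]] get the
    first or the last state, which makes the limit curves Lipschitz on the whole
    line. *)
Definition step_index j (t : R) : nat := xget 0%N [set k | [/\ (k <= K j)%N,
  0 <= t -> T j k <= t, t < 0 -> k = 0%N & k = K j \/ t < T j k.+1]].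

Lemma step_indexP j t : [/\ (step_index j t <= K j)%N,
  0 <= t -> T j (step_index j t) <= t, t < 0 -> step_index j t = 0%N &
  step_index j t = K j \/ t < T j (step_index j t).+1].
Proof.
rewrite /step_index; case: xgetP => [k _ //|nk].
by have [k kP] := step_index_ex (h_gt0 j) (K j) t; have := nk k kP.
Qed.

Lemma step_index_le j s t : s <= t -> (step_index j s <= step_index j t)%N.
Proof.
move=> st; have [s1 s2 s3 s4] := step_indexP j s; have [t1 t2 t3 t4] := step_indexP j t.
rewrite leqNgt; apply/negP => lt_ts.
case: t4 => [tK|tT]; first by move: s1; rewrite -tK leqNgt lt_ts.
have [s0|s0] := leP 0 s; last by move: lt_ts; rewrite (s3 s0).
have := step_time_le (h_gt0 j) lt_ts; have := s2 s0; lra.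
Qed.

Lemma step_index0 j t : t <= 0 -> step_index j t = 0%N.
Proof.
rewrite le_eqVlt => /predU1P[->|]; last by have [] := step_indexP j t.
have [_ /(_ (lexx _)) h1 _ _] := step_indexP j 0.
apply/eqP; rewrite -leqn0 leqNgt; apply/negP => /(step_time_lt (h_gt0 j)).
rewrite step_time0; lra.
Qed.

(** The two step times are each within one step of [s] and [t]; the next two lemmas
    keep track of the direction of the errors. *)
Lemma elapsed_le j s t : s <= t ->
  T j (step_index j t) - T j (step_index j s) <= t - s + harmonic j.
Proof.
move=> st; have [s1 s2 s3 s4] := step_indexP j s; have [t1 t2 t3 t4] := step_indexP j t.
have j0 := @harmonic_gt0 R j.
have [t0|t0] := leP 0 t; last first.
  rewrite (step_index0 j (ltW t0)) (step_index0 j (ltW (le_lt_trans st t0))) subrr.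
  by lra.
have tT := t2 t0; case: (s4) => [sK|sT].
  suff -> : step_index j t = step_index j s by rewrite subrr; lra.
  by apply/eqP; rewrite eqn_leq (step_index_le j st) sK t1.
have := t1; have := step_index_le j st; rewrite leq_eqVlt => /predU1P[<-|lt_st] tK.
  by rewrite subrr; lra.
have := @h_small j _ (leq_trans lt_st tK).
move: sT; rewrite step_timeS; lra.
Qed.

Lemma elapsed_ge j s t : 0 <= s -> t < T j (K j) ->
  t - s - harmonic j <= T j (step_index j t) - T j (step_index j s).
Proof.
move=> s0 tK; have [s1 /(_ s0) s2 _ s4] := step_indexP j s; have [t1 _ _ t4] := step_indexP j t.
have tT : t < T j (step_index j t).+1.
  case: t4 => // tE; apply: lt_le_trans tK _; rewrite -tE; exact/ltW/step_time_lt.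
have := tT; rewrite step_timeS.
have [tK'|] := ltnP (step_index j t) (K j); first by have := @h_small j _ tK'; lra.
move=> Kt; have {t1} tE : step_index j t = K j by apply/eqP; rewrite eqn_leq t1.
by have : 0 < harmonic j :> R; [exact: harmonic_gt0|rewrite tE; lra].
Qed.

Lemma U_small (e : R) : 0 < e -> \forall j \near U, harmonic j < e.
Proof.
move=> e0; apply: U_oo; have := @cvg_harmonic R => /cvgr_lt /(_ _ e0).
exact.
Qed.

Variables (tau : R).
Hypothesis tau_lim : (fun j => T j (K j)) @ U --> tau.

Lemma tau_le1 : tau <= 1.
Proof. by apply: (cvgr_to_le tau_lim); exact: nearW. Qed.

Lemma tau_ge0 : 0 <= tau.
Proof. by apply: (cvgr_to_ge tau_lim); apply: nearW => j; exact: step_time_ge0. Qed.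

Lemma U_inside t : t < tau -> \forall j \near U, t < T j (K j).
Proof. by move=> tt; exact: (cvgr_gt tau tau_lim). Qed.

Context {V : normedModType R}.
Variables (C : R) (z : nat -> nat -> V).
Hypothesis C_ge0 : 0 <= C.
Hypothesis z_lip : forall j k, (k < K j)%N -> `|z j k.+1 - z j k| <= C * h j k.

Lemma steps_lip j k l : (k <= l)%N -> (l <= K j)%N ->
  `|z j l - z j k| <= C * (T j l - T j k).
Proof.
elim: l => [|l IH]; first by rewrite leqn0 => /eqP -> _; rewrite !subrr normr0 mulr0.
rewrite leq_eqVlt => /predU1P[-> _|]; first by rewrite !subrr normr0 mulr0.
rewrite ltnS => kl lK; have := IH kl (ltnW lK); have := z_lip lK.
have := ler_normD (z j l.+1 - z j l) (z j l - z j k).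
rewrite addrA subrK step_timeS; lra.
Qed.

Lemma index_lip j s t : s <= t ->
  `|z j (step_index j t) - z j (step_index j s)| <= C * (t - s + harmonic j).
Proof.
move=> st; have [t1 _ _ _] := step_indexP j t.
apply: (le_trans (steps_lip (step_index_le j st) t1)).
by rewrite ler_wpM2l// elapsed_le.
Qed.

Variables (x : R -> V).
Hypothesis x_lim : forall t, (fun j => z j (step_index j t)) @ U --> x t.

Lemma limit_lip : lip_on_line C x.
Proof.
suff H s t : s <= t -> `|x t - x s| <= C * (t - s).
  move=> s t; have [st|/ltW ts] := leP s t.
    by rewrite distrC [in leRHS]distrC (ger0_norm (_ : 0 <= t - s)) ?H ?subr_ge0.
  by rewrite (ger0_norm (_ : 0 <= s - t)) ?H ?subr_ge0.
move=> st; apply/ler_addgt0Pr => e e0.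
have lim : (fun j => `|z j (step_index j t) - z j (step_index j s)|) @ U --> `|x t - x s|.
  by apply: cvg_norm; apply: cvgB.
have d0 : 0 < e / (C + 1) by rewrite divr_gt0// ltr_wpDl.
apply: (cvgr_to_le lim); apply: filterS (U_small d0) => j jd.
apply: (le_trans (index_lip j st)); rewrite mulrDr lerD2l.
apply: (@le_trans _ _ (C * (e / (C + 1)))); first by rewrite ler_wpM2l// ltW.
by rewrite mulrA ler_pdivrMr ?ltr_wpDl// mulrC ler_wpM2l ?ltW// ltrDl.
Qed.

Lemma limit_start : (fun j => z j 0%N) @ U --> x 0.
Proof.
have := @x_lim 0; rewrite (_ : (fun j => _) = (fun j => z j 0%N))//.
by apply/funext => j; rewrite step_index0.
Qed.

Lemma limit_end : (fun j => z j (K j)) @ U --> x tau.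
Proof.
apply/cvgrPdist_le => e e0.
have C1 : 0 < C + 1 by rewrite ltr_wpDl.
have d0 : 0 < e / 4 / (C + 1) by rewrite !divr_gt0.
have e2 : 0 < e / 2 by rewrite divr_gt0.
have n1 := (cvgrPdist_le _ _).1 (@x_lim tau) _ e2.
have n2 := (@cvgrPdist_le _ R^o _ U _ _ _).1 tau_lim _ d0.
have FU : Filter U by exact: PU.
apply: filterS3 (n1 FU) (n2 FU) (U_small d0) => j j1 j2 j3.
have [t1 t2 _ t4] := step_indexP j tau; have {t2} t2 := t2 tau_ge0.
have h1 := steps_lip t1 (leqnn _).
have h2 : T j (K j) - T j (step_index j tau) <= 2 * (e / 4 / (C + 1)).
  case: t4 => [->|]; first by rewrite subrr; lra.
  have [tK|Kt] := ltnP (step_index j tau) (K j).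
    rewrite step_timeS; have := h_small tK; move: j2; rewrite ler_norml => /andP[]; lra.
  have -> : step_index j tau = K j by apply/eqP; rewrite eqn_leq t1.
  by rewrite subrr; lra.
have h3 : C * (2 * (e / 4 / (C + 1))) <= e / 2.
  have -> : C * (2 * (e / 4 / (C + 1))) = e / 2 * (C / (C + 1)).
    by field; exact: lt0r_neq0.
  by rewrite -[leRHS]mulr1 ler_wpM2l ?(ltW e2)// ler_pdivrMr// mul1r lerDl.
have h4 : C * (T j (K j) - T j (step_index j tau)) <= e / 2.
  by apply: le_trans h3; rewrite ler_wpM2l.
have := ler_normD (x tau - z j (step_index j tau)) (z j (step_index j tau) - z j (K j)).
rewrite addrA subrK (distrC (z j (step_index j tau))); lra.
Qed.

Lemma elapsed_cvg s t : 0 <= s -> s <= t -> t < tau ->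
  (fun j => T j (step_index j t) - T j (step_index j s)) @ U --> t - s.
Proof.
move=> s0 st tt; apply/(@cvgrPdist_le _ R^o _ U) => e e0.
apply: filterS2 (U_inside tt) (U_small e0) => j jt je.
have := elapsed_le j st; have := elapsed_ge s0 jt.
by move=> h1 h2; rewrite ler_norml; apply/andP; split; lra.
Qed.

Lemma derive_le (F : R -> R) (t d B w : R) : 0 < w -> is_derive t (1 : R) F d ->
  (forall s, t < s < t + w -> F s - F t <= B * (s - t)) -> d <= B.
Proof.
move=> w0 [Fd <-] FB.
have Fd' : (fun h : R => h^-1 *: (F (h *: (1 : R) + t) - F t)) @ 0^' --> 'D_1 F t := Fd.
have lim := cvg_comp _ _ (@harmonic_dnbhs R) Fd'.
apply: (cvgr_to_le lim).
have hw : \forall j \near \oo, @harmonic R j < w by exact: (cvgr_lt _ cvg_harmonic).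
apply: filterS hw => j jw.
have j0 := @harmonic_gt0 R j; rewrite /= -/(harmonic j).
have -> : harmonic j *: (1 : R) + t = t + harmonic j by rewrite addrC [_ *: _]mulr1.
rewrite [_ *: _]mulrC ler_pdivrMr// (le_trans (FB _ _))//; last by rewrite addrAC subrr add0r.
by apply/andP; split; lra.
Qed.

(** Turns the difference inequalities of the iteration into differential
    inequalities: over a short time after [t] the state stays near [x t], and the
    increments of [phi] add up to a difference quotient of the limit. *)
Lemma rate_le (phi : nat -> nat -> R) (Phi : R -> R) (b t d : R) :
  0 <= t < tau ->
  (forall s, (fun j => phi j (step_index j s)) @ U --> Phi s) ->
  (forall e : R, 0 < e -> exists2 r : R, 0 < r & \forall j \near U,
     forall k, (k < K j)%N -> `|z j k - x t| <= r ->
     phi j k.+1 - phi j k <= (b + e) * h j k) ->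
  is_derive t (1 : R) Phi d -> d <= b.
Proof.
move=> /andP[t0 tt] phi_lim rate Phid; apply/ler_addgt0Pr => e e0.
have [r r0 near_r] := rate e e0.
have C1 : 0 < C + 1 by rewrite ltr_wpDl.
have r8 : 0 < r / 4 / (C + 1) by rewrite !divr_gt0.
have r2 : 0 < r / 2 by rewrite divr_gt0.
pose w := Num.min (r / 4 / (C + 1)) (tau - t).
have w0 : 0 < w by rewrite lt_min r8 subr_gt0.
have [wr wt] : w <= r / 4 / (C + 1) /\ w <= tau - t by rewrite !ge_min !lexx orbT.
apply: (derive_le w0 Phid) => s /andP[ts sw].
have st : s < tau by lra.
have lim1 : (fun j => phi j (step_index j s) - phi j (step_index j t)) @ U --> Phi s - Phi t.
  by apply: cvgB; exact: phi_lim.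
have lim2 : (fun j => (b + e) * (T j (step_index j s) - T j (step_index j t))) @ U --> (b + e) * (s - t).
  by apply: (@cvgMl_tmp R^o _ U); exact: elapsed_cvg t0 (ltW ts) st.
apply: (ler_cvg_to lim1 lim2).
have n1 := (@cvgrPdist_le _ _ _ U _ _ _).1 (@x_lim t) _ r2.
have FU : Filter U by exact: PU.
apply: filterS3 near_r (n1 FU) (U_small r8) => j j1 j2 j3.
have [s1 _ _ _] := step_indexP j s.
apply: telescope_le; first exact/step_index_le/ltW.
move=> k /andP[tk ks]; apply: j1; first exact: leq_trans ks s1.
have h1 := steps_lip tk (ltnW (leq_trans ks s1)).
have h2 : T j k - T j (step_index j t) <= r / 4 / (C + 1) + r / 4 / (C + 1).
  have := elapsed_le j (ltW ts); have := step_time_le (h_gt0 j) (ltnW ks); lra.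
have h3 : C * (r / 4 / (C + 1) + r / 4 / (C + 1)) <= r / 2.
  have -> : C * (r / 4 / (C + 1) + r / 4 / (C + 1)) = r / 2 * (C / (C + 1)).
    by field; exact: lt0r_neq0.
  by rewrite -[leRHS]mulr1 ler_wpM2l ?(ltW r2)// ler_pdivrMr// mul1r lerDl.
have h4 : C * (T j k - T j (step_index j t)) <= r / 2.
  by apply: le_trans h3; rewrite ler_wpM2l.
have := ler_normD (z j k - z j (step_index j t)) (z j (step_index j t) - x t).
rewrite addrA subrK (distrC (z j (step_index j t)) (x t)); lra.
Qed.

End CurveLimit.

(** * The energy along the limiting inclusion *)

Section Lyapunov.
Context {R : realType} {n N : nat}.
Notation mu := (@lebesgue_measure R).
Variables (f : 'I_N -> 'rV[R]_n -> R) (Df : 'I_N -> 'rV[R]_n -> set 'rV[R]_n).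
Hypothesis Df_cons : forall i, conservative_field_for (f i) (Df i).
Hypothesis f_lipschitz : forall i, locally_lipschitz (f i).
Variables (eps0 tau1 rho : R).
Hypotheses (eps0_gt0 : 0 < eps0) (tau1_gt0 : 0 < tau1) (rho_ge0 : 0 <= rho).

Let Dusc i : usc_field (Df i).
Proof. by case: (Df_cons i) => -[]. Qed.

(** The Lyapunov function: the momentum is weighted by the preconditioner [p], so
    that its cross terms with the gradient cancel. *)
Definition energy (x m p : 'rV[R]_n) : R :=
  avg_fun f x + (2 * tau1)^-1 * \sum_c p 0 c * m 0 c ^+ 2.

Variables (x m p : R -> 'rV[R]_n) (C pmin tau : R).
Hypotheses (pmin_gt0 : 0 < pmin) (tau_le1 : tau <= 1).
Hypotheses (x_lip : lip_on_line C x) (m_lip : lip_on_line C m) (p_lip : lip_on_line C p).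
Hypotheses (x_bnd : forall t, `|x t| <= C) (m_bnd : forall t, `|m t| <= C)
  (p_bnd : forall t, `|p t| <= C) (p_min : forall t c, pmin <= p t 0 c).

(** Pointwise form of the limiting differential inclusion. The gradient element
    [m' / tau1 + m] is read off the momentum equation; [flow_dual] says that it
    lies in the averaged field, through its support function. *)
Hypothesis flow_x : forall (t : R) c (dx dm : R), 0 < t < tau ->
  is_derive t (1 : R) (fun s => x s 0 c : R) dx ->
  is_derive t (1 : R) (fun s => m s 0 c : R) dm ->
  dx = - (p t 0 c * ((1 + rho) * m t 0 c + rho / tau1 * dm)).
Hypothesis flow_dual : forall (t : R) (a : 'rV[R]_n) (d : R), 0 < t < tau ->
  is_derive t (1 : R) (fun s => dot a (m s) : R) d ->
  d / tau1 + dot a (m t) <= N%:R^-1 * \sum_i supp (Df i (x t)) a.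
Hypothesis flow_p : forall (t : R) c (d : R), 0 < t < tau ->
  is_derive t (1 : R) (fun s => p s 0 c : R) d ->
  d <= 2 * tau1 * (p t 0 c * (1 - eps0 * p t 0 c ^+ 2)).

Let Phi t := energy (x t) (m t) (p t).

Let C_ge0 : 0 <= C.
Proof. exact: le_trans (x_bnd 0). Qed.

Lemma lip_add (F G : R -> R) (K L : R) : lip_on_line K F -> lip_on_line L G ->
  lip_on_line (K + L) (fun t => F t + G t : R).
Proof.
move=> FK GL s t; have := FK s t; have := GL s t.
have := ler_normD (F s - F t) (G s - G t).
have -> : F s - F t + (G s - G t) = F s + G s - (F t + G t) by ring.
by rewrite mulrDl; lra.
Qed.

Lemma lip_scale (F : R -> R) (K c : R) : lip_on_line K F ->
  lip_on_line (`|c| * K) (fun t => c * F t : R).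
Proof.
move=> FK s t; rewrite -mulrBr normrM -mulrA ler_wpM2l//.
Qed.

Lemma lip_mul (F G : R -> R) (K L A B : R) : lip_on_line K F -> lip_on_line L G ->
  (forall t, `|F t| <= A) -> (forall t, `|G t| <= B) ->
  lip_on_line (A * L + B * K) (fun t => F t * G t : R).
Proof.
move=> FK GL FA GB s t.
have -> : F s * G s - F t * G t = F s * (G s - G t) + G t * (F s - F t) by ring.
apply: (le_trans (ler_normD _ _)); rewrite !normrM mulrDl -!mulrA lerD//.
  by rewrite ler_pM// ?FA//; exact: GL.
by rewrite ler_pM// ?GB//; exact: FK.
Qed.

Lemma lip_sum (I : Type) (r : seq I) (F : I -> R -> R) (K : I -> R) :
  (forall i, lip_on_line (K i) (F i)) ->
  lip_on_line (\sum_(i <- r) K i) (fun t => \sum_(i <- r) F i t : R).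
Proof.
move=> FK s t; rewrite -sumrB (le_trans (ler_norm_sum _ _ _))// mulr_suml.
by apply: ler_sum => i _; exact: FK.
Qed.

Lemma energy_lip : exists L, lip_on_line L (fun t => Phi t : R).
Proof.
have ex i : exists Ki : R, lip_on_line Ki (fun t => f i (x t) : R).
  have [M M0 fM] := lipschitz_on_compact (f_lipschitz i) (@closed_ball_compact R n C).
  exists (M * C) => s t; apply: (le_trans (fM _ _ (x_bnd s) (x_bnd t))).
  by rewrite -mulrA ler_wpM2l ?(ltW M0)//; exact: x_lip.
have [K KF] := choice ex.
have mc c : forall t, `|m t 0 c| <= C by move=> t; exact: le_trans (coord_le_norm _ _) (m_bnd t).
have pc c : forall t, `|p t 0 c| <= C by move=> t; exact: le_trans (coord_le_norm _ _) (p_bnd t).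
have mlc c := lip_coord c m_lip; have plc c := lip_coord c p_lip.
have m2 c : forall t, `|m t 0 c * m t 0 c| <= C * C.
  by move=> t; rewrite normrM ler_pM.
eexists; apply: lip_add.
  by apply: lip_scale; apply: lip_sum; exact: KF.
apply: lip_scale; apply: lip_sum => c.
exact: (lip_mul (plc c) (lip_mul (mlc c) (mlc c) (mc c) (mc c)) (pc c) (m2 c)).
Qed.

(** Write [G = m' / tau1 + m] for the gradient element. The dual inequality at
    [x'] and [- x'], with the chain rule, gives [(f x)' = <x', G>], whose part
    [- <p m, G>] cancels the cross term in the derivative of the kinetic energy.
    What remains is [- rho <p G, G>] and [- sum_c p_c m_c^2], and the latter is only
    partly consumed by the growth of [p]. *)
Lemma energy_derive : {ae mu, forall t, 0 < t < tau ->
  exists d : R, [/\ is_derive t (1 : R) (fun t => Phi t : R) d,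
    d <= - (eps0 * \sum_c p t 0 c ^+ 3 * m t 0 c ^+ 2) &
    forall a, dot a (m t) + dot a (derive1 m t) / tau1 <=
      N%:R^-1 * \sum_i supp (Df i (x t)) a]}.
Proof.
have cr : {ae mu, forall t : R, forall i, 0 < t < 1 -> derivable x t 1 /\
    exists d : R, is_derive t (1 : R) (fun t : R => f i (x t) : R) d /\
      forall v, Df i (x t) v -> dot (derive1 x t) v = d}.
  by apply: filter_forall => i; exact: (chain_rule (Df_cons i) x_lip).
have dx := lip_curve_ae_derivable 0 1 x_lip.
have dm := lip_curve_ae_derivable 0 1 m_lip.
have dp := lip_curve_ae_derivable 0 1 p_lip.
have dall : {ae mu, forall t : R, 0 < t < 1 ->
    [/\ derivable x t 1, derivable m t 1 & derivable p t 1]}.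
  by apply: filterS3 dx dm dp => t xt mt pt t01; split; [exact: xt|exact: mt|exact: pt].
apply: filterS2 cr dall => t ti allt tt.
have t01 : 0 < t < 1 by case/andP: tt => -> /= tt; exact: lt_le_trans tt tau_le1.
have [xt mt pt] := allt t01.
have {ti} [dd ddE] := choice (fun i => (ti i t01).2).
have coord_d (g : R -> 'rV[R]_n) c : derivable g t 1 ->
    is_derive t (1 : R) (fun s => g s 0 c : R) (derive1 g t 0 c).
  move=> gt; have /derivable_mxP/(_ 0 c) gc := gt.
  by split => //; rewrite derive1E derive_mx// mxE.
have dot_d (g : R -> 'rV[R]_n) (a : 'rV[R]_n) : derivable g t 1 ->
    is_derive t (1 : R) (fun s => dot a (g s) : R) (dot a (derive1 g t)).
  move=> gt; have -> : (fun s => dot a (g s) : R) =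
      \sum_c (a 0 c \*: (fun s => g s 0 c : R)).
    by apply/funext => s; rewrite fct_sumE.
  by apply: is_derive_sum => c; apply: is_deriveZ; exact: coord_d.
pose G c := derive1 m t 0 c / tau1 + m t 0 c.
have mE c : derive1 m t 0 c = tau1 * (G c - m t 0 c).
  by rewrite /G addrK mulrC divfK// gt_eqF.
have xE c : derive1 x t 0 c = - (p t 0 c * (m t 0 c + rho * G c)).
  rewrite (flow_x tt (coord_d x c xt) (coord_d m c mt)) /G; field; exact: lt0r_neq0.
have dual a : dot a (m t) + dot a (derive1 m t) / tau1 <=
    N%:R^-1 * \sum_i supp (Df i (x t)) a.
  by rewrite addrC; exact: flow_dual tt (dot_d m a mt).
have fE : N%:R^-1 * \sum_i dd i = \sum_c derive1 x t 0 c * G c.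
  have GE (a : 'rV[R]_n) : dot a (m t) + dot a (derive1 m t) / tau1 = \sum_c a 0 c * G c.
    rewrite /dot mulr_suml -big_split/=; apply: eq_bigr => c _.
    by rewrite /G; ring.
  apply/eqP; rewrite eq_le; apply/andP; split.
    have := dual (- derive1 x t); rewrite GE.
    rewrite (eq_bigr (fun i => - dd i)); last first.
      move=> i _; have [v Dv <-] := supp_ex (Dusc i) (x t) (- derive1 x t).
      by rewrite dotNl (ddE i).2.
    rewrite [X in X <= _](eq_bigr (fun c => - (derive1 x t 0 c * G c))); last first.
      by move=> c _; rewrite mxE mulNr.
    by rewrite !sumrN mulrN lerN2.
  have := dual (derive1 x t); rewrite GE (eq_bigr dd)// => i _.
  by have [v Dv <-] := supp_ex (Dusc i) (x t) (derive1 x t); rewrite (ddE i).2.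
pose dPhi := N%:R^-1 * \sum_i dd i + (2 * tau1)^-1 *
  \sum_c (p t 0 c * (2 * m t 0 c * derive1 m t 0 c) + m t 0 c ^+ 2 * derive1 p t 0 c).
exists dPhi; split=> //.
  have -> : (fun t => Phi t : R) = (N%:R^-1 \*: \sum_i (fun t => f i (x t) : R)) +
      ((2 * tau1)^-1 \*: \sum_c ((fun t => p t 0 c : R) * ((fun t => m t 0 c : R) ^+ 2))).
    apply/funext => s; rewrite /Phi /energy /avg_fun /=.
    by rewrite [RHS]/GRing.add/= !fct_sumE.
  apply: is_deriveD.
    by apply: is_deriveZ; apply: is_derive_sum => i; exact: (ddE i).1.
  apply: is_deriveZ; apply: is_derive_sum => c.
  have h1 := coord_d p c pt; have h2 := coord_d m c mt.
  have h3 := is_deriveM h1 (is_deriveX 2 h2).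
  apply: is_derive_eq; rewrite exprfctE /GRing.scale/= expr1; ring.
rewrite /dPhi fE [X in _ + X <= _]mulr_sumr -big_split/= mulr_sumr -sumrN ler_sum// => c _.
have pc := flow_p tt (coord_d p c pt).
have p0 : 0 < p t 0 c := lt_le_trans pmin_gt0 (p_min t c).
rewrite xE mE.
have m2 : 0 <= m t 0 c ^+ 2 := sqr_ge0 _.
have h1 : (2 * tau1)^-1 * (m t 0 c ^+ 2 * derive1 p t 0 c) <=
    m t 0 c ^+ 2 * (p t 0 c * (1 - eps0 * p t 0 c ^+ 2)).
  rewrite mulrCA ler_wpM2l// -ler_pdivlMl ?invr_gt0 ?mulr_gt0// invrK.
  by [].
have h2 : 0 <= rho * (p t 0 c * G c ^+ 2) by rewrite mulr_ge0// mulr_ge0 ?sqr_ge0// ltW.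
have h3 : (2 * tau1)^-1 * (p t 0 c * (2 * m t 0 c * (tau1 * (G c - m t 0 c)))) =
    p t 0 c * m t 0 c * (G c - m t 0 c).
  by field; exact: lt0r_neq0.
rewrite [(2 * tau1)^-1 * _]mulrDr h3; lra.
Qed.

Lemma energy_nonincreasing s t : 0 <= s -> s <= t -> t <= tau -> Phi t <= Phi s.
Proof.
move=> s0 st tt; have [L PL] := energy_lip.
apply: (lip_nonincreasing PL st); apply: filterS energy_derive => u hu /andP[su ut] d Phid.
have [|d' [d'E d'le _]] := hu; first by apply/andP; split; lra.
have -> : d = d' by case: Phid => _ <-; case: d'E => _ <-.
apply: (le_trans d'le); rewrite oppr_le0 mulr_ge0 ?(ltW eps0_gt0)//.
apply: sumr_ge0 => c _; rewrite mulr_ge0 ?sqr_ge0// exprn_ge0//.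
exact: le_trans (ltW pmin_gt0) (p_min u c).
Qed.

(** Constant energy forces [m = 0] at almost all times, hence [m = m' = 0] near
    every interior time; the dual inequality then says that [x t] is critical, and
    both properties pass to the limit [t = 0]. *)
Lemma energy_stationary : 0 < tau -> Phi 0 <= Phi tau ->
  m 0 = 0 /\ crit_dual Df (x 0).
Proof.
move=> tau0 P0.
have Pcst t : 0 <= t <= tau -> Phi t = Phi 0.
  move=> /andP[t0 tt]; apply/eqP; rewrite eq_le energy_nonincreasing//=.
  by apply: (le_trans P0); exact: energy_nonincreasing.
have ae0 : {ae mu, forall t, 0 < t < tau -> m t = 0 /\
    forall a, dot a (m t) + dot a (derive1 m t) / tau1 <=
      N%:R^-1 * \sum_i supp (Df i (x t)) a}.
  apply: filterS energy_derive => t ht tt; have [d [dE dle dual]] := ht tt; split=> //.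
  have d0 : d = 0.
    have : is_derive t (1 : R) (cst (Phi 0)) 0 by exact: is_derive_cst.
    move=> h; have : is_derive t (1 : R) (fun t => Phi t : R) 0.
      apply: near_eq_is_derive h.
      have tt' : t \in `]0, tau[ by rewrite in_itv.
      near=> u; rewrite /= Pcst//.
      have : u \in `]0, tau[ by near: u; exact: near_in_itvoo.
      by rewrite in_itv/= => /andP[/ltW -> /ltW ->].
    by case: dE => _ <- [_ <-].
  have p0 c : 0 < p t 0 c := lt_le_trans pmin_gt0 (p_min t c).
  have sum0 : \sum_c p t 0 c ^+ 3 * m t 0 c ^+ 2 = 0.
    apply/eqP; rewrite eq_le; apply/andP; split; last first.
      by apply: sumr_ge0 => c _; rewrite mulr_ge0 ?sqr_ge0// exprn_ge0// ltW.
    by move: dle; rewrite d0 oppr_ge0 pmulr_rle0.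
  apply/rowP => c; rewrite mxE; move/eqP: sum0; rewrite psumr_eq0; last first.
    by move=> i _; rewrite mulr_ge0 ?sqr_ge0// exprn_ge0// ltW.
  move=> /allP/(_ c (mem_index_enum c))/=; rewrite mulf_eq0 expf_eq0/= gt_eqF//=.
  by rewrite sqrf_eq0 => /eqP.
have small e : 0 < e -> exists2 t, 0 < t < Num.min e tau & m t = 0 /\ crit_dual Df (x t).
  move=> e0; have me : 0 < Num.min e tau by rewrite lt_min e0.
  have [mle1 mle2] : Num.min e tau <= e /\ Num.min e tau <= tau by rewrite !ge_min !lexx orbT.
  have m0 t : 0 < t < tau -> m t = 0.
    move=> /andP[t0 tt]; apply/eqP; rewrite -normr_eq0 eq_le normr_ge0 andbT.
    apply/ler_addgt0Pr => r r0; rewrite add0r.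
    have C1 : 0 < C + 1 by rewrite ltr_wpDl.
    have rC : 0 < r / (C + 1) by rewrite divr_gt0.
    pose w := Num.min (r / (C + 1)) (tau - t).
    have w0 : 0 < w by rewrite lt_min rC subr_gt0.
    have [w1 w2] : w <= r / (C + 1) /\ w <= tau - t by rewrite !ge_min !lexx orbT.
    have [|s /andP[ts sw] hs] := ae_ex (_ : t < t + w) ae0; first by rewrite ltrDl.
    have [|ms _] := hs; first by apply/andP; split; lra.
    have := m_lip t s; rewrite ms subr0 ltr0_norm ?subr_lt0// => /le_trans; apply.
    have sr : - (t - s) <= r / (C + 1) by lra.
    apply: (@le_trans _ _ (C * (r / (C + 1)))); first by rewrite ler_wpM2l.
    by rewrite mulrA ler_pdivrMr// mulrC ler_wpM2l ?(ltW r0)// lerDl.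
  have [t /andP[t0 tm] ht] := ae_ex me ae0.
  exists t; first by rewrite t0.
  have [|mt dual] := ht; first by apply/andP; split; lra.
  split=> // a; have := dual a; rewrite mt dot0r add0r.
  have -> : derive1 m t = 0.
    have h : is_derive t (1 : R) (cst (0 : 'rV[R]_n)) 0 by exact: is_derive_cst.
    have [_ <-] : is_derive t (1 : R) m 0; last by rewrite derive1E.
    apply: near_eq_is_derive h.
    have tt' : t \in `]0, tau[ by rewrite in_itv/= t0/=; lra.
    near=> u; rewrite /= m0//.
    have : u \in `]0, tau[ by near: u; exact: near_in_itvoo.
    by rewrite in_itv.
  rewrite dot0r mul0r => h; case: (posnP N) => [N0|N0].
    by rewrite big1// => i; exfalso; case: i => i; rewrite N0.
  by rewrite -(pmulr_rge0 _ (_ : 0 < N%:R^-1)) ?invr_gt0 ?ltr0n.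
split.
  apply/eqP; rewrite -normr_eq0 eq_le normr_ge0 andbT; apply/ler_addgt0Pr => e e0.
  have C1 : 0 < C + 1 by rewrite ltr_wpDl.
  have [t /andP[t0 te] [mt _]] := small _ (divr_gt0 e0 C1).
  have := m_lip 0 t; rewrite mt subr0 sub0r normrN gtr0_norm// add0r => /le_trans; apply.
  apply: (@le_trans _ _ (C * (e / (C + 1)))).
    by rewrite ler_wpM2l// (le_trans (ltW te))// ge_min lexx.
  by rewrite mulrA ler_pdivrMr// mulrC ler_wpM2l ?(ltW e0)// lerDl.
apply: contrapT => ncrit.
have : nbhs (x 0) (~` crit_dual Df).
  by apply: open_nbhs_nbhs; split => //; rewrite openC; exact: crit_dual_closed.
have := lip_continuous x_lip (x := 0).
move=> xc /xc /nbhs_ballP[e /= e0 he].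
have [t /andP[t0 te] [_ ct]] := small e e0.
apply: (he t) ct; rewrite /ball/= sub0r normrN gtr0_norm//.
by apply: lt_le_trans te _; rewrite ge_min lexx.
Unshelve. all: by end_near. Qed.

End Lyapunov.

(** * Schemes and their limits *)

Section Scheme.
Context {R : realType} {n N : nat}.
Variables (Df : 'I_N -> 'rV[R]_n -> set 'rV[R]_n) (eps0 tau1 rho : R).

(** What the algorithm looks like over passes through the whole sum: [k] counts the
    passes, [h k] is the sum of the step sizes of a pass, [p] the preconditioner,
    and [g i] the gradient used for [f i], taken at a nearby point [y i]. The
    dynamics of the second moment only enter through a one-sided bound on the
    growth of [p]. *)
Record scheme (C pmin : R) (x m p : nat -> 'rV[R]_n) (h : nat -> R) (K : nat) : Prop := {
  scheme_gt0 : forall k, 0 < h k;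
  scheme_x : forall k, (k <= K)%N -> `|x k| <= C;
  scheme_m : forall k, (k <= K)%N -> `|m k| <= C;
  scheme_p : forall k, (k <= K)%N -> `|p k| <= C;
  scheme_pmin : forall k c, (k <= K)%N -> pmin <= p k 0 c;
  scheme_lip : forall k, (k < K)%N -> [/\ `|x k.+1 - x k| <= C * h k,
    `|m k.+1 - m k| <= C * h k & `|p k.+1 - p k| <= C * h k];
  scheme_step : forall k, (k < K)%N -> exists y g : 'I_N -> 'rV[R]_n,
    let gbar := N%:R^-1 *: \sum_i g i in
    [/\ forall i, Df i (y i) (g i), forall i, `|y i - x k| <= C * h k,
        `|gbar| <= C,
        (forall c, `|m k.+1 0 c - m k 0 c - tau1 * h k * (gbar 0 c - m k 0 c)| <= C * h k ^+ 2 /\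
         `|x k.+1 0 c - x k 0 c + h k * (p k 0 c * (m k 0 c + rho * gbar 0 c))| <= C * h k ^+ 2) &
        forall c, p k.+1 0 c - p k 0 c <=
          h k * (2 * tau1 * (p k 0 c * (1 - eps0 * p k 0 c ^+ 2))) + C * h k ^+ 2]
}.

Lemma scheme_sub C pmin k L x m p h K : scheme C pmin x m p h K -> (k + L <= K)%N ->
  scheme C pmin (fun i => x (k + i)%N) (fun i => m (k + i)%N) (fun i => p (k + i)%N) (fun i => h (k + i)%N) L.
Proof.
move=> S0 kL; have lt i : (i < L)%N -> (k + i < K)%N by lia.
have le i : (i <= L)%N -> (k + i <= K)%N by lia.
split=> [i|i /le|i /le|i /le|i c /le|i /lt|i /lt]; rewrite ?addnS.
- exact: (scheme_gt0 S0).
- exact: (scheme_x S0).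
- exact: (scheme_m S0).
- exact: (scheme_p S0).
- exact: (scheme_pmin S0).
- exact: (scheme_lip S0).
- exact: (scheme_step S0).
Qed.

End Scheme.

(** The last step time below 1 is at least 1/2, because the next one exceeds 1. *)
Lemma full_window {R : realType} (h : nat -> R) K : (forall k, 0 < h k) -> (forall k, (k < K)%N -> h k <= 1 / 2) ->
  1 < step_time h K -> exists k, [/\ (k < K)%N, 1 / 2 <= step_time h k & step_time h k <= 1].
Proof.
move=> h0 hK K1; have [k [kK k1 _ kE]] := step_index_ex h0 K 1.
have {}k1 := k1 ler01.
have lt_kK : (k < K)%N.
  by rewrite ltn_neqAle kK andbT; apply/eqP => kE'; move: k1; rewrite kE' leNgt K1.
case: kE => [kE'|]; first by move: lt_kK; rewrite kE' ltnn.
by rewrite step_timeS => h1; exists k; split=> //; have := hK k lt_kK; lra.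
Qed.

Section SchemeLimit.
Context {R : realType} {n N : nat}.
Variables (Df : 'I_N -> 'rV[R]_n -> set 'rV[R]_n).
Hypothesis Dusc : forall i, usc_field (Df i).
Variables (eps0 tau1 rho : R).
Hypotheses (eps0_gt0 : 0 < eps0) (tau1_gt0 : 0 < tau1) (rho_ge0 : 0 <= rho).
Context {U : set_system nat} {UU : UltraFilter U}.
Hypothesis U_oo : \oo `<=` U.
Variables (C pmin : R) (x m p : nat -> nat -> 'rV[R]_n) (h : nat -> nat -> R) (K : nat -> nat).
Hypotheses (C_ge1 : 1 <= C) (pmin_gt0 : 0 < pmin).
Hypothesis h_small : forall j k, (k < K j)%N -> h j k <= harmonic j.
Hypothesis S : forall j, scheme Df eps0 tau1 rho C pmin (x j) (m j) (p j) (h j) (K j).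
Variable tau : R.
Hypothesis tau_lim : (fun j => step_time (h j) (K j)) @ U --> tau.

Let h_gt0 j k : 0 < h j k := scheme_gt0 (S j) k.
Let C_ge0 : 0 <= C. Proof. exact: le_trans C_ge1. Qed.
Let PU : ProperFilter U. Proof. exact: ultra_proper. Qed.
#[local] Existing Instance PU.

Notation idx := (step_index h K).

Variables (X M P : R -> 'rV[R]_n).
Hypothesis X_lim : forall t, (fun j => x j (idx j t)) @ U --> X t.
Hypothesis M_lim : forall t, (fun j => m j (idx j t)) @ U --> M t.
Hypothesis P_lim : forall t, (fun j => p j (idx j t)) @ U --> P t.

Let V : normedModType R := ('rV[R]_n * ('rV[R]_n * 'rV[R]_n))%type.
Let z j k : V := (x j k, (m j k, p j k)).
Let Z t : V := (X t, (M t, P t)).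

Let Z_lim t : (fun j => z j (idx j t)) @ U --> Z t.
Proof. exact: (cvg_pair (@X_lim t) (cvg_pair (@M_lim t) (@P_lim t))). Qed.

Let z_lip j k : (k < K j)%N -> `|z j k.+1 - z j k| <= C * h j k.
Proof.
move=> kK; have [hx hm hp] := scheme_lip (S j) kK.
by rewrite /z prod_normE/= prod_normE/= !ge_max hx hm hp.
Qed.

Let z_close j k t r : `|z j k - Z t| <= r ->
  [/\ `|x j k - X t| <= r, `|m j k - M t| <= r & `|p j k - P t| <= r].
Proof.
by rewrite /z /Z prod_normE/= prod_normE/= !ge_max => /and3P[].
Qed.

Let rate (phi : nat -> nat -> R) (Phi : R -> R) (b t d : R) :
  0 <= t < tau ->
  (forall s, (fun j => phi j (idx j s)) @ U --> Phi s) ->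
  (forall e : R, 0 < e -> exists2 r : R, 0 < r & \forall j \near U,
     forall k, (k < K j)%N ->
     `|x j k - X t| <= r -> `|m j k - M t| <= r -> `|p j k - P t| <= r ->
     phi j k.+1 - phi j k <= (b + e) * h j k) ->
  is_derive t (1 : R) Phi d -> d <= b.
Proof.
move=> t0 phi_lim H; apply: (rate_le h_gt0 h_small U_oo tau_lim C_ge0 z_lip Z_lim t0 phi_lim).
move=> e e0; have [r r0 near_r] := H e e0; exists r => //.
by apply: filterS near_r => j hj k kK /z_close[? ? ?]; exact: hj.
Qed.

Let M_bnd t : `|M t| <= C.
Proof.
apply: (cvgr_to_le (cvg_norm (@M_lim t))); apply: nearW => j.
by apply: (scheme_m (S j)); have [] := @step_indexP _ h K h_gt0 j t.
Qed.

Let P_bnd t : `|P t| <= C.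
Proof.
apply: (cvgr_to_le (cvg_norm (@P_lim t))); apply: nearW => j.
by apply: (scheme_p (S j)); have [] := @step_indexP _ h K h_gt0 j t.
Qed.

Let coordB (u v : 'rV[R]_n) c r : `|u - v| <= r -> `|u 0 c - v 0 c| <= r.
Proof. by move=> uv; have := coord_le_norm (u - v) c; rewrite !mxE => /le_trans; apply. Qed.

Let coordN (u : 'rV[R]_n) c r : `|u| <= r -> `|u 0 c| <= r.
Proof. by move=> uv; exact: le_trans (coord_le_norm _ _) uv. Qed.

Let cvg_coord_lim (a : nat -> nat -> 'rV[R]_n) (A : R -> 'rV[R]_n) c t :
  (fun j => a j (idx j t)) @ U --> A t -> (fun j => a j (idx j t) 0 c) @ U --> A t 0 c.
Proof. by move=> aA; exact: (cvg_comp _ _ aA (@coord_continuous _ _ _ 0 c (A t))). Qed.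

Lemma limit_flow_p t c (d : R) : 0 <= t < tau ->
  is_derive t (1 : R) (fun s => P s 0 c : R) d ->
  d <= 2 * tau1 * (P t 0 c * (1 - eps0 * P t 0 c ^+ 2)).
Proof.
move=> tt; apply: (rate (phi := fun j k => p j k 0 c) tt) => [s|e e0].
  exact: cvg_coord_lim (@P_lim s).
pose L := 2 * tau1 * (1 + 3 * eps0 * C ^+ 2).
have L0 : 0 < L by rewrite !mulr_gt0// ltr_pwDl// mulr_ge0 ?sqr_ge0// mulr_ge0// ltW.
have e2L : 0 < e / (2 * L) by rewrite divr_gt0// mulr_gt0.
have e2C : 0 < e / (2 * C) by rewrite divr_gt0// mulr_gt0// (lt_le_trans ltr01).
exists (e / (2 * L)) => //; apply: filterS (U_small U_oo e2C) => j je k kK _ _ pP.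
have [y [g [_ _ _ _ /(_ c) hp]]] := scheme_step (S j) kK.
apply: (le_trans hp); have hk := h_gt0 j k.
have hC : C * h j k <= e / 2.
  apply: (@le_trans _ _ (C * (e / (2 * C)))).
    by rewrite ler_wpM2l// (le_trans (h_small kK))// ltW.
  by have -> // : C * (e / (2 * C)) = e / 2; field; apply: lt0r_neq0; exact: lt_le_trans C_ge1.
have q0 := coordB c pP; set a := p j k 0 c in q0 *; set b := P t 0 c in q0 *.
have aC : `|a| <= C by apply: coordN; apply: (scheme_p (S j)); exact: ltnW.
have bC : `|b| <= C by exact: coordN.
have qq : a * (1 - eps0 * a ^+ 2) - b * (1 - eps0 * b ^+ 2) <= e / (2 * L) * (1 + 3 * eps0 * C ^+ 2).
  have -> : a * (1 - eps0 * a ^+ 2) - b * (1 - eps0 * b ^+ 2) =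
     (a - b) * (1 - eps0 * (a ^+ 2 + a * b + b ^+ 2)) by ring.
  rewrite (le_trans (ler_norm _))// normrM ler_pM//.
  rewrite (le_trans (ler_normB _ _))// normr1 lerD2l normrM (gtr0_norm eps0_gt0).
  have -> : 3 * eps0 * C ^+ 2 = eps0 * (3 * C ^+ 2) by ring.
  rewrite ler_wpM2l ?(ltW eps0_gt0)//.
  have a2 : `|a ^+ 2| <= C ^+ 2 by rewrite normrX; apply: lerXn2r; rewrite ?nnegrE.
  have b2 : `|b ^+ 2| <= C ^+ 2 by rewrite normrX; apply: lerXn2r; rewrite ?nnegrE.
  have ab : `|a * b| <= C ^+ 2 by rewrite normrM expr2 ler_pM.
  have := ler_normD (a ^+ 2 + a * b) (b ^+ 2); have := ler_normD (a ^+ 2) (a * b); lra.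
have qL : 2 * tau1 * (e / (2 * L) * (1 + 3 * eps0 * C ^+ 2)) = e / 2.
  have L' : L != 0 by exact: lt0r_neq0.
  transitivity (L * (e / (2 * L))); first by rewrite /L; ring.
  by field.
have qq2 : 2 * tau1 * (a * (1 - eps0 * a ^+ 2)) <= 2 * tau1 * (b * (1 - eps0 * b ^+ 2)) + e / 2.
  by rewrite -qL -mulrDr ler_wpM2l; [lra|rewrite mulr_ge0// ltW|lra].
have -> : h j k * (2 * tau1 * (a * (1 - eps0 * a ^+ 2))) + C * h j k ^+ 2 =
  (2 * tau1 * (a * (1 - eps0 * a ^+ 2)) + C * h j k) * h j k by ring.
rewrite ler_wpM2r ?(ltW hk)//; lra.
Qed.

(** The gradients of the [k]-th pass are taken near [x k], and the support functions
    of the fields are upper semicontinuous, so the limit satisfies the inclusion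
    [m' / tau1 + m \in conv (1/N sum_i Df i x)]. *)
Lemma limit_flow_dual t (a : 'rV[R]_n) (d : R) : 0 <= t < tau ->
  is_derive t (1 : R) (fun s => dot a (M s) : R) d ->
  d / tau1 + dot a (M t) <= N%:R^-1 * \sum_i supp (Df i (X t)) a.
Proof.
move=> tt dM; suff : d <= tau1 * (N%:R^-1 * \sum_i supp (Df i (X t)) a - dot a (M t)).
  by rewrite -ler_pdivrMl// mulrC; lra.
move: dM; apply: (rate (phi := fun j k => dot a (m j k)) tt) => [s|e e0].
  by apply: cvg_dot; [exact: cvg_cst|exact: M_lim].
have e' : 0 < e / (4 * tau1) by rewrite divr_gt0// mulr_gt0.
have [r1 r10 usc1] : exists2 r : R, 0 < r & forall y i, `|y - X t| <= r ->
    supp (Df i y) a <= supp (Df i (X t)) a + e / (4 * tau1).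
  have h1 : \forall y \near X t, forall i, supp (Df i y) a < supp (Df i (X t)) a + e / (4 * tau1).
    apply: (@filter_forall _ _ _ (nbhs (X t))) => i.
    have xe : supp (Df i (X t)) a < supp (Df i (X t)) a + e / (4 * tau1) by rewrite ltrDl.
    have [[W1 W2] /= [xW aW] WW] := supp_usc (Dusc i) xe.
    apply: (@filterS _ (nbhs (X t)) _ _ _ _ xW) => y Wy; apply: (WW (y, a)); split => //=.
    exact: nbhs_singleton.
  have [r /= r0 hr] := (nbhs_ballP (X t) _).1 h1.
  exists (r / 2); first by rewrite divr_gt0.
  move=> y i yr; apply/ltW/hr; rewrite -ball_normE/= distrC.
  by apply: le_lt_trans yr _; rewrite ltr_pdivrMr// ltr_pMr// ltr1n.
pose B := n%:R * `|a| + 1.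
have B0 : 0 < B by rewrite ltr_wpDl// mulr_ge0.
have aB v r : `|v| <= r -> `|dot a v| <= B * r.
  move=> vr; have r0 : 0 <= r by exact: le_trans vr.
  rewrite (le_trans (dot_le _ _))// mulrA; apply: (@le_trans _ _ (n%:R * `|a| * r)).
    by rewrite ler_wpM2l// mulr_ge0.
  by rewrite ler_wpM2r// lerDl.
pose r2 := e / (4 * tau1 * B).
have r20 : 0 < r2 by rewrite divr_gt0// !mulr_gt0.
pose r := Num.min (r1 / 2) r2.
have r0 : 0 < r by rewrite lt_min r20 divr_gt0.
have [rr1 rr2] : r <= r1 / 2 /\ r <= r2 by rewrite !ge_min !lexx orbT.
have C0 : 0 < C := lt_le_trans ltr01 C_ge1.
have s1 : 0 < r1 / (2 * C) by rewrite divr_gt0// mulr_gt0.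
have s2 : 0 < e / (4 * (B * C)) by rewrite divr_gt0// !mulr_gt0.
exists r => //; apply: filterS2 (U_small U_oo s1) (U_small U_oo s2) => j j1 j2 k kK xr mr _.
have hk := h_gt0 j k.
have [y [g [gD yx gC hm _]]] := scheme_step (S j) kK.
set gbar := _ *: _ in gC hm.
pose er := m j k.+1 - m j k - (tau1 * h j k) *: (gbar - m j k).
have erC : `|er| <= C * h j k ^+ 2.
  apply: norm_leP; first by rewrite mulr_ge0// sqr_ge0.
  move=> c; have [+ _] := hm c; rewrite /er; clearbody gbar.
  by rewrite !mxE.
have mE : dot a (m j k.+1) - dot a (m j k) =
    dot a er + tau1 * h j k * (dot a gbar - dot a (m j k)).
  by rewrite -(dotBr a (m j k.+1)) -(dotBr a gbar) -dotZr -dotDr /er subrK.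
have hC1 : C * h j k <= r1 / 2.
  apply: (@le_trans _ _ (C * (r1 / (2 * C)))).
    by rewrite ler_wpM2l// (le_trans (h_small kK))// ltW.
  by have -> // : C * (r1 / (2 * C)) = r1 / 2; field; exact: lt0r_neq0.
have hC2 : B * (C * h j k) <= e / 4.
  apply: (@le_trans _ _ (B * C * (e / (4 * (B * C))))).
    by rewrite [leLHS]mulrA ler_wpM2l ?mulr_ge0 ?(ltW B0)// (le_trans (h_small kK))// ltW.
  by have -> // : B * C * (e / (4 * (B * C))) = e / 4; field; rewrite !gt_eqF.
have gsupp : dot a gbar <= N%:R^-1 * \sum_i supp (Df i (X t)) a + e / (4 * tau1).
  rewrite dotZr dot_sumr.
  have N0 : 0 <= N%:R^-1 :> R by rewrite invr_ge0.
  apply: (@le_trans _ _ (N%:R^-1 * \sum_(i < N) (supp (Df i (X t)) a + e / (4 * tau1)))).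
    rewrite ler_wpM2l// ler_sum// => i _.
    apply: (le_trans (supp_ge (Dusc i) a (gD i))); apply: usc1.
    have := ler_normD (y i - x j k) (x j k - X t); have := yx i.
    by rewrite addrA subrK; lra.
  rewrite big_split/= mulrDr lerD2l sumr_const card_ord -[(e / _) *+ N]mulr_natl mulrA.
  have [->|NN] := eqVneq (N%:R : R) 0; first by rewrite !mul0r mulr0 ltW.
  by rewrite !mulrA mulVf// mul1r.
have mM : dot a (M t) - dot a (m j k) <= e / (4 * tau1).
  have := aB _ _ mr; rewrite dotBr ler_norml => /andP[h1 _].
  have : B * r <= e / (4 * tau1).
    apply: (@le_trans _ _ (B * r2)); first by rewrite ler_wpM2l// ltW.
    have -> // : B * r2 = e / (4 * tau1); rewrite /r2; field.
    by rewrite !gt_eqF.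
  lra.
have er1 : dot a er <= e / 4 * h j k.
  rewrite (le_trans (ler_norm _))// (le_trans (aB _ _ erC))//.
  by rewrite expr2 !mulrA ler_wpM2r ?(ltW hk)// -mulrA.
have tE : tau1 * (e / (4 * tau1)) = e / 4 by field; exact: lt0r_neq0.
rewrite mE; set Q := N%:R^-1 * _ in gsupp *.
have : tau1 * (dot a gbar - dot a (m j k)) <= tau1 * (Q - dot a (M t)) + e / 2.
  have -> : e / 2 = tau1 * (e / (4 * tau1) + e / (4 * tau1)) by rewrite mulrDr tE; lra.
  by rewrite -mulrDr ler_wpM2l ?(ltW tau1_gt0)//; lra.
move=> h1; have : tau1 * (dot a gbar - dot a (m j k)) * h j k <=
    (tau1 * (Q - dot a (M t)) + e / 2) * h j k by rewrite ler_wpM2r ?(ltW hk).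
have : 0 <= e * h j k by rewrite mulr_ge0// ltW.
lra.
Qed.

(** Eliminating the gradient between the recursions of [x] and [m] shows that
    [x + (rho / tau1) p m], with [p] frozen at its value at time [t], has a rate that
    does not involve the gradient; [rate_le] applied to this quantity and to its
    opposite gives the equation. *)
Lemma limit_flow_x t c (dx dm : R) : 0 <= t < tau ->
  is_derive t (1 : R) (fun s => X s 0 c : R) dx ->
  is_derive t (1 : R) (fun s => M s 0 c : R) dm ->
  dx = - (P t 0 c * ((1 + rho) * M t 0 c + rho / tau1 * dm)).
Proof.
move=> tt dX dM; pose q := rho / tau1 * P t 0 c.
have q0 : 0 <= q.
  rewrite mulr_ge0 ?divr_ge0 ?(ltW tau1_gt0)//.
  apply: (cvgr_to_ge (cvg_coord_lim (c := c) (@P_lim t))); apply: nearW => j.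
  apply: le_trans (ltW pmin_gt0) _; apply: (scheme_pmin (S j)).
  by have [] := @step_indexP _ h K h_gt0 j t.
have C0 : 0 < C := lt_le_trans ltr01 C_ge1.
have dF (s : R) : is_derive t (1 : R) (fun u => s * (X u 0 c + q * M u 0 c) : R)
    (s * (dx + q * dm)).
  exact: (is_deriveZ s (is_deriveD dX (is_deriveZ q dM))).
have key (s : R) : `|s| = 1 -> s * (dx + q * dm) <= s * (- ((1 + rho) * (P t 0 c * M t 0 c))).
  move=> s1; apply: (rate (phi := fun j k => s * (x j k 0 c + q * m j k 0 c)) tt) (dF s) => [u|e e0].
    apply: (@cvgMl_tmp R^o _ U); apply: (@cvgD _ R^o _ U); first exact: cvg_coord_lim.
    by apply: (@cvgMl_tmp R^o _ U); exact: cvg_coord_lim.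
  pose L := 2 * (1 + rho) * C.
  have L0 : 0 < L by rewrite !mulr_gt0// ltr_pwDl.
  pose B := (1 + q) * C; have B0 : 0 < B by rewrite mulr_gt0// ltr_pwDl.
  have eL : 0 < e / (2 * L) by rewrite divr_gt0// mulr_gt0.
  have eB : 0 < e / (2 * B) by rewrite divr_gt0// mulr_gt0.
  exists (e / (2 * L)) => //; apply: filterS (U_small U_oo eB) => j jB k kK _ mr pr.
  have hk := h_gt0 j k.
  have [y [g [_ _ gC /(_ c)[hm hx] _]]] := scheme_step (S j) kK.
  set gb := fun_of_matrix (_ *: _) 0 c in hm hx.
  have {}gC : `|gb| <= C by exact: coordN.
  have {}mr := coordB c mr; have {}pr := coordB c pr.
  have mC : `|m j k 0 c| <= C by apply: coordN; apply: (scheme_m (S j)); exact: ltnW.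
  have PC : `|P t 0 c| <= C by exact: coordN.
  move: hm hx mr pr mC PC gC; rewrite /q.
  set m0 := m j k 0 c; set m1 := m j k.+1 0 c; set x0 := x j k 0 c; set x1 := x j k.+1 0 c.
  set p0 := p j k 0 c; set p_ := P t 0 c; set m_ := M t 0 c; set hh := h j k.
  move=> hm hx mr pr mC PC gC.
  pose e1 := x1 - x0 + hh * (p0 * (m0 + rho * gb)).
  pose e2 := m1 - m0 - tau1 * hh * (gb - m0).
  have -> : s * (x1 + rho / tau1 * p_ * m1) - s * (x0 + rho / tau1 * p_ * m0) =
    s * (e1 + rho / tau1 * p_ * e2) +
    hh * (s * (- ((1 + rho) * (p_ * m_)))) +
    hh * (s * (- ((p0 - p_) * m0 + p_ * (m0 - m_)) - rho * ((p0 - p_) * gb) - rho * (p_ * (m0 - m_)))).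
    by rewrite /e1 /e2; field; exact: lt0r_neq0.
  have E1 : s * (e1 + rho / tau1 * p_ * e2) <= e / 2 * hh.
    rewrite (le_trans (ler_norm _))// normrM s1 mul1r (le_trans (ler_normD _ _))//.
    rewrite [`|_ / _ * _ * _|]normrM (ger0_norm q0).
    have : q * `|e2| <= q * (C * hh ^+ 2) by rewrite ler_wpM2l.
    have : B * hh <= e / 2.
      apply: (@le_trans _ _ (B * (e / (2 * B)))).
        by rewrite ler_wpM2l ?(ltW B0)// (le_trans (h_small kK))// ltW.
      by have -> // : B * (e / (2 * B)) = e / 2; field; exact: lt0r_neq0.
    move=> /(ler_wpM2r (ltW hk)); rewrite -/hh => h1 h2.
    have : C * hh ^+ 2 + q * (C * hh ^+ 2) = B * hh * hh by rewrite /B; ring.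
    lra.
  have E2 : s * (- ((p0 - p_) * m0 + p_ * (m0 - m_)) - rho * ((p0 - p_) * gb) - rho * (p_ * (m0 - m_))) <= e / 2.
    rewrite (le_trans (ler_norm _))// normrM s1 mul1r.
    have n1 : `|(p0 - p_) * m0| <= e / (2 * L) * C by rewrite normrM ler_pM.
    have n2 : `|p_ * (m0 - m_)| <= e / (2 * L) * C by rewrite mulrC normrM ler_pM.
    have n3 : `|(p0 - p_) * gb| <= e / (2 * L) * C by rewrite normrM ler_pM.
    have LE : (2 + 2 * rho) * (e / (2 * L) * C) = e / 2.
      have L' : L != 0 by exact: lt0r_neq0.
      transitivity (L * (e / (2 * L))); first by rewrite /L; ring.
      by field.
    have n4 : `|rho * ((p0 - p_) * gb)| <= rho * (e / (2 * L) * C).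
      by rewrite normrM (ger0_norm rho_ge0) ler_wpM2l.
    have n5 : `|rho * (p_ * (m0 - m_))| <= rho * (e / (2 * L) * C).
      by rewrite normrM (ger0_norm rho_ge0) ler_wpM2l.
    apply: (le_trans (ler_normB _ _)).
    have := ler_normB (- ((p0 - p_) * m0 + p_ * (m0 - m_))) (rho * ((p0 - p_) * gb)).
    have := ler_normD ((p0 - p_) * m0) (p_ * (m0 - m_)).
    rewrite normrN; lra.
  have := ler_wpM2l (ltW hk) E2; rewrite -/hh; lra.
have := key 1 (normr1 _); have := key (-1) (normrN1 _).
rewrite /q; set pm := P t 0 c; set mm := M t 0 c; set w := rho / tau1.
lra.
Qed.

End SchemeLimit.

(** * Energy descent for small steps *)

Section Descent.
Context {R : realType} {n N : nat}.
Variables (f : 'I_N -> 'rV[R]_n -> R) (Df : 'I_N -> 'rV[R]_n -> set 'rV[R]_n).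
Hypothesis Df_cons : forall i, conservative_field_for (f i) (Df i).
Hypothesis f_lipschitz : forall i, locally_lipschitz (f i).
Variables (eps0 tau1 rho C pmin : R).
Hypotheses (eps0_gt0 : 0 < eps0) (tau1_gt0 : 0 < tau1) (rho_ge0 : 0 <= rho).
Hypotheses (C_ge1 : 1 <= C) (pmin_gt0 : 0 < pmin).

Notation scheme := (scheme Df eps0 tau1 rho C pmin).
Notation Phi x m p k := (energy f tau1 (x k) (m k) (p k)).

Let Dusc i : usc_field (Df i).
Proof. by case: (Df_cons i) => -[]. Qed.

Lemma cvg_energy {U : set_system nat} {UU : UltraFilter U} (x m p : nat -> 'rV[R]_n) (x0 m0 p0 : 'rV[R]_n) :
  x @ U --> x0 -> m @ U --> m0 -> p @ U --> p0 ->
  (fun j => Phi x m p j) @ U --> energy f tau1 x0 m0 p0.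
Proof.
move=> xx mm pp; have PU : ProperFilter U by exact: ultra_proper.
apply: (@cvgD _ R^o _ U).
  exact: (cvg_comp _ _ xx (@avg_fun_continuous _ _ _ f f_lipschitz x0)).
apply: (@cvgMl_tmp R^o _ U); apply: (@cvg_sumr R _ _ U) => c.
have coord (a : nat -> 'rV[R]_n) (l : 'rV[R]_n) : a @ U --> l -> (fun j => a j 0 c) @ U --> l 0 c.
  by move=> al; exact: (cvg_comp _ _ al (@coord_continuous _ _ _ 0 c l)).
rewrite (_ : (fun j => p j 0 c * m j 0 c ^+ 2) = (fun j => p j 0 c * (m j 0 c * m j 0 c))); last first.
  by apply/funext => j; rewrite expr2.
by rewrite expr2; apply: (@cvgM _ _ U); [exact: coord|apply: (@cvgM _ _ U); exact: coord].
Qed.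

Section Compactness.
Variables (x m p : nat -> nat -> 'rV[R]_n) (h : nat -> nat -> R) (K : nat -> nat).
Hypothesis S : forall j, scheme (x j) (m j) (p j) (h j) (K j).
Hypothesis h_small : forall j k, (k < K j)%N -> h j k <= harmonic j.
Hypothesis total_le1 : forall j, step_time (h j) (K j) <= 1.
Context {U : set_system nat} {UU : UltraFilter U}.
Hypothesis U_oo : \oo `<=` U.

(** Time-one trajectories of schemes with vanishing steps converge along the
    ultrafilter to solutions of the limiting inclusion, and the energies at both ends
    converge as well. *)
Lemma scheme_compactness : exists (tau : R) (x0 : 'rV[R]_n) (E0 E1 : R),
  [/\ (fun j => step_time (h j) (K j)) @ U --> tau,
      (fun j => x j 0%N) @ U --> x0,
      (fun j => Phi (x j) (m j) (p j) 0%N) @ U --> E0 &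
      (fun j => Phi (x j) (m j) (p j) (K j)) @ U --> E1] /\
  [/\ E1 <= E0 & 0 < tau -> E0 <= E1 -> E0 = avg_fun f x0 /\ crit_dual Df x0].
Proof.
have PU : ProperFilter U by exact: ultra_proper.
have C_ge0 : 0 <= C by exact: le_trans C_ge1.
have h_gt0 j k : 0 < h j k := scheme_gt0 (S j) k.
have [tau tau01 tau_lim] : exists2 tau : R, `[(0 : R), (1 : R)]%classic tau & (fun j => step_time (h j) (K j)) @ U --> tau.
  apply: (ultralimit (@segment_compact R 0 1)) => j.
  by rewrite /= in_itv/= step_time_ge0// total_le1.
pose limit_of (a : nat -> nat -> 'rV[R]_n) (A : R -> 'rV[R]_n) := [/\ forall t, `|A t| <= C,
      forall t, (fun j => a j (step_index h K j t)) @ U --> A t & lip_on_line C A].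
have curve (a : nat -> nat -> 'rV[R]_n) :
    (forall j k, (k <= K j)%N -> `|a j k| <= C) ->
    (forall j k, (k < K j)%N -> `|a j k.+1 - a j k| <= C * h j k) ->
    exists A, limit_of a A.
  move=> aC aL.
  have ex (t : R) : exists y : 'rV[R]_n, `|y| <= C /\ (fun j => a j (step_index h K j t)) @ U --> y.
    have [j|y yC ay] := @ultralimit U UU _ _ (fun j => a j (step_index h K j t)) (@closed_ball_compact R n C).
      by apply: aC; have [] := @step_indexP _ h K h_gt0 j t.
    by exists y.
  have [A AP] := choice ex.
  have A_lim t : (fun j => a j (step_index h K j t)) @ U --> A t := (AP t).2.
  exists A; split=> //; first by move=> t; exact: (AP t).1.
  exact: (limit_lip h_gt0 h_small U_oo C_ge0 aL A_lim).
have [X [X_bnd X_lim X_lip]] : exists A, limit_of x A.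
  by apply: curve => j k kK; [exact: (scheme_x (S j))|have [] := scheme_lip (S j) kK].
have [M [M_bnd M_lim M_lip]] : exists A, limit_of m A.
  by apply: curve => j k kK; [exact: (scheme_m (S j))|have [] := scheme_lip (S j) kK].
have [P [P_bnd P_lim P_lip]] : exists A, limit_of p A.
  by apply: curve => j k kK; [exact: (scheme_p (S j))|have [] := scheme_lip (S j) kK].
have P_min t c : pmin <= P t 0 c.
  apply: (cvgr_to_ge (cvg_comp _ _ (@P_lim t) (@coord_continuous _ _ _ 0 c (P t)))).
  apply: nearW => j; apply: (scheme_pmin (S j)).
  by have [] := @step_indexP _ h K h_gt0 j t.
have tau_le1 : tau <= 1 by move: tau01; rewrite /= in_itv/= => /andP[].
have tau_ge0 : 0 <= tau by move: tau01; rewrite /= in_itv/= => /andP[].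
have inside (t : R) : 0 < t < tau -> 0 <= t < tau by move=> /andP[/ltW -> ->].
have flow_x (t : R) c (dx dm : R) : 0 < t < tau ->
  is_derive t (1 : R) (fun s => X s 0 c : R) dx ->
  is_derive t (1 : R) (fun s => M s 0 c : R) dm ->
  dx = - (P t 0 c * ((1 + rho) * M t 0 c + rho / tau1 * dm)).
  by move=> /inside; exact: (limit_flow_x tau1_gt0 rho_ge0 U_oo C_ge1 pmin_gt0 h_small S tau_lim X_lim M_lim P_lim).
have flow_dual (t : R) (a : 'rV[R]_n) (d : R) : 0 < t < tau ->
  is_derive t (1 : R) (fun s => dot a (M s) : R) d ->
  d / tau1 + dot a (M t) <= N%:R^-1 * \sum_i supp (Df i (X t)) a.
  by move=> /inside; exact: (limit_flow_dual Dusc tau1_gt0 U_oo C_ge1 h_small S tau_lim X_lim M_lim P_lim).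
have flow_p (t : R) c (d : R) : 0 < t < tau ->
  is_derive t (1 : R) (fun s => P s 0 c : R) d ->
  d <= 2 * tau1 * (P t 0 c * (1 - eps0 * P t 0 c ^+ 2)).
  by move=> /inside; exact: (limit_flow_p eps0_gt0 tau1_gt0 U_oo C_ge1 h_small S tau_lim X_lim M_lim P_lim).
exists tau, (X 0), (Phi X M P 0), (Phi X M P tau).
have xS := limit_start h_gt0 X_lim.
split; [split => //|split].
- by apply: cvg_energy => //; [exact: (limit_start h_gt0 M_lim)|exact: (limit_start h_gt0 P_lim)].
- have at_end (a : nat -> nat -> 'rV[R]_n) (A : R -> 'rV[R]_n) : (forall j k, (k < K j)%N -> `|a j k.+1 - a j k| <= C * h j k) ->
      (forall t, (fun j => a j (step_index h K j t)) @ U --> A t) -> (fun j => a j (K j)) @ U --> A tau.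
    by move=> aL aA; exact: (limit_end h_gt0 h_small U_oo tau_lim C_ge0 aL aA).
  apply: cvg_energy; [apply: at_end X_lim|apply: at_end M_lim|apply: at_end P_lim] => j k kK;
    by have [] := scheme_lip (S j) kK.
- exact: (energy_nonincreasing Df_cons f_lipschitz eps0_gt0 tau1_gt0 rho_ge0 pmin_gt0 tau_le1
    X_lip M_lip P_lip X_bnd M_bnd P_bnd P_min flow_x flow_dual flow_p (lexx 0) tau_ge0 (lexx tau)).
- move=> tau_gt0 E01.
  have [M0 cX] := energy_stationary Df_cons f_lipschitz eps0_gt0 tau1_gt0 rho_ge0 pmin_gt0 tau_le1
    X_lip M_lip P_lip X_bnd M_bnd P_bnd P_min flow_x flow_dual flow_p tau_gt0 E01.
  split=> //; rewrite /energy M0 big1 ?mulr0 ?addr0// => c _.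
  by rewrite mxE expr0n mulr0.
Qed.
End Compactness.

(** The ball around [x] is part of the conclusion because the iterates inside a pass
    are only known to be close to its starting point. *)
Definition near_critical (theta delta : R) (x : 'rV[R]_n) (e : R) :=
  exists xs : 'rV[R]_n, [/\ crit_dual Df xs, `|e - avg_fun f xs| <= theta &
    forall y, `|y - x| <= delta -> `|y - xs| <= theta /\ `|avg_fun f y - avg_fun f xs| <= theta].

(** By contradiction: schemes with steps at most [1 / (j + 1)] that violate the claim
    have a limit with nonincreasing energy. If the energy does not drop in the limit,
    [scheme_compactness] says that the limit starts at a critical point without
    momentum, and by continuity the schemes far in the sequence start near it. *)
Lemma descent (theta : R) : 0 < theta -> exists2 delta : R, 0 < delta &
  forall x m p h K, scheme x m p h K -> (forall k, (k < K)%N -> h k <= delta) ->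
  step_time h K <= 1 ->
  Phi x m p K <= Phi x m p 0%N + theta /\
  (1 / 2 <= step_time h K ->
   Phi x m p K <= Phi x m p 0%N - delta \/
   near_critical theta delta (x 0%N) (Phi x m p 0%N)).
Proof.
move=> theta0; apply: contrapT => nodelta.
pose T := ((nat -> 'rV[R]_n) * (nat -> 'rV[R]_n) * (nat -> 'rV[R]_n) * (nat -> R) * nat)%type.
pose late (j : nat) (x m p : nat -> 'rV[R]_n) (h : nat -> R) K := [/\ 1 / 2 <= step_time h K,
  Phi x m p 0%N - harmonic j <= Phi x m p K & ~ near_critical theta (harmonic j) (x 0%N) (Phi x m p 0%N)].
pose bad (j : nat) (s : T) := let: (x, m, p, h, K) := s in
  [/\ scheme x m p h K, forall k, (k < K)%N -> h k <= harmonic j, step_time h K <= 1 &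
   Phi x m p K <= Phi x m p 0%N + theta ->
   late j x m p h K].
have ex j : exists s, bad j s.
  apply: contrapT => nobad; apply: nodelta; exists (harmonic j); first exact: harmonic_gt0.
  move=> x m p h K Ss hs tl; have nb : ~ bad j (x, m, p, h, K) by move=> b; apply: nobad; eexists; exact: b.
  have E : Phi x m p K <= Phi x m p 0%N + theta.
    by apply: contrapT => nE; apply: nb; split=> // /nE.
  split=> // half; apply: contrapT => /not_orP[nE nc]; apply: nb; split=> // _; split=> //.
  by apply/ltW; rewrite ltNge; apply/negP.
have [s sP] := choice ex.
pose x j := (s j).1.1.1.1; pose m j := (s j).1.1.1.2; pose p j := (s j).1.1.2.
pose h j := (s j).1.2; pose K j := (s j).2.
have B j : [/\ scheme (x j) (m j) (p j) (h j) (K j), forall k, (k < K j)%N -> h j k <= harmonic j, step_time (h j) (K j) <= 1 &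
   Phi (x j) (m j) (p j) (K j) <= Phi (x j) (m j) (p j) 0%N + theta ->
   late j (x j) (m j) (p j) (h j) (K j)].
  by have := sP j; rewrite /bad /x /m /p /h /K; case: (s j) => -[[[]]].
have [U [UU U_oo]] := ultraFilterLemma eventually_filter.
have PU : ProperFilter U by exact: ultra_proper.
have Ss j : scheme (x j) (m j) (p j) (h j) (K j) by have [] := B j.
have hs j k : (k < K j)%N -> h j k <= harmonic j by have [_ + _ _] := B j; apply.
have tl j : step_time (h j) (K j) <= 1 by have [] := B j.
have [tau [x0 [E0 [E1 [[tau_lim x_lim E0_lim E1_lim] [E10 crit]]]]]] := scheme_compactness Ss hs tl U_oo.
have t3 : 0 < theta / 3 by rewrite divr_gt0.
have close (a : nat -> R) (l e : R) : a @ U --> l -> 0 < e -> \forall j \near U, `|l - a j| <= e.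
  by move=> al e0; exact: ((@cvgrPdist_le _ R^o _ U _ a l).1 al _ e0).
have near0 := close _ _ _ E0_lim t3.
have near1 := close _ _ _ E1_lim t3.
have late_U : \forall j \near U, late j (x j) (m j) (p j) (h j) (K j).
  apply: filterS2 near0 near1 => j; rewrite !ler_norml => /andP[a1 a2] /andP[b1 b2].
  by have [_ _ _] := B j; apply; lra.
have tau_gt0 : 0 < tau.
  apply: (@lt_le_trans _ _ (1 / 2)); first by rewrite divr_gt0.
  by apply: (cvgr_to_ge tau_lim); apply: filterS late_U => j [].
have E01 : E0 <= E1.
  apply/ler_addgt0Pr => e e0; have e3 : 0 < e / 3 by rewrite divr_gt0.
  have n0 := close _ _ _ E0_lim e3; have n1 := close _ _ _ E1_lim e3.
  have n2 : \forall j \near U, harmonic j < e / 3 by exact: (U_small U_oo e3).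
  have [j [[a b] [c [_ d _]]]] : exists j, (`|E0 - Phi (x j) (m j) (p j) 0%N| <= e / 3 /\
     `|E1 - Phi (x j) (m j) (p j) (K j)| <= e / 3) /\ (harmonic j < e / 3 /\
     late j (x j) (m j) (p j) (h j) (K j)).
    by apply: (@filter_ex _ U); apply: filterI; apply: filterI.
  by move: a b; rewrite !ler_norml => /andP[a1 a2] /andP[b1 b2]; lra.
have [E0E cx0] := crit tau_gt0 E01.
have fc : \forall y \near x0, `|avg_fun f x0 - avg_fun f y| <= theta.
  exact: ((@cvgrPdist_le _ R^o _ (nbhs x0) _ (avg_fun f) (avg_fun f x0)).1 (@avg_fun_continuous _ _ _ f f_lipschitz x0) _ theta0).
have [r /= r0 rP] := (nbhs_ballP x0 _).1 fc.
pose r' := Num.min r theta; have r'0 : 0 < r' by rewrite lt_min r0.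
have r3 : 0 < r' / 3 by rewrite divr_gt0.
have nx : \forall j \near U, `|x0 - x j 0%N| <= r' / 3.
  exact: ((@cvgrPdist_le _ _ _ U _ (fun j => x j 0%N) x0).1 x_lim _ r3).
have nh : \forall j \near U, harmonic j < r' / 3 by exact: (U_small U_oo r3).
have [j [[a b] [c [_ _]]]] : exists j, (`|E0 - Phi (x j) (m j) (p j) 0%N| <= theta / 3 /\
     `|x0 - x j 0%N| <= r' / 3) /\ (harmonic j < r' / 3 /\
     late j (x j) (m j) (p j) (h j) (K j)).
  by apply: (@filter_ex _ U); apply: filterI; apply: filterI.
apply; exists x0; split=> //.
  by rewrite -E0E distrC (le_trans a)//; lra.
move=> y yj.
have yx : `|y - x0| < r'.
  have := ler_distD (x j 0%N) y x0; rewrite [X in _ <= _ + X]distrC; lra.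
have [rr rt] : r' <= r /\ r' <= theta by rewrite !ge_min !lexx orbT.
split; first exact/ltW/(lt_le_trans yx).
by rewrite distrC; apply: rP; rewrite -ball_normE/= distrC; exact: lt_le_trans yx rr.
Qed.

End Descent.

(** * Trapping and convergence of schemes *)

Section Trap.
Context {R : realType} (S : forall m, set (set 'rV[R]_m)) (Somin : o_minimal S).
Context {n N : nat}.
Variables (f : 'I_N -> 'rV[R]_n -> R) (Df : 'I_N -> 'rV[R]_n -> set 'rV[R]_n).
Hypothesis f_coercive : coercive (avg_fun f).
Hypothesis f_definable : forall i, definable_fun S (f i).
Hypothesis f_lipschitz : forall i, locally_lipschitz (f i).
Hypothesis Df_definable : forall i, definable_map S (Df i).
Hypothesis Df_cons : forall i, conservative_field_for (f i) (Df i).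
Variables (eps0 tau1 rho C pmin : R).
Hypotheses (eps0_gt0 : 0 < eps0) (tau1_gt0 : 0 < tau1) (rho_ge0 : 0 <= rho).
Hypotheses (C_ge1 : 1 <= C) (pmin_gt0 : 0 < pmin).

Notation scheme := (scheme Df eps0 tau1 rho C pmin).
Notation Phi x m p k := (energy f tau1 (x k) (m k) (p k)).

Definition trapped (l mu delta : R) := forall x m p h K, scheme x m p h K ->
  (forall k, (k < K)%N -> h k <= delta) -> Phi x m p 0%N <= l ->
  Phi x m p K <= l + mu.

Lemma trapped_le l mu d1 d2 : d1 <= d2 -> trapped l mu d2 -> trapped l mu d1.
Proof.
by move=> d12 t2 x m p h K S0 hd; apply: t2 S0 _ => k kK; exact: le_trans (hd k kK) d12.
Qed.

(** [sard] provides an interval without critical values between [l] and [l + mu].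
    Climbing through it takes several windows of duration between 1/2 and 1, and by
    [descent] each window that starts in the interval loses energy. *)
Lemma trap (l mu : R) : 0 < mu -> exists2 delta : R, 0 < delta & trapped l mu delta.
Proof.
move=> mu0; have lmu : l < l + mu by rewrite ltrDl.
have [c [d [lc cd dl gap]]] := sard Somin Df_cons f_coercive f_definable f_lipschitz Df_definable lmu.
pose th := (d - c) / 8; have th0 : 0 < th by rewrite /th; lra.
pose e := (c + d) / 2.
have [d1 d10 D] := descent Df_cons f_lipschitz eps0_gt0 tau1_gt0 rho_ge0 C_ge1 pmin_gt0 th0.
pose dl' := Num.min d1 (1 / 2).
have [dd1 dd2] : dl' <= d1 /\ dl' <= 1 / 2 by rewrite !ge_min !lexx orbT.
exists dl'; first by rewrite lt_min d10 divr_gt0.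
have run L : forall x m p h K, (K <= L)%N -> scheme x m p h K -> (forall k, (k < K)%N -> h k <= dl') ->
    (forall k, (k <= K)%N -> e < Phi x m p k) ->
    Phi x m p 0%N <= e + th -> Phi x m p K <= e + 2 * th.
  elim: L => [|L IH] x m p h K KL S0 hd above e0.
    by move: KL; rewrite leqn0 => /eqP ->; lra.
  have h1 k : (k < K)%N -> h k <= d1 by move=> kK; exact: le_trans (hd k kK) dd1.
  have h2 k : (k < K)%N -> h k <= 1 / 2 by move=> kK; exact: le_trans (hd k kK) dd2.
  have [T1|T1] := leP (step_time h K) 1.
    by have [] := D _ _ _ _ _ S0 h1 T1; lra.
  have [k [kK k1 k2]] := full_window (scheme_gt0 S0) h2 T1.
  have k0 : (0 < k)%N by rewrite lt0n; apply/eqP => kE; move: k1; rewrite kE step_time0; lra.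
  have Sk : scheme x m p h k by exact: (scheme_sub (k := 0%N) S0 (ltnW kK)).
  have [_ /(_ k1)] := D _ _ _ _ _ Sk (fun i ik => h1 i (ltn_trans ik kK)) k2.
  case=> [desc|[xs [cxs exs _]]].
    have kKE : (k + (K - k))%N = K by exact: subnKC (ltnW kK).
    have S2 := scheme_sub (k := k) (L := (K - k)%N) S0 (eq_leq kKE).
    have := IH _ _ _ _ _ _ S2; rewrite /= addn0 kKE; apply; last by lra.
    + by rewrite leq_subLR; apply: (leq_trans KL); rewrite -addn1 addnC leq_add2r.
    + by move=> i iK; apply: hd; rewrite -[X in (_ < X)%N]kKE ltn_add2l.
    + by move=> i iK; apply: above; rewrite -[X in (_ <= X)%N]kKE leq_add2l.
  exfalso; apply: (gap xs cxs); have := above 0%N (leq0n _).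
  by move: exs; rewrite ler_norml => /andP[a1 a2] a3; apply/andP; split; move: a1 a2 a3 e0; rewrite /e /th; lra.
have main L : forall x m p h K, (K <= L)%N -> scheme x m p h K -> (forall k, (k < K)%N -> h k <= dl') ->
    Phi x m p 0%N <= e -> Phi x m p K <= e + 2 * th.
  elim: L => [|L IH] x m p h K KL S0 hd e0.
    by move: KL; rewrite leqn0 => /eqP ->; lra.
  have [[k [k0 kK ek]]|nk] := pselect (exists k, [/\ (0 < k)%N, (k <= K)%N & Phi x m p k <= e]).
    have kKE : (k + (K - k))%N = K by exact: subnKC.
    have S2 := scheme_sub (k := k) (L := (K - k)%N) S0 (eq_leq kKE).
    have := IH _ _ _ _ _ _ S2; rewrite /= addn0 kKE; apply=> //.
    + by rewrite leq_subLR; apply: (leq_trans KL); rewrite -addn1 addnC leq_add2r.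
    + by move=> i iK; apply: hd; rewrite -[X in (_ < X)%N]kKE ltn_add2l.
  case: K => [|K] in KL S0 hd nk *; first lra.
  have above k : (0 < k)%N -> (k <= K.+1)%N -> e < Phi x m p k.
    by move=> k0 kK; rewrite ltNge; apply/negP => ek; apply: nk; exists k.
  have S1 : scheme x m p h 1 by exact: (scheme_sub (k := 0%N) (L := 1%N) S0).
  have h01 : step_time h 1 <= 1.
    by rewrite /step_time big_ord1; have := hd 0%N isT; lra.
  have [e1 _] := D _ _ _ _ _ S1 (fun i i1 => le_trans (hd i (leq_trans i1 (ltn0Sn K))) dd1) h01.
  have S2 := scheme_sub (k := 1%N) (L := K) S0 (leqnn _).
  have := run K _ _ _ _ K (leqnn K) S2; rewrite /= addn0 add1n; apply.
  + by move=> i iK; apply: hd; rewrite add1n ltnS.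
  + by move=> i iK; apply: above; rewrite ?add1n ?ltnS.
  + by apply: (le_trans e1); rewrite lerD2r.
move=> x m p h K S0 hd e0; have := main K x m p h K (leqnn K) S0 hd.
by rewrite /e /th; lra.
Qed.

Lemma energy_bounded : exists2 B : R, 0 < B & forall x m p : 'rV[R]_n, `|x| <= C -> `|m| <= C -> `|p| <= C ->
  `|energy f tau1 x m p| <= B.
Proof.
have Lex i : exists L : R, 0 < L /\ forall y z, `|y| <= C -> `|z| <= C -> `|f i y - f i z| <= L * `|y - z|.
  have [L L0 LP] := lipschitz_on_compact (f_lipschitz i) (@closed_ball_compact R n C).
  by exists L.
have [L LP] := choice Lex.
have C0 : 0 <= C by exact: le_trans C_ge1.
pose B1 := N%:R^-1 * \sum_i (`|f i 0| + L i * C).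
pose B2 := (2 * tau1)^-1 * \sum_(c < n) C * C ^+ 2.
have B10 : 0 <= B1.
  rewrite mulr_ge0 ?invr_ge0// sumr_ge0// => i _.
  by rewrite addr_ge0// mulr_ge0// ltW// (LP i).1.
have B20 : 0 <= B2.
  by rewrite mulr_ge0 ?invr_ge0 ?mulr_ge0 ?(ltW tau1_gt0)// sumr_ge0// => c _; rewrite mulr_ge0// sqr_ge0.
exists (B1 + B2 + 1); first lra.
move=> x m p xC mC pC; apply: (@le_trans _ _ (B1 + B2)); last by rewrite lerDl.
rewrite (le_trans (ler_normD _ _))// lerD//.
  rewrite normrM ger0_norm ?invr_ge0// ler_wpM2l ?invr_ge0//.
  rewrite (le_trans (ler_norm_sum _ _ _))// ler_sum// => i _.
  have := (LP i).2 x 0 xC; rewrite normr0 subr0 => /(_ C0) h1.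
  have := ler_wpM2l (ltW (LP i).1) xC; have := ler_distD 0 (f i x) (f i 0).
  by have := ler_normD (f i x - f i 0) (f i 0); rewrite subrK; lra.
rewrite normrM ger0_norm ?invr_ge0 ?mulr_ge0 ?(ltW tau1_gt0)//.
rewrite ler_wpM2l ?invr_ge0 ?mulr_ge0 ?(ltW tau1_gt0)//.
rewrite (le_trans (ler_norm_sum _ _ _))// ler_sum// => c _.
rewrite normrM normrX ler_pM//; first exact: le_trans (coord_le_norm _ _) pC.
by rewrite lerXn2r ?nnegrE//; exact: le_trans (coord_le_norm _ _) mC.
Qed.

(** Cut the range of the energy into levels whose spacing is small compared to the
    loss in [descent]. If [lev i] is the lowest level that is ever reached, [trap]
    keeps the energy within one spacing of it from then on, so no later window can
    lose energy, and every pass starts near a critical point. *)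
Lemma eventually_near_critical (theta : R) : 0 < theta -> exists2 delta : R, 0 < delta &
  forall x m p h, (forall K, scheme x m p h K) -> (forall k, h k <= delta) ->
  (forall T : R, exists K, T <= step_time h K) ->
  exists k0, forall k, (k0 <= k)%N -> near_critical f Df theta delta (x k) (Phi x m p k).
Proof.
move=> th0; have [d1 d10 D] := descent Df_cons f_lipschitz eps0_gt0 tau1_gt0 rho_ge0 C_ge1 pmin_gt0 th0.
have [B B0 EB] := energy_bounded.
have q0 : 0 < d1 / 4 by rewrite divr_gt0.
pose lev (i : nat) := - B + i%:R * (d1 / 4).
have [d2 d20 D2] : exists2 d2 : R, 0 < d2 & forall i, (i <= Num.bound (2 * B / (d1 / 4)))%N -> trapped (lev i) (d1 / 4) d2.
  elim: (Num.bound _) => [|M [d2 d20 D2]].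
    have [d d0 Dd] := trap (lev 0%N) q0.
    by exists d => // i; rewrite leqn0 => /eqP ->.
  have [d d0 Dd] := trap (lev M.+1) q0.
  exists (Num.min d d2); first by rewrite lt_min d0.
  have [l1 l2] : Num.min d d2 <= d /\ Num.min d d2 <= d2 by rewrite !ge_min !lexx orbT.
  move=> i; rewrite leq_eqVlt => /predU1P[->|iM]; first exact: trapped_le l1 Dd.
  exact: trapped_le l2 (D2 i iM).
set Mx := Num.bound _ in D2.
have levM : B <= lev Mx.
  have : 2 * B / (d1 / 4) < Mx%:R by apply: archi_boundP; rewrite divr_ge0 ?mulr_ge0// ltW.
  by rewrite ltr_pdivrMr// /lev; lra.
pose delta := Num.min (Num.min d1 d2) (1 / 2).
have [l1 l2 l3] : [/\ delta <= d1, delta <= d2 & delta <= 1 / 2].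
  by rewrite /delta !ge_min !lexx !orbT.
have delta0 : 0 < delta by rewrite !lt_min d10 d20 divr_gt0.
exists delta => // x m p h S0 hd T_oo.
pose en k := Phi x m p k.
have enB k : `|en k| <= B.
  by apply: EB; [exact: (scheme_x (S0 k))|exact: (scheme_m (S0 k))|exact: (scheme_p (S0 k))].
have hgt0 := scheme_gt0 (S0 0%N).
have exi : exists i, `[< exists k, en k <= lev i >].
  exists Mx; apply/asboolP; exists 0%N; apply: le_trans levM.
  by have := enB 0%N; rewrite ler_norml => /andP[].
case: (ex_minnP exi) => i /asboolP[k0 k0i] imin.
have iM : (i <= Mx)%N.
  apply: imin; apply/asboolP; exists 0%N; apply: le_trans levM.
  by have := enB 0%N; rewrite ler_norml => /andP[].
have upper k : (k0 <= k)%N -> en k <= lev i + d1 / 4.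
  move=> k0k; have kE : (k0 + (k - k0))%N = k by exact: subnKC.
  have := D2 i iM _ _ _ _ _ (scheme_sub (k := k0) (S0 k) (eq_leq kE)).
  rewrite /= addn0 kE; apply=> // j _; exact: le_trans (hd _) l2.
have lower k : lev i - d1 / 4 <= en k.
  case E : i => [|i'].
    rewrite /lev mul0r addr0; have := enB k; rewrite ler_norml => /andP[a1 _]; lra.
  apply/ltW; rewrite ltNge; apply/negP => enk.
  have : (i <= i')%N.
    apply: imin; apply/asboolP; exists k; apply: (le_trans enk).
    by rewrite /lev -natr1; lra.
  by rewrite E ltnn.
exists k0 => k k0k.
have hk i0 : 0 < h (k + i0)%N by [].
have [L TL] : exists L, 1 < step_time (fun i => h (k + i)%N) L.
  have [K KP] := T_oo (step_time h k + 2).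
  have kK : (k <= K)%N.
    rewrite leqNgt; apply/negP => /ltnW/(step_time_le hgt0); lra.
  exists (K - k)%N; move: KP; rewrite -{1}(subnKC kK) /step_time big_split_ord/=; lra.
have [w [_ w1 w2]] := full_window hk (fun j _ => le_trans (hd (k + j)%N) l3) TL.
have [_ /(_ w1)] := D _ _ _ _ _ (scheme_sub (k := k) (L := w) (S0 (k + w)%N) (leqnn _))
  (fun j _ => le_trans (hd (k + j)%N) l1) w2.
rewrite addn0; case=> [desc|[xs [c1 c2 c3]]].
  exfalso; have := upper k k0k; have := lower (k + w)%N; move: desc; rewrite /en; lra.
exists xs; split=> // y yk; apply: c3; exact: le_trans yk l1.
Qed.

End Trap.

(** * The preconditioner *)

Section InverseSqrt.
Context {R : realType}.
Variable eps0 : R.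
Hypothesis eps0_gt0 : 0 < eps0.

Definition invsqrt (t : R) : R := (t + eps0) `^ (- 2^-1).

Lemma invsqrt_gt0 t : 0 <= t -> 0 < invsqrt t.
Proof. by move=> t0; rewrite powR_gt0// ltr_wpDl. Qed.

Lemma invsqrt_sqr t : 0 <= t -> invsqrt t ^+ 2 * (t + eps0) = 1.
Proof.
move=> t0; have te : 0 < t + eps0 by rewrite ltr_wpDl.
by rewrite /invsqrt powRN powR12_sqrt ?(ltW te)// exprVn sqr_sqrtr ?(ltW te)// mulVf// gt_eqF.
Qed.

(** Both values [a] of [invsqrt] satisfy [a ^+ 2 * (t + eps0) = 1], so a difference
    of values is a difference of arguments times [a ^+ 2 * b ^+ 2 / (a + b)]. *)
Lemma invsqrt_sub t s : 0 <= t -> 0 <= s ->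
  (invsqrt t - invsqrt s) * (invsqrt t + invsqrt s) = invsqrt t ^+ 2 * invsqrt s ^+ 2 * (s - t).
Proof.
move=> t0 s0; have ht := invsqrt_sqr t0; have hs := invsqrt_sqr s0.
move: ht hs; set a := invsqrt t; set b := invsqrt s => ht hs.
have -> : (a - b) * (a + b) = a ^+ 2 * 1 - b ^+ 2 * 1 by ring.
by rewrite -{1}hs -{1}ht; ring.
Qed.

Lemma invsqrt_le t s : 0 <= s -> s <= t -> invsqrt t <= invsqrt s.
Proof.
move=> s0 st; have t0 := le_trans s0 st.
have a0 := invsqrt_gt0 t0; have b0 := invsqrt_gt0 s0.
rewrite -subr_ge0 -(pmulr_lge0 _ (addr_gt0 b0 a0)) invsqrt_sub//.
by rewrite mulr_ge0 ?subr_ge0// mulr_ge0// sqr_ge0.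
Qed.

Lemma invsqrt_max t : 0 <= t -> invsqrt t <= invsqrt 0.
Proof. exact: invsqrt_le. Qed.

Lemma invsqrt_lip t s : 0 <= t -> 0 <= s ->
  `|invsqrt t - invsqrt s| <= invsqrt 0 ^+ 3 * `|t - s|.
Proof.
move=> t0 s0; have a0 := invsqrt_gt0 t0; have b0 := invsqrt_gt0 s0.
have aM := invsqrt_max t0; have bM := invsqrt_max s0.
have E := congr1 Num.norm (invsqrt_sub t0 s0).
have ab0 : 0 < invsqrt t + invsqrt s by rewrite addr_gt0.
have ab2 : 0 <= invsqrt t ^+ 2 * invsqrt s ^+ 2 by rewrite mulr_ge0 ?sqr_ge0.
rewrite normrM (gtr0_norm ab0) normrM (ger0_norm ab2) (distrC s t) in E.
rewrite -(ler_pM2r ab0) E [leRHS]mulrAC ler_wpM2r//.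
have h1 : invsqrt t ^+ 2 * invsqrt s ^+ 2 = (invsqrt t * invsqrt s ^+ 2) * invsqrt t by ring.
rewrite h1; apply: ler_pM => //; [by rewrite mulr_ge0 ?sqr_ge0// ltW|exact: ltW| |by rewrite lerDl ltW].
rewrite [leRHS]exprS; apply: ler_pM => //; rewrite ?sqr_ge0 ?(ltW a0)//.
by rewrite lerXn2r ?nnegrE// ltW// invsqrt_gt0.
Qed.

(** The discrete form of the fact that along [u' = - u] the function
    [p = (u + eps0)^(-1/2)] satisfies [p' = p * (1 - eps0 * p ^+ 2) / 2]; the last
    term is of second order in the step [w]. *)
Lemma invsqrt_growth t s w : 0 <= t -> 0 <= s -> 0 <= w -> (1 - w) * t <= s ->
  invsqrt s - invsqrt t <= w / 2 * (invsqrt t * (1 - eps0 * invsqrt t ^+ 2)) + w * `|invsqrt s - invsqrt t|.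
Proof.
move=> t0 s0 w0 ts; have a0 := invsqrt_gt0 t0; have b0 := invsqrt_gt0 s0.
have E := invsqrt_sub s0 t0; have H := invsqrt_sqr t0.
move: a0 b0 E H; set a := invsqrt t; set b := invsqrt s => a0 b0 E H.
have at0 : 0 <= a ^+ 2 * t by rewrite mulr_ge0 ?sqr_ge0.
have ea0 : 0 <= eps0 * a ^+ 2 by rewrite mulr_ge0 ?sqr_ge0// ltW.
have aE : 1 - eps0 * a ^+ 2 = a ^+ 2 * t by rewrite -H; ring.
rewrite aE; have at1 : a ^+ 2 * t <= 1 by lra.
have [ba|/ltW ab] := leP b a.
  apply: (@le_trans _ _ 0); first by rewrite subr_le0.
  by rewrite addr_ge0 ?mulr_ge0// ?divr_ge0// ltW.
rewrite ger0_norm ?subr_ge0//.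
have ab0 : 0 < b + a by rewrite addr_gt0.
rewrite -(ler_pM2r ab0) E.
have h1 : b ^+ 2 * a ^+ 2 * (t - s) <= b ^+ 2 * (w * (a ^+ 2 * t)).
  have -> : b ^+ 2 * (w * (a ^+ 2 * t)) = b ^+ 2 * a ^+ 2 * (w * t) by ring.
  by rewrite ler_wpM2l ?mulr_ge0 ?sqr_ge0//; lra.
apply: (le_trans h1).
have h2 : (a / 2 * (a ^+ 2 * t) + (b - a)) * (b + a) >= b ^+ 2 * (a ^+ 2 * t).
  have h3 : (b - a) * (a ^+ 2 * t) <= (b - a) * 1 by rewrite ler_wpM2l ?subr_ge0.
  apply: (@le_trans _ _ ((a / 2 * (a ^+ 2 * t) + (b - a) * (a ^+ 2 * t)) * (b + a))); last first.
    by rewrite ler_wpM2r ?(ltW ab0)//; lra.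
  rewrite -mulrDl [leRHS]mulrAC ler_wpM2r//.
  have := mulr_ge0 (ltW b0) (_ : 0 <= b - a); rewrite subr_ge0 => /(_ ab).
  by have := sqr_ge0 a; have := mulr_ge0 (ltW a0) (ltW b0); nra.
have := ler_wpM2l w0 h2; lra.
Qed.

End InverseSqrt.

(** * One pass of the algorithm *)

Section Block.
Context {R : realType} {n N : nat}.
Variables (Df : 'I_N -> 'rV[R]_n -> set 'rV[R]_n) (V : 'rV[R]_n * 'rV[R]_n -> set 'rV[R]_n).
Variables (eps0 tau1 tau2 rho r G Mm W Kv : R).
Hypotheses (N_gt0 : (0 < N)%N).
Hypotheses (eps0_gt0 : 0 < eps0) (tau1_gt0 : 0 < tau1) (tau2_gt0 : 0 < tau2)
    (tau12 : tau2 <= 4 * tau1) (rho_ge0 : 0 <= rho).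
Hypothesis G_ge0 : 0 <= G.
Hypothesis W_ge0 : 0 <= W.
Hypothesis G_bound : forall i y g, `|y| <= r + 1 -> Df i y g -> `|g| <= G.
Hypothesis W_bound : forall y mu w, `|y| <= r + 1 -> `|mu| <= Mm -> V (y, mu) w -> `|w| <= W.
Hypothesis V_nonneg : forall z, V z `<=` nonneg_orthant.
Hypotheses (GM : G <= Mm) (WK : W <= Kv).

(** Locked, since unification would otherwise unfold [proj_nonneg]. *)
Definition precond : 'rV[R]_n -> 'rV[R]_n :=
  locked (fun v => map_mx (invsqrt eps0) (proj_nonneg v)).

Lemma precondE v c : precond v 0 c = invsqrt eps0 (Num.max 0 (v 0 c)).
Proof. by rewrite /precond -lock proj_nonnegE !mxE. Qed.

(** Upper bound of the preconditioner, attained at second moment zero. *)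
Definition pmax := invsqrt eps0 0.
Definition speed := pmax * (Mm + rho * G).

Lemma pmax_gt0 : 0 < pmax. Proof. exact: invsqrt_gt0. Qed.

Lemma precond_gt0 v c : 0 < precond v 0 c.
Proof. by rewrite precondE invsqrt_gt0// le_max lexx. Qed.

Lemma precond_le v c : precond v 0 c <= pmax.
Proof. by rewrite precondE invsqrt_max// le_max lexx. Qed.

Lemma precond_norm v : `|precond v| <= pmax.
Proof.
apply: norm_leP; first exact/ltW/pmax_gt0.
by move=> c; rewrite gtr0_norm ?precond_gt0// precond_le.
Qed.

Lemma precond_min v c : `|v| <= Kv -> invsqrt eps0 Kv <= precond v 0 c.
Proof.
move=> vK; rewrite precondE invsqrt_le ?le_max ?lexx// ge_max (le_trans W_ge0 WK)/=.
exact: le_trans (ler_norm _) (le_trans (coord_le_norm _ _) vK).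
Qed.

Variables (eta : R) (idx : nat -> 'I_N) (x m v g : nat -> 'rV[R]_n).
Hypothesis eta_gt0 : 0 < eta.
Hypothesis eta1 : tau1 * eta <= 1.
Hypothesis eta2 : tau2 * eta <= 1.
Hypothesis eta3 : N%:R * eta * speed <= 1.
Hypothesis idx_onto : forall i : 'I_N, exists2 k, (k < N)%N & idx k = i.
Hypotheses (x0 : `|x 0%N| <= r) (m0 : `|m 0%N| <= Mm) (v0 : `|v 0%N| <= Kv).
Hypothesis step : forall k, (k < N)%N ->
  [/\ Df (idx k) (x k) (g k),
          m k.+1 = m k + (tau1 * eta) *: (g k - m k),
          [set v k + (tau2 * eta) *: (w - v k) | w in V (x k, m k.+1)]
            (v k.+1) &
          x k.+1 = x k - eta *:
            map2_mx *%R (precond (v k.+1)) (m k.+1 + rho *: g k)].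

Notation h := (N%:R * eta).

Let h_gt0 : 0 < h. Proof. by rewrite mulr_gt0 ?ltr0n. Qed.
Let Mm_ge0 : 0 <= Mm. Proof. exact: le_trans GM. Qed.
Let Kv_ge0 : 0 <= Kv. Proof. exact: le_trans WK. Qed.
Let pmax0 := pmax_gt0.
Let speed_ge0 : 0 <= speed.
Proof. by rewrite mulr_ge0 ?(ltW pmax0)// addr_ge0// mulr_ge0. Qed.

Let step_le k : (k <= N)%N -> k%:R * eta <= h.
Proof. by move=> kN; rewrite ler_pM2r// ler_nat. Qed.

Lemma relax_norm (a b : 'rV[R]_n) (t K : R) : 0 <= t -> t <= 1 -> `|a| <= K -> `|b| <= K ->
  `|a + t *: (b - a)| <= K.
Proof.
move=> t0 t1 aK bK; have -> : a + t *: (b - a) = (1 - t) *: a + t *: b.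
  by apply/rowP => c; rewrite !mxE; ring.
rewrite (le_trans (ler_normD _ _))// !normrZ (ger0_norm t0) ger0_norm ?subr_ge0//.
have := ler_wpM2l t0 bK; have := @ler_wpM2l _ (1 - t) _ _ _ aK; rewrite subr_ge0 => /(_ t1); lra.
Qed.

Let move_norm (a b : 'rV[R]_n) (t A B : R) : 0 <= t -> `|a| <= A -> `|b| <= B ->
  `|(a + t *: (b - a)) - a| <= t * (B + A).
Proof.
move=> t0 aA bB; rewrite addrC addKr normrZ ger0_norm// ler_wpM2l//.
by rewrite (le_trans (ler_normB _ _))// lerD.
Qed.

(** The moments are convex combinations of bounded vectors as long as [x] stays in
    the ball of radius [r + 1], and it cannot leave this ball during one pass because
    the step sizes are small. *)
Lemma block_bounds k : (k <= N)%N ->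
  [/\ `|x k - x 0%N| <= k%:R * eta * speed, `|m k| <= Mm & `|v k| <= Kv].
Proof.
elim: k => [|k IH] kN; first by rewrite subrr normr0 mul0r mul0r.
have [xk mk vk] := IH (ltnW kN); have [gD mE [w wV vE] xE] := step kN.
have xr : `|x k| <= r + 1.
  have := ler_normD (x k - x 0%N) (x 0%N); rewrite subrK.
  by have := ler_wpM2r speed_ge0 (step_le (ltnW kN)); move: xk eta3 x0; lra.
have gG := G_bound xr gD.
have t1 : 0 <= tau1 * eta by rewrite mulr_ge0// ltW.
have t2 : 0 <= tau2 * eta by rewrite mulr_ge0// ltW.
have mk1 : `|m k.+1| <= Mm by rewrite mE relax_norm// (le_trans gG).
have wW := W_bound xr mk1 wV.
split=> //; last by rewrite -vE relax_norm// (le_trans wW).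
have dx : `|x k.+1 - x k| <= eta * speed.
  rewrite xE addrAC subrr sub0r normrN normrZ (gtr0_norm eta_gt0) ler_wpM2l ?(ltW eta_gt0)//.
  apply: norm_leP => // c; move: (precond_norm (v k.+1)).
  set q := precond _ => qM; rewrite mxE [fun_of_matrix (_ + _) _ _]mxE [fun_of_matrix (_ *: _) _ _]mxE normrM ler_pM//.
    by apply: le_trans (coord_le_norm _ _) qM.
  have := coord_le_norm (m k.+1) c; have := coord_le_norm (g k) c.
  move=> h1 h2; rewrite (le_trans (ler_normD _ _))// normrM (ger0_norm rho_ge0).
  by have := ler_wpM2l rho_ge0 (le_trans h1 gG); lra.
have := ler_distD (x k) (x k.+1) (x 0%N); rewrite -natr1 !mulrDl mul1r; lra.
Qed.

Lemma block_x k : (k <= N)%N -> `|x k - x 0%N| <= speed * h.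
Proof.
move=> kN; have [xk _ _] := block_bounds kN; rewrite mulrC.
exact: le_trans xk (ler_wpM2r speed_ge0 (step_le kN)).
Qed.

Lemma block_region k : (k <= N)%N -> `|x k| <= r + 1.
Proof.
move=> kN; have := ler_normD (x k - x 0%N) (x 0%N); rewrite subrK.
by have := block_x kN; have := x0; move: eta3; rewrite mulrC; lra.
Qed.

Let g_bound k : (k < N)%N -> `|g k| <= G.
Proof. by move=> kN; have [gD _ _ _] := step kN; exact: G_bound (block_region (ltnW kN)) gD. Qed.

Definition mspeed := tau1 * (G + Mm).
Definition pspeed := pmax ^+ 3 * (tau2 * (W + Kv)).

Let mspeed_ge0 : 0 <= mspeed.
Proof. by rewrite mulr_ge0 ?(ltW tau1_gt0)// addr_ge0. Qed.
Let pspeed_ge0 : 0 <= pspeed.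
Proof. by rewrite mulr_ge0 ?exprn_ge0 ?(ltW pmax0)// mulr_ge0 ?(ltW tau2_gt0)// addr_ge0. Qed.

Let drift (a : nat -> R) s : 0 <= s -> (forall k, (k < N)%N -> `|a k.+1 - a k| <= eta * s) ->
  forall k, (k <= N)%N -> `|a k - a 0%N| <= s * h.
Proof.
move=> s0 da k kN; apply: (@le_trans _ _ (s * (k%:R * eta))); last by rewrite ler_wpM2l// step_le.
elim: k kN => [|k IH] kN; first by rewrite subrr normr0 mul0r mulr0.
have := IH (ltnW kN); have := da k kN; have := ler_distD (a k) (a k.+1) (a 0%N).
rewrite -natr1 mulrDl mul1r; lra.
Qed.

Let m_step k c : (k < N)%N -> `|m k.+1 0 c - m k 0 c| <= eta * mspeed.
Proof.
move=> kN; have [_ mE _ _] := step kN; have [_ mk _] := block_bounds (ltnW kN).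
have t1 : 0 <= tau1 * eta by rewrite mulr_ge0// ltW.
have := move_norm t1 mk (g_bound kN); rewrite -mE => /(le_trans (coord_le_norm _ c)).
by rewrite !mxE /mspeed mulrA [eta * _]mulrC.
Qed.

Let u k c := Num.max 0 (v k 0 c).

Let u_ge0 k c : 0 <= u k c. Proof. by rewrite le_max lexx. Qed.

Let v_step k c : (k < N)%N ->
  `|u k.+1 c - u k c| <= tau2 * eta * (W + Kv) /\ (1 - tau2 * eta) * u k c <= u k.+1 c.
Proof.
move=> kN; have [_ _ [w wV vE] _] := step kN; have [_ _ vk] := block_bounds (ltnW kN).
have [_ mk _] := block_bounds kN.
have t2 : 0 <= tau2 * eta by rewrite mulr_ge0// ltW.
have wW := W_bound (block_region (ltnW kN)) mk wV.
split.
  have := move_norm t2 vk wW; rewrite vE => /(le_trans (coord_le_norm _ c)); rewrite !mxE => vv.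
  apply: le_trans vv; rewrite /u !maxEle.
  by case: (leP 0 (v k.+1 0 c)) => h1; case: (leP 0 (v k 0 c)) => h2; rewrite ?subrr ?subr0 ?sub0r ?normrN ?normr0//;
    [rewrite !ger0_norm; lra|rewrite distrC !ger0_norm; lra].
have w0 := V_nonneg wV c.
have vcE : v k.+1 0 c = (1 - tau2 * eta) * v k 0 c + tau2 * eta * w 0 c by rewrite -vE !mxE; ring.
have tw : 0 <= tau2 * eta * w 0 c by rewrite mulr_ge0.
have t1 : 0 <= 1 - tau2 * eta by rewrite subr_ge0.
rewrite [u k.+1 c]/u le_max vcE /u; have [h1|h1] := leP 0 (v k 0 c).
  by apply/orP; right; rewrite lerDl.
by rewrite mulr0 lexx.
Qed.

Let pE k c : precond (v k) 0 c = invsqrt eps0 (u k c).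
Proof. exact: precondE. Qed.

Let p_step k c : (k < N)%N -> `|precond (v k.+1) 0 c - precond (v k) 0 c| <= eta * pspeed.
Proof.
move=> kN; rewrite (pE k.+1 c) (pE k c).
apply: (le_trans (invsqrt_lip eps0_gt0 (u_ge0 k.+1 c) (u_ge0 k c))).
have -> : eta * pspeed = pmax ^+ 3 * (tau2 * eta * (W + Kv)) by rewrite /pspeed; ring.
by rewrite ler_wpM2l ?exprn_ge0 ?(ltW pmax0)//; have [] := v_step c kN.
Qed.

Let block_m k c : (k <= N)%N -> `|m k 0 c - m 0%N 0 c| <= mspeed * h.
Proof. by move=> kN; apply: (drift (a := fun k => m k 0 c)) => // i iN; exact: m_step. Qed.

Let block_p k c : (k <= N)%N -> `|precond (v k) 0 c - precond (v 0%N) 0 c| <= pspeed * h.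
Proof. by move=> kN; apply: (drift (a := fun k => precond (v k) 0 c)) => // i iN; exact: p_step. Qed.

Lemma block_lip : [/\ `|x N - x 0%N| <= speed * h, `|m N - m 0%N| <= mspeed * h &
  `|precond (v N) - precond (v 0%N)| <= pspeed * h].
Proof.
split; first exact: block_x.
- by apply: norm_leP => [|c]; [rewrite mulr_ge0 ?(ltW h_gt0)|have := block_m c (leqnn N); rewrite !mxE].
- apply: norm_leP => [|c]; first by rewrite mulr_ge0 ?(ltW h_gt0).
  have := block_p c (leqnn N); set a := precond _; set b := precond _.
  by rewrite [(a - b) 0 c]mxE [(- b) 0 c]mxE.
Qed.

Let gbar := N%:R^-1 *: \sum_(k < N) g k.

Let gbarE c : N%:R * gbar 0 c = \sum_(k < N) g k 0 c.
Proof. by rewrite mxE mulrA mulfV ?mul1r ?summxE// pnatr_eq0 -lt0n. Qed.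

Lemma block_gbar : `|gbar| <= G.
Proof.
have N0 : 0 < N%:R :> R by rewrite ltr0n.
rewrite normrZ ger0_norm ?invr_ge0// ler_pdivrMl// (le_trans (ler_norm_sum _ _ _))//.
by rewrite (le_trans (ler_sum _ (fun k _ => g_bound (ltn_ord k))))// sumr_const card_ord mulr_natl.
Qed.

Let block_sum (a F : nat -> R) (b e : R) :
  (forall k, (k < N)%N -> `|a k.+1 - a k - eta * F k| <= eta * e) ->
  `|a N - a 0%N - eta * \sum_(k < N) F k| <= e * h.
Proof.
move=> H; suff H2 k : (k <= N)%N -> `|a k - a 0%N - eta * \sum_(i < k) F i| <= k%:R * (eta * e).
  by have := H2 N (leqnn N); rewrite mulrA [e * _]mulrC.
elim: k => [|k IH] kN; first by rewrite big_ord0 subrr mulr0 subr0 normr0 mul0r.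
have := IH (ltnW kN); have := H k kN; rewrite big_ord_recr/= -natr1.
move=> h1 h2; have := ler_normD (a k.+1 - a k - eta * F k) (a k - a 0%N - eta * \sum_(i < k) F i).
have -> : (a k.+1 - a k - eta * F k) + (a k - a 0%N - eta * \sum_(i < k) F i) =
  a k.+1 - a 0%N - eta * (\sum_(i < k) F i + F k) by ring.
lra.
Qed.

Lemma block_m_step c : `|m N 0 c - m 0%N 0 c - tau1 * h * (gbar 0 c - m 0%N 0 c)| <= tau1 * mspeed * h ^+ 2.
Proof.
have -> : tau1 * h * (gbar 0 c - m 0%N 0 c) = eta * \sum_(k < N) (tau1 * (g k 0 c - m 0%N 0 c)).
  rewrite -mulr_sumr big_split/= sumr_const card_ord -[(- m 0%N 0 c) *+ N]mulr_natl -gbarE; ring.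
rewrite (_ : tau1 * mspeed * h ^+ 2 = (tau1 * (mspeed * h)) * h); last by ring.
apply: (block_sum (a := fun k => m k 0 c) (F := fun k => tau1 * (g k 0 c - m 0%N 0 c)) 0) => k kN.
have [_ mE _ _] := step kN; rewrite {1}mE !mxE.
have -> : m k 0 c + tau1 * eta * (g k 0 c - m k 0 c) - m k 0 c - eta * (tau1 * (g k 0 c - m 0%N 0 c)) =
  eta * tau1 * - (m k 0 c - m 0%N 0 c) by ring.
rewrite normrM normrN (ger0_norm (mulr_ge0 (ltW eta_gt0) (ltW tau1_gt0))) mulrA.
by rewrite ler_wpM2l ?mulr_ge0 ?(ltW eta_gt0) ?(ltW tau1_gt0)// block_m// ltnW.
Qed.

Definition xerr := pspeed * (Mm + rho * G) + pmax * mspeed.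

Lemma block_x_step c : `|x N 0 c - x 0%N 0 c + h * (precond (v 0%N) 0 c * (m 0%N 0 c + rho * gbar 0 c))| <=
  xerr * h ^+ 2.
Proof.
set p0 := precond (v 0%N) 0 c.
have -> : h * (p0 * (m 0%N 0 c + rho * gbar 0 c)) = - (eta * \sum_(k < N) (- (p0 * (m 0%N 0 c + rho * g k 0 c)))).
  rewrite sumrN -mulr_sumr big_split/= sumr_const card_ord -[(m 0%N 0 c) *+ N]mulr_natl -mulr_sumr -gbarE; ring.
rewrite (_ : xerr * h ^+ 2 = (xerr * h) * h); last by ring.
apply: (block_sum (a := fun k => x k 0 c) (F := fun k => - (p0 * (m 0%N 0 c + rho * g k 0 c))) 0) => k kN.
have [_ _ _ xE] := step kN; rewrite {1}xE.
have -> : (x k - eta *: map2_mx *%R (precond (v k.+1)) (m k.+1 + rho *: g k)) 0 c =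
  x k 0 c - eta * (precond (v k.+1) 0 c * (m k.+1 0 c + rho * g k 0 c)).
  by rewrite !mxE.
set p1 := precond (v k.+1) 0 c.
have -> : x k 0 c - eta * (p1 * (m k.+1 0 c + rho * g k 0 c)) - x k 0 c - eta * - (p0 * (m 0%N 0 c + rho * g k 0 c)) =
  - (eta * ((p1 - p0) * (m k.+1 0 c + rho * g k 0 c) + p0 * (m k.+1 0 c - m 0%N 0 c))) by ring.
rewrite normrN normrM (gtr0_norm eta_gt0) ler_wpM2l ?(ltW eta_gt0)//.
rewrite (le_trans (ler_normD _ _))// /xerr [leRHS]mulrDl lerD//.
  rewrite normrM [leRHS]mulrAC ler_pM//; first exact: block_p.
  have [_ mk _] := block_bounds kN.
  rewrite (le_trans (ler_normD _ _))// normrM (ger0_norm rho_ge0).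
  rewrite lerD ?(le_trans (coord_le_norm _ _) mk)// ler_wpM2l//.
  exact: le_trans (coord_le_norm _ _) (g_bound kN).
rewrite normrM -[leRHS]mulrA ler_pM//; last exact: block_m.
by rewrite gtr0_norm ?precond_gt0// precond_le.
Qed.

Definition perr := 8 * tau1 * pspeed + tau2 * pspeed.

(** The second moment decreases at most by the factor [1 - tau2 * eta], since the
    values of [V] are nonnegative; [invsqrt_growth] with [tau2 <= 4 * tau1] turns this
    into the bound required of a scheme. *)
Lemma block_p_step c : precond (v N) 0 c - precond (v 0%N) 0 c <=
  h * (2 * tau1 * (precond (v 0%N) 0 c * (1 - eps0 * precond (v 0%N) 0 c ^+ 2))) + perr * h ^+ 2.
Proof.
pose psi (a : R) := a * (1 - eps0 * a ^+ 2).
pose p k := precond (v k) 0 c.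
have p_gt0 k : 0 < p k by exact: precond_gt0.
have psq : eps0 * pmax ^+ 2 = 1.
  by have := invsqrt_sqr eps0_gt0 (lexx 0); rewrite add0r mulrC.
have p_sq k : eps0 * p k ^+ 2 <= 1.
  rewrite -psq ler_wpM2l ?(ltW eps0_gt0)// lerXn2r ?nnegrE ?(ltW (p_gt0 k)) ?(ltW pmax0)//.
  exact: precond_le.
have psi_ge0 k : 0 <= psi (p k) by rewrite mulr_ge0 ?subr_ge0 ?(ltW (p_gt0 k)).
have psi_lip k : (k <= N)%N -> psi (p k) - psi (p 0%N) <= 4 * (pspeed * h).
  move=> kN; have -> : psi (p k) - psi (p 0%N) =
     (p k - p 0%N) * (1 - (eps0 * p k ^+ 2 + eps0 * (p k * p 0%N) + eps0 * p 0%N ^+ 2)) by rewrite /psi; ring.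
  rewrite (le_trans (ler_norm _))// normrM mulrC ler_pM//; last exact: block_p.
  have pp : 0 <= eps0 * (p k * p 0%N) <= 1.
    rewrite mulr_ge0 ?mulr_ge0 ?(ltW (p_gt0 _)) ?(ltW eps0_gt0)//= -psq ler_wpM2l ?(ltW eps0_gt0)//.
    by rewrite expr2 ler_pM ?(ltW (p_gt0 _))// precond_le.
  have q k' : 0 <= eps0 * p k' ^+ 2 by rewrite mulr_ge0 ?sqr_ge0 ?(ltW eps0_gt0).
  move: pp => /andP[pp1 pp2]; rewrite ler_norml; apply/andP.
  by split; have := q k; have := q 0%N; have := p_sq k; have := p_sq 0%N; lra.
have t2 : 0 <= tau2 * eta by rewrite mulr_ge0// ltW.
have inc k : (k < N)%N -> p k.+1 - p k <= eta * (2 * tau1 * psi (p 0%N) + perr * h).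
  move=> kN; have := invsqrt_growth eps0_gt0 (u_ge0 k c) (u_ge0 k.+1 c) t2 (v_step c kN).2.
  rewrite -!pE -/(p k) -/(p k.+1) -/(psi (p k)) => h1; apply: (le_trans h1).
  have h2 : tau2 * eta / 2 * psi (p k) <= eta * (2 * tau1) * psi (p k).
    rewrite ler_wpM2r//; have := ler_wpM2l (ltW eta_gt0) tau12; lra.
  have h3 : eta * (2 * tau1) * psi (p k) <= eta * (2 * tau1) * (psi (p 0%N) + 4 * (pspeed * h)).
    rewrite ler_wpM2l ?mulr_ge0 ?(ltW eta_gt0) ?(ltW tau1_gt0)//.
    by have := psi_lip k (ltnW kN); lra.
  have eh : eta <= h by have := step_le N_gt0; rewrite mul1r.
  have h4 : tau2 * eta * `|p k.+1 - p k| <= tau2 * eta * (pspeed * h).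
    rewrite ler_wpM2l// (le_trans (p_step c kN))// mulrC ler_wpM2l//.
  have -> : eta * (2 * tau1 * psi (p 0%N) + perr * h) =
    eta * (2 * tau1) * (psi (p 0%N) + 4 * (pspeed * h)) + tau2 * eta * (pspeed * h) by rewrite /perr; ring.
  lra.
have tele k : (k <= N)%N -> p k - p 0%N <= k%:R * (eta * (2 * tau1 * psi (p 0%N) + perr * h)).
  elim: k => [|k IH] kN; first by rewrite subrr mul0r.
  by have := IH (ltnW kN); have := inc k kN; rewrite -natr1 mulrDl mul1r; lra.
apply: (le_trans (tele N (leqnn N))); rewrite mulrA -/(p 0%N) -/(psi (p 0%N)); lra.
Qed.

(** Over a block every index is used exactly once, so the steps of a block sum up
    to one element of each field. *)
Lemma block_reindex : exists y gg : 'I_N -> 'rV[R]_n,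
  [/\ forall i, Df i (y i) (gg i), forall i, `|y i - x 0%N| <= speed * h &
      \sum_(k < N) g k = \sum_i gg i].
Proof.
have ex i : exists k : 'I_N, idx k = i.
  by have [k kN kE] := idx_onto i; exists (Ordinal kN).
have [s sE] := choice ex.
have s_inj : injective s by move=> i j sij; rewrite -(sE i) -(sE j) sij.
exists (fun i => x (s i)), (fun i => g (s i)); split=> [i|i|].
- by have [+ _ _ _] := step (ltn_ord (s i)); rewrite sE.
- by apply: block_x; exact: ltnW.
- by rewrite (reindex_inj s_inj).
Qed.

End Block.

(** * From the algorithm to schemes *)

Section Iteration.
Context {R : realType} {n N : nat}.
Variables (Df : 'I_N -> 'rV[R]_n -> set 'rV[R]_n) (V : 'rV[R]_n * 'rV[R]_n -> set 'rV[R]_n).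
Variables (eps0 tau1 tau2 rho r G Mm W Kv : R).
Hypotheses (N_gt0 : (0 < N)%N).
Hypotheses (eps0_gt0 : 0 < eps0) (tau1_gt0 : 0 < tau1) (tau2_gt0 : 0 < tau2)
    (tau12 : tau2 <= 4 * tau1) (rho_ge0 : 0 <= rho).
Hypotheses (r_ge0 : 0 <= r) (G_ge0 : 0 <= G) (W_ge0 : 0 <= W).
Hypothesis G_bound : forall i y g, `|y| <= r + 1 -> Df i y g -> `|g| <= G.
Hypothesis W_bound : forall y mu w, `|y| <= r + 1 -> `|mu| <= Mm -> V (y, mu) w -> `|w| <= W.
Hypothesis V_nonneg : forall z, V z `<=` nonneg_orthant.
Hypotheses (GM : G <= Mm) (WK : W <= Kv).

Notation sx := (speed eps0 rho G Mm).
Notation sm := (mspeed tau1 G Mm).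
Notation sp := (pspeed eps0 tau2 W Kv).
Notation ex := (xerr eps0 tau1 tau2 rho G Mm W Kv).
Notation ep := (perr eps0 tau1 tau2 W Kv).

(** A single constant above all those of the analysis of one pass. *)
Definition block_const : R :=
  1 + (r + 1) + Mm + pmax eps0 + sx + sm + sp + G + tau1 * sm + ex + ep.

Lemma block_constP : [/\ 1 <= block_const, r + 1 <= block_const, Mm <= block_const & pmax eps0 <= block_const] /\
  [/\ 0 <= sx, sx <= block_const, sm <= block_const & sp <= block_const] /\
  [/\ G <= block_const, tau1 * sm <= block_const, ex <= block_const & ep <= block_const].
Proof.
have p0 := pmax_gt0 eps0_gt0; have M0 : 0 <= Mm := le_trans G_ge0 GM.
have K0 : 0 <= Kv := le_trans W_ge0 WK.
have a1 : 0 <= sx by rewrite mulr_ge0 ?(ltW p0)// addr_ge0// mulr_ge0.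
have a2 : 0 <= sm by rewrite mulr_ge0 ?(ltW tau1_gt0)// addr_ge0.
have a3 : 0 <= sp by rewrite mulr_ge0 ?exprn_ge0 ?(ltW p0)// mulr_ge0 ?(ltW tau2_gt0)// addr_ge0.
have a4 : 0 <= tau1 * sm by rewrite mulr_ge0 ?(ltW tau1_gt0).
have a5 : 0 <= ex by rewrite addr_ge0// mulr_ge0 ?(ltW p0)// addr_ge0// mulr_ge0.
have a6 : 0 <= ep by rewrite addr_ge0// mulr_ge0// ?mulr_ge0// ?ltW.
rewrite /block_const; move: r_ge0 G_ge0 p0 M0 a1 a2 a3 a4 a5 a6.
move: (sx) (sm) (sp) (ex) (ep) (pmax eps0) (tau1 * _) => b1 b2 b3 b4 b5 b6 b7 *.
by split; [split; lra|split; split; lra].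
Qed.

Variables (eta : nat -> R) (idx : nat -> 'I_N) (x m v g : nat -> 'rV[R]_n).
Hypothesis eta_gt0 : forall k, 0 < eta k.
Hypothesis eta_block : forall k1 k2 : nat, (k1 %/ N)%N = (k2 %/ N)%N -> eta k1 = eta k2.
Hypothesis eta1 : forall k, tau1 * eta k <= 1.
Hypothesis eta2 : forall k, tau2 * eta k <= 1.
Hypothesis eta3 : forall k, N%:R * eta k * sx <= 1.
Hypothesis idx_onto : forall j : nat,
      [set idx k | k in [set k | (j * N <= k < j.+1 * N)%N]] = setT.
Hypothesis step : forall k,
  [/\ Df (idx k) (x k) (g k),
          m k.+1 = m k + (tau1 * eta k) *: (g k - m k),
          [set v k + (tau2 * eta k) *: (w - v k) | w in V (x k, m k.+1)]
            (v k.+1) &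
          x k.+1 = x k - eta k *:
            map2_mx *%R (precond eps0 (v k.+1)) (m k.+1 + rho *: g k)].

Notation bx k := (x (k * N)%N).
Notation bm k := (m (k * N)%N).
Notation bv k := (v (k * N)%N).
Notation bp k := (precond eps0 (v (k * N)%N)).
Notation bh k := (N%:R * eta (k * N)%N).

(** The bounds under which a pass can be analysed; they are propagated from one pass
    to the next by the trap lemma. *)
Definition good k := [/\ `|bx k| <= r, `|bm k| <= Mm & `|bv k| <= Kv].

Lemma eta_const k i : (i < N)%N -> eta (k * N + i)%N = eta (k * N)%N.
Proof. by move=> iN; apply: eta_block; rewrite divnMDl// divn_small// addn0 mulnK. Qed.

Section OneBlock.
Variable k : nat.
Hypothesis gk : good k.

Let shift (a : nat -> 'rV[R]_n) i := a (k * N + i)%N.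
Let gx : `|shift x 0%N| <= r. Proof. by rewrite /shift addn0; case: gk. Qed.
Let gm : `|shift m 0%N| <= Mm. Proof. by rewrite /shift addn0; case: gk. Qed.
Let gv : `|shift v 0%N| <= Kv. Proof. by rewrite /shift addn0; case: gk. Qed.

Let bstep i : (i < N)%N ->
  [/\ Df (idx (k * N + i)) (shift x i) (shift g i),
          shift m i.+1 = shift m i + (tau1 * eta (k * N)%N) *: (shift g i - shift m i),
          [set shift v i + (tau2 * eta (k * N)%N) *: (w - shift v i) | w in V (shift x i, shift m i.+1)]
            (shift v i.+1) &
          shift x i.+1 = shift x i - eta (k * N)%N *:
            map2_mx *%R (precond eps0 (shift v i.+1)) (shift m i.+1 + rho *: shift g i)].
Proof. by move=> iN; rewrite -(eta_const k iN) /shift addnS; exact: step. Qed.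

Let shift0 a : shift a 0%N = a (k * N)%N. Proof. by rewrite /shift addn0. Qed.
Let shiftN a : shift a N = a (k.+1 * N)%N. Proof. by rewrite /shift mulSnr. Qed.

Let onto i : exists2 j, (j < N)%N & idx (k * N + j) = i.
Proof.
have : [set idx k0 | k0 in [set k0 | (k * N <= k0 < k.+1 * N)%N]] i by rewrite idx_onto.
case=> j /= /andP[j1 j2] ji; exists (j - k * N)%N; last by rewrite subnKC.
by rewrite ltn_subLR// -mulSnr.
Qed.

Lemma block_end : [/\ `|bx k.+1| <= r + 1, `|bm k.+1| <= Mm & `|bv k.+1| <= Kv].
Proof.
have [_ h2 h3] := block_bounds eps0_gt0 tau1_gt0 tau2_gt0 rho_ge0 G_ge0 G_bound W_bound GM WK
  (eta_gt0 _) (eta1 _) (eta2 _) (eta3 _) gx gm gv bstep (leqnn N).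
have h1 := block_region eps0_gt0 tau1_gt0 tau2_gt0 rho_ge0 G_ge0 G_bound W_bound GM WK
  (eta_gt0 _) (eta1 _) (eta2 _) (eta3 _) gx gm gv bstep (leqnn N).
by move: h1 h2 h3; rewrite !shiftN.
Qed.

Lemma block_move i : (i <= N)%N -> `|x (k * N + i)%N - bx k| <= sx * bh k.
Proof.
move=> iN; have := block_x eps0_gt0 tau1_gt0 tau2_gt0 rho_ge0 G_ge0 G_bound W_bound GM WK
  (eta_gt0 _) (eta1 _) (eta2 _) (eta3 _) gx gm gv bstep iN.
by rewrite shift0.
Qed.

Lemma block_lips : [/\ `|bx k.+1 - bx k| <= sx * bh k, `|bm k.+1 - bm k| <= sm * bh k &
  `|bp k.+1 - bp k| <= sp * bh k].
Proof.
have := block_lip N_gt0 eps0_gt0 tau1_gt0 tau2_gt0 rho_ge0 G_ge0 W_ge0 G_bound W_bound V_nonneg GM WK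
  (eta_gt0 _) (eta1 _) (eta2 _) (eta3 _) gx gm gv bstep.
by rewrite !shiftN !shift0.
Qed.

Lemma block_step : exists y gg : 'I_N -> 'rV[R]_n,
    let gbar := N%:R^-1 *: \sum_i gg i in
    [/\ forall i, Df i (y i) (gg i), forall i, `|y i - bx k| <= block_const * bh k,
        `|gbar| <= block_const,
        (forall c, `|bm k.+1 0 c - bm k 0 c - tau1 * bh k * (gbar 0 c - bm k 0 c)| <= block_const * bh k ^+ 2 /\
         `|bx k.+1 0 c - bx k 0 c + bh k * (bp k 0 c * (bm k 0 c + rho * gbar 0 c))| <= block_const * bh k ^+ 2) &
        forall c, bp k.+1 0 c - bp k 0 c <=
          bh k * (2 * tau1 * (bp k 0 c * (1 - eps0 * bp k 0 c ^+ 2))) + block_const * bh k ^+ 2].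
Proof.
have [_ [[_ sxC _ _] [GC mC xC pC]]] := block_constP.
have h0 : 0 <= bh k by rewrite mulr_ge0 ?ler0n ?(ltW (eta_gt0 _)).
have h2 := sqr_ge0 (bh k).
have [y [gg [y1 y2 gE]]] := block_reindex eps0_gt0 tau1_gt0 tau2_gt0 rho_ge0 G_ge0 G_bound W_bound GM WK
  (eta_gt0 _) (eta1 _) (eta2 _) (eta3 _) onto gx gm gv bstep.
exists y, gg => gbar; split=> //.
- by move=> i; move: (y2 i); rewrite shift0 => /le_trans; apply; rewrite ler_wpM2r.
- have := block_gbar N_gt0 eps0_gt0 tau1_gt0 tau2_gt0 rho_ge0 G_ge0 G_bound W_bound GM WK
    (eta_gt0 _) (eta1 _) (eta2 _) (eta3 _) gx gm gv bstep.
  by rewrite gE => /le_trans; apply.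
- move=> c; split.
    have := block_m_step N_gt0 eps0_gt0 tau1_gt0 tau2_gt0 rho_ge0 G_ge0 G_bound W_bound GM WK
      (eta_gt0 _) (eta1 _) (eta2 _) (eta3 _) gx gm gv bstep c.
    by rewrite gE !shiftN !shift0 => /le_trans; apply; rewrite ler_wpM2r.
  have := block_x_step N_gt0 eps0_gt0 tau1_gt0 tau2_gt0 rho_ge0 G_ge0 W_ge0 G_bound W_bound V_nonneg GM WK
    (eta_gt0 _) (eta1 _) (eta2 _) (eta3 _) gx gm gv bstep c.
  by rewrite gE !shiftN !shift0 => /le_trans; apply; rewrite ler_wpM2r.
move=> c; have := block_p_step N_gt0 eps0_gt0 tau1_gt0 tau2_gt0 tau12 rho_ge0 G_ge0 W_ge0 G_bound W_bound V_nonneg GM WK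
    (eta_gt0 _) (eta1 _) (eta2 _) (eta3 _) gx gm gv bstep c.
by rewrite !shiftN !shift0 => /le_trans; apply; rewrite lerD2l ler_wpM2r.
Qed.

End OneBlock.

Lemma blocks_scheme K : (forall k, (k < K)%N -> good k) ->
  [/\ `|bx K| <= r + 1, `|bm K| <= Mm & `|bv K| <= Kv] ->
  scheme Df eps0 tau1 rho block_const (invsqrt eps0 Kv)
    (fun k => bx k) (fun k => bm k) (fun k => bp k) (fun k => bh k) K.
Proof.
move=> gd gK; have [[_ rC MC pC] [[_ s1 s2 s3] _]] := block_constP.
have all k : (k <= K)%N -> [/\ `|bx k| <= r + 1, `|bm k| <= Mm & `|bv k| <= Kv].
  rewrite leq_eqVlt => /predU1P[->//|/gd[a b c]]; split=> //.
  by rewrite (le_trans a)// lerDl.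
have h0 k : 0 < bh k by rewrite mulr_gt0 ?ltr0n.
split=> // [k kK|k kK|k kK|k c kK|k kK|k kK].
- by have [a _ _] := all k kK; exact: le_trans rC.
- by have [_ a _] := all k kK; exact: le_trans MC.
- exact: le_trans (precond_norm eps0_gt0 _) pC.
- by have [_ _ a] := all k kK; exact: (precond_min eps0_gt0 W_ge0 WK c a).
- have [a b c] := block_lips (gd k kK).
  by split; [apply: le_trans a _|apply: le_trans b _|apply: le_trans c _]; rewrite ler_wpM2r ?(ltW (h0 k)).
- exact: block_step (gd k kK).
Qed.

Lemma block_time J : step_time (fun k => bh k) J = \sum_(k < J * N) eta k.
Proof.
elim: J => [|J IH]; first by rewrite /step_time !big_ord0.
rewrite step_timeS IH mulSnr big_split_ord/=; congr (_ + _).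
rewrite (eq_bigr (fun=> eta (J * N)%N)); last by move=> i _; exact: eta_const.
by rewrite sumr_const card_ord mulr_natl.
Qed.

End Iteration.

(** * Convergence of the algorithm *)

Lemma limn_esup_lt {R : realType} (u : nat -> R) (a b : R) :
  (limn_esup (fun k => (u k)%:E) <= a%:E)%E -> a < b -> exists k0, forall k, (k0 <= k)%N -> u k < b.
Proof.
move=> ua ab; have : (limn_esup (fun k => (u k)%:E) < b%:E)%E.
  by apply: le_lt_trans ua _; rewrite lte_fin.
move=> /ereal_inf_lt[_ [W [k0 _ k0W] <-] Wb]; exists k0 => k k0k.
rewrite -lte_fin; apply: le_lt_trans Wb; apply: ereal_sup_ubound.
by exists k => //; exact: k0W.
Qed.

Lemma limn_esup_le {R : realType} (u : nat -> \bar R) (a : \bar R) k0 :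
  (forall k, (k0 <= k)%N -> (u k <= a)%E) -> (limn_esup u <= a)%E.
Proof.
move=> ua; apply: (@le_trans _ _ (ereal_sup (u @` [set k | (k0 <= k)%N]))).
  by apply: ereal_inf_lbound; exists [set k | (k0 <= k)%N] => //; exists k0.
by apply: ge_ereal_sup => _ [k /= k0k <-]; exact: ua.
Qed.

Lemma partial_sums_unbounded {R : realType} (u : nat -> R) : (forall k, 0 <= u k) ->
  (\sum_(0 <= k <oo) (u k)%:E = +oo)%E -> forall T : R, exists K, T <= \sum_(k < K) u k.
Proof.
move=> u0 uoo T; apply: contrapT => nT.
suff : (\sum_(0 <= k <oo) (u k)%:E <= T%:E)%E by rewrite uoo.
apply: lime_le; first by apply: is_cvg_nneseries => k _ _; rewrite lee_fin.
apply: nearW => K; rewrite sumEFin lee_fin big_mkord leNgt; apply/negP => /ltW TK.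
by apply: nT; exists K.
Qed.

Lemma triple_bounded {R : realType} {n : nat} (X : set ('rV[R]_n * 'rV[R]_n * 'rV[R]_n)) : compact X ->
  exists2 K : R, 0 < K & forall a b c, X (a, b, c) -> [/\ `|a| <= K, `|b| <= K & `|c| <= K].
Proof.
move=> /compact_bounded[K0 [_ KP]]; exists (Num.max 1 (K0 + 1)); first by rewrite lt_max ltr01.
move=> a b c abc; have K1 : K0 < Num.max 1 (K0 + 1) by rewrite lt_max ltrDl ltr01 orbT.
have := KP _ K1 _ abc; rewrite /= prod_normE/= prod_normE/= !ge_max => /andP[/andP[]].
by [].
Qed.

Lemma vdist_le {R : realType} {n : nat} (x y : 'rV[R]_n) A (e : R) : A y -> n%:R * `|x - y| <= e ->
  (vdist x A <= e%:E)%E.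
Proof.
move=> Ay xy; apply: (@le_trans _ _ (enorm (x - y))%:E).
  by apply: ereal_inf_lbound; exists y.
by rewrite lee_fin (le_trans (enorm_le_norm _)).
Qed.

Lemma rdist_le {R : realType} (a b : R) A (e : R) : A b -> `|a - b| <= e -> (rdist a A <= e%:E)%E.
Proof.
move=> Ab ab; apply: (@le_trans _ _ (`|a - b|)%:E); last by rewrite lee_fin.
by apply: ereal_inf_lbound; exists b.
Qed.

Theorem corollary5p5 (R : realType)
    (S : forall m : nat, set (set 'rV[R]_m)) (S_omin : o_minimal S)
    (n N : nat) (N_gt0 : (0 < N)%N)
    (f : 'I_N -> 'rV[R]_n -> R) (Df : 'I_N -> 'rV[R]_n -> set 'rV[R]_n)
    (f_coercive : coercive (avg_fun f))
    (f_definable : forall i, definable_fun S (f i))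
    (f_lipschitz : forall i, locally_lipschitz (f i))
    (Df_definable : forall i, definable_map S (Df i))
    (Df_conservative : forall i, conservative_field_for (f i) (Df i))
    (eps0 tau1 tau2 rho : R)
    (eps0_gt0 : 0 < eps0) (tau1_gt0 : 0 < tau1) (tau2_gt0 : 0 < tau2)
    (tau12 : tau2 <= 4 * tau1) (rho_ge0 : 0 <= rho)
    (V : 'rV[R]_n * 'rV[R]_n -> set 'rV[R]_n)
    (V_nonneg : forall z, V z `<=` nonneg_orthant)
    (V_nonempty : forall z, V z !=set0)
    (V_convex : forall z, convex_set (V z))
    (V_compact : forall z, compact (V z))
    (V_bounded : locally_bounded V)
    (V_closed : graph_closed V)
    (X : set ('rV[R]_n * 'rV[R]_n * 'rV[R]_n)) (X_compact : compact X) :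
  exists2 alpha_ub : R, 0 < alpha_ub &
  forall eps : R, 0 < eps -> exists2 alpha : R, 0 < alpha &
  forall eta : nat -> R,
    (forall k, 0 < eta k) ->
    (\sum_(0 <= k <oo) (eta k)%:E = +oo)%E ->
    (forall k1 k2 : nat, (k1 %/ N)%N = (k2 %/ N)%N -> eta k1 = eta k2) ->
    (ereal_sup [set (eta k)%:E | k in [set: nat]] <= alpha_ub%:E)%E ->
    (limn_esup (fun k => (eta k)%:E) <= alpha%:E)%E ->
  forall idx : nat -> 'I_N,
    (forall j : nat,
      [set idx k | k in [set k | (j * N <= k < j.+1 * N)%N]] = setT) ->
  forall x m v g : nat -> 'rV[R]_n,
    X (x 0%N, m 0%N, v 0%N) ->
    (forall k : nat,
      [/\ Df (idx k) (x k) (g k),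
          m k.+1 = m k + (tau1 * eta k) *: (g k - m k),
          [set v k + (tau2 * eta k) *: (w - v k) | w in V (x k, m k.+1)]
            (v k.+1) &
          x k.+1 = x k - eta k *:
            map2_mx *%R
              (map_mx (fun t => (t + eps0) `^ (- 2^-1)) (proj_nonneg (v k.+1)))
              (m k.+1 + rho *: g k)]) ->
    (limn_esup (fun k => vdist (x k) (crit_points (avg_field Df)))
       <= eps%:E)%E /\
    (limn_esup (fun k => rdist (avg_fun f (x k))
                           (avg_fun f @` crit_points (avg_field Df)))
       <= eps%:E)%E.

Proof.
have Dusc i : usc_field (Df i) by case: (Df_conservative i) => -[].
have Vusc : usc_field V by split.
have p_gt0 := pmax_gt0 eps0_gt0.
have [K0 K0_gt0 K0P] := triple_bounded X_compact.
(* [l] bounds the initial energy; once the trap lemma confines the energies below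
   [l + 1], coercivity confines the starting points of the passes to a ball *)
have C0_ge1 : 1 <= 1 + K0 + pmax eps0 by lra.
have [l l_gt0 lP] := energy_bounded f_lipschitz tau1_gt0 C0_ge1.
have [r1 r1P] := sublevel_bounded f_coercive (l + 1).
pose r := Num.max 0 r1.
have r_ge0 : 0 <= r by rewrite le_max lexx.
have rP x : avg_fun f x <= l + 1 -> `|x| <= r.
  by move=> /r1P h; rewrite le_max h orbT.
have [G G_ge0 G_bound] : exists2 G : R, 0 <= G & forall i y g, `|y| <= r + 1 -> Df i y g -> `|g| <= G.
  have ex i : exists M : R, 0 < M /\ forall y g, `|y| <= r + 1 -> Df i y g -> `|g| <= M.
    have [M M0 MP] := compact_field_bound (Dusc i) (@closed_ball_compact R n (r + 1)).
    by exists M; split => // y g yr; exact: MP.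
  have [M MP] := choice ex.
  exists (\sum_i M i); first by apply: sumr_ge0 => i _; exact/ltW/(MP i).1.
  move=> i y g yr gD; apply: (le_trans ((MP i).2 y g yr gD)).
  by rewrite (bigD1 i)//= lerDl sumr_ge0// => j _; exact/ltW/(MP j).1.
(* the moments are convex combinations of their initial values and of bounded
   vectors, which gives [Mm] and [Kv] *)
pose Mm := K0 + G.
have [W W_ge0 W_bound] : exists2 W : R, 0 <= W &
    forall y mu w, `|y| <= r + 1 -> `|mu| <= Mm -> V (y, mu) w -> `|w| <= W.
  have cK := compact_setX (@closed_ball_compact R n (r + 1)) (@closed_ball_compact R n Mm).
  have [W W0 WP] := compact_field_bound Vusc cK.
  by exists W; [exact: ltW|move=> y mu w yr muM; apply: WP].
pose Kv := K0 + W.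
have GM : G <= Mm by rewrite lerDr ltW.
have WK : W <= Kv by rewrite lerDr ltW.
pose C := block_const eps0 tau1 tau2 rho r G Mm W Kv.
have [[C_ge1 _ _ _] [[sx_ge0 _ _ _] _]] :=
  block_constP eps0_gt0 tau1_gt0 tau2_gt0 rho_ge0 r_ge0 G_ge0 W_ge0 GM WK.
rewrite -/C in C_ge1.
set sx := speed _ _ _ _ in sx_ge0.
have pmin_gt0 : 0 < invsqrt eps0 Kv by rewrite invsqrt_gt0// (le_trans W_ge0).
have [d d_gt0 d_trap] := trap S_omin f_coercive f_definable f_lipschitz Df_definable
  Df_conservative eps0_gt0 tau1_gt0 rho_ge0 C_ge1 pmin_gt0 l ltr01.
have N0 : 0 < N%:R :> R by rewrite ltr0n.
have sx1 : 0 < sx + 1 by rewrite ltr_wpDl.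
have inv (a b t : R) : 0 < a -> t <= b / a -> a * t <= b.
  by move=> a0; rewrite ler_pdivlMr// mulrC.
exists (Num.min (Num.min (1 / tau1) (1 / tau2)) (Num.min (1 / (N%:R * (sx + 1))) (d / N%:R))).
  by rewrite !lt_min !divr_gt0// mulr_gt0.
(* the Euclidean norm is at most [n] times the sup norm *)
move=> eps eps_gt0; pose th := eps / n.+1%:R.
have th_gt0 : 0 < th by rewrite divr_gt0 ?ltr0n.
have [d' d'_gt0 d'_near] := eventually_near_critical S_omin f_coercive f_definable f_lipschitz Df_definable
  Df_conservative eps0_gt0 tau1_gt0 rho_ge0 C_ge1 pmin_gt0 th_gt0.
pose alpha := d' / (N%:R * (sx + 1)).
have alpha_gt0 : 0 < alpha by rewrite divr_gt0 ?mulr_gt0.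
exists (alpha / 2); first by rewrite divr_gt0.
move=> eta eta_gt0 eta_oo eta_block eta_sup eta_lim idx idx_onto x m v g init step0.
have step k : [/\ Df (idx k) (x k) (g k),
          m k.+1 = m k + (tau1 * eta k) *: (g k - m k),
          [set v k + (tau2 * eta k) *: (w - v k) | w in V (x k, m k.+1)]
            (v k.+1) &
          x k.+1 = x k - eta k *:
            map2_mx *%R (precond eps0 (v k.+1)) (m k.+1 + rho *: g k)].
  by have := step0 k; rewrite /precond -lock.
have eta_ub k : [/\ tau1 * eta k <= 1, tau2 * eta k <= 1, N%:R * eta k * sx <= 1 & N%:R * eta k <= d].
  have : eta k <= Num.min (Num.min (1 / tau1) (1 / tau2)) (Num.min (1 / (N%:R * (sx + 1))) (d / N%:R)).
    by rewrite -lee_fin; apply: le_trans eta_sup; apply: ereal_sup_ubound; exists k.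
  rewrite !le_min => /andP[/andP[e1 e2] /andP[e3 e4]]; split; try by apply: inv.
  have := inv _ _ _ (mulr_gt0 N0 sx1) e3; rewrite mulrAC.
  by apply: le_trans; rewrite ler_wpM2l ?mulr_ge0 ?ler0n ?(ltW (eta_gt0 k))// lerDl.
have eta1 k : tau1 * eta k <= 1 by have [] := eta_ub k.
have eta2 k : tau2 * eta k <= 1 by have [] := eta_ub k.
have eta3 k : N%:R * eta k * sx <= 1 by have [] := eta_ub k.
have eta4 k : N%:R * eta k <= d by have [] := eta_ub k.
have h_gt0 k : 0 < N%:R * eta k by rewrite mulr_gt0.
pose isgood := good (N := N) r Mm Kv x m v.
pose en k := energy f tau1 (x (k * N)%N) (m (k * N)%N) (precond eps0 (v (k * N)%N)).
have f_en k : avg_fun f (x (k * N)%N) <= en k.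
  rewrite lerDl mulr_ge0 ?invr_ge0 ?mulr_ge0 ?(ltW tau1_gt0)// sumr_ge0// => c _.
  by rewrite mulr_ge0 ?sqr_ge0 ?(ltW (precond_gt0 _ _ _)).
have [x0K m0K v0K] := K0P _ _ _ init.
have en0 : en 0%N <= l.
  apply: (le_trans (ler_norm _)); rewrite /en mul0n; apply: lP.
  - lra.
  - lra.
  - by apply: (le_trans (precond_norm eps0_gt0 _)); lra.
have to_scheme K := blocks_scheme N_gt0 eps0_gt0 tau1_gt0 tau2_gt0 tau12 rho_ge0 r_ge0 G_ge0 W_ge0
  G_bound W_bound V_nonneg GM WK eta_gt0 eta_block eta1 eta2 eta3 idx_onto step (K := K).
have all_good K : forall k, (k <= K)%N -> isgood k.
  elim: K => [|K IH] k.
    rewrite leqn0 => /eqP ->; split; rewrite mul0n.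
    + by have := f_en 0%N; rewrite mul0n => h1; apply: rP; lra.
    + by rewrite /Mm; lra.
    + by rewrite /Kv; lra.
  rewrite leq_eqVlt => /predU1P[->|]; last exact: IH.
  have [e1 e2 e3] := block_end N_gt0 eps0_gt0 tau1_gt0 tau2_gt0 rho_ge0 G_ge0 G_bound W_bound GM WK
    eta_gt0 eta_block eta1 eta2 eta3 step (IH K (leqnn K)).
  split=> //; apply: rP; apply: (le_trans (f_en _)).
  (* the pass that ends at [K.+1] may leave the ball of radius [r] but not that of
     radius [r + 1], so the iteration up to there is a scheme and is trapped *)
  have S0 := to_scheme K.+1 (fun k kK => IH k kK) (And3 e1 e2 e3).
  apply: (d_trap _ _ _ _ _ S0) => [k' _|]; first exact: eta4.
  exact: en0.
have goods k : isgood k by exact: all_good (leqnn k).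
have schemes K : scheme Df eps0 tau1 rho C (invsqrt eps0 Kv) (fun k => x (k * N)%N)
   (fun k => m (k * N)%N) (fun k => precond eps0 (v (k * N)%N)) (fun k => N%:R * eta (k * N)%N) K.
  apply: to_scheme => [k _|]; first exact: goods.
  by have [a b c] := goods K; split=> //; rewrite (le_trans a)// lerDl.
have alpha2 : alpha / 2 < alpha by lra.
have [k1 k1P] := limn_esup_lt eta_lim alpha2.
have small k : (k1 <= k)%N -> N%:R * eta k * (sx + 1) <= d'.
  move=> /k1P/ltW h1; rewrite mulrAC; apply: inv => //; exact: mulr_gt0.
have small_h k : (k1 <= k)%N -> N%:R * eta k <= d'.
  move=> /small; apply: le_trans; rewrite ler_pMr ?lerDr//.
have small_x k : (k1 <= k)%N -> sx * (N%:R * eta k) <= d'.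
  move=> /small; apply: le_trans; rewrite mulrC ler_pM2l// lerDl//.
have kN k : (k <= k * N)%N by rewrite leq_pmulr.
have late K := scheme_sub (k := k1) (L := K) (schemes (k1 + K)%N) (leqnn _).
have late_h k : N%:R * eta ((k1 + k) * N)%N <= d'.
  by apply: small_h; apply: leq_trans (kN _); exact: leq_addr.
have late_oo (T : R) : exists K, T <= step_time (fun k => N%:R * eta ((k1 + k) * N)%N) K.
  pose h k := N%:R * eta (k * N)%N.
  have [K KP] := partial_sums_unbounded (fun k => ltW (eta_gt0 k)) eta_oo (step_time h k1 + T).
  exists K; suff : step_time h k1 + T <= step_time h (k1 + K)%N.
    by rewrite {2}/step_time big_split_ord/= lerD2l.
  rewrite {2}/h (block_time N_gt0 eta_block) (le_trans KP)//.
  have KK : (K <= (k1 + K) * N)%N by rewrite (leq_trans _ (kN _))// leq_addl.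
  rewrite -(subnKC KK) big_split_ord/= lerDl sumr_ge0// => i _; exact: ltW.
have [k0 k0P] := d'_near _ _ _ _ late late_h late_oo.
have final k : ((k1 + k0).+1 * N <= k)%N -> exists xs, [/\ crit_dual Df xs,
    `|x k - xs| <= th & `|avg_fun f (x k) - avg_fun f xs| <= th].
  move=> kk; pose j := (k %/ N)%N.
  have jk : (k1 + k0 <= j)%N by rewrite leq_divRL// (leq_trans _ kk)// leq_mul2r leqnSn orbT.
  have k1j : (k1 <= j)%N := leq_trans (leq_addr _ _) jk.
  have jE : (k1 + (j - k1))%N = j by exact: subnKC.
  have jk0 : (k0 <= j - k1)%N by rewrite leq_subRL.
  have [xs [cxs _ near_xs]] := k0P _ jk0; exists xs.
  have [|a b] := near_xs (x k); last by split.
  rewrite /= jE [in x k](divn_eq k N) -/j.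
  apply: le_trans (block_move N_gt0 eps0_gt0 tau1_gt0 tau2_gt0 rho_ge0 G_ge0 G_bound W_bound GM WK
    eta_gt0 eta_block eta1 eta2 eta3 step (goods j) (ltnW (ltn_pmod k N_gt0))) _.
  by apply: small_x; apply: leq_trans k1j (kN _).
have n1 : 0 < n.+1%:R :> R by rewrite ltr0n.
split; apply: (limn_esup_le (k0 := ((k1 + k0).+1 * N)%N)) => k /final[xs [cxs xk fk]].
  apply: (vdist_le (y := xs)); first exact: crit_dual_avg_field.
  rewrite (le_trans (ler_wpM2l (ler0n _ _) xk))// /th mulrA ler_pdivrMr// mulrC ler_pM2l//.
  by rewrite ler_nat.
apply: (rdist_le (b := avg_fun f xs)); first by exists xs => //; exact: crit_dual_avg_field.
rewrite (le_trans fk)// /th ler_pdivrMr// ler_peMr ?(ltW eps_gt0)// ler1n//.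
Qed.
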